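(* Let $k\ge 0$. The map $Z^{alg}_k:\mathrm{Fil}^W_k(\mathcal{MD})\to\mathbb{R}[T]$ satisfies: (i) if $s_1,\dots,s_l\ge 1$ are integers with $s_1+\dots+s_l<k$, then $Z^{alg}_k([s_1,\dots,s_l])=0$; (ii) for every $f\in\mathrm{Fil}^W_{k-2}(\mathcal{MD})$ one has $Z^{alg}_k(\mathrm{d}f)=0$, where $\mathrm{d}=q\frac{d}{dq}$; (iii) if $f\in\mathrm{Fil}^W_k(\mathcal{MD})$ is (the $q$-expansion of) a cusp form of weight $k$ for $\mathrm{SL}_2(\mathbb{Z})$, then $Z^{alg}_k(f)=0$.
   Context: For integers $r_1,\dots,r_l\ge 0$ and $n\ge 1$ let $\sigma_{r_1,\dots,r_l}(n)=\sum v_1^{r_1}\cdots v_l^{r_l}$, summed over positive integers $u_1>\dots>u_l>0$, $v_1,\dots,v_l>0$ with $u_1v_1+\dots+u_lv_l=n$. For integers $s_1,\dots,s_l\ge1$ the bracket is $[s_1,\dots,s_l]=\frac{1}{(s_1-1)!\cdots(s_l-1)!}\sum_{n>0}\sigma_{s_1-1,\dots,s_l-1}(n)q^n\in\mathbb{Q}[[q]]$, of weight $s_1+\dots+s_l$; $[\emptyset]=1$ has weight $0$. $\mathcal{MD}$ is the $\mathbb{Q}$-span of $1$ and all brackets (a $\mathbb{Q}$-algebra under multiplication of power series), and $\mathrm{Fil}^W_k(\mathcal{MD})$ is the span of $1$ and the brackets of weight $\le k$. A bracket is admissible if $s_1>1$; $\mathcal{MD}^{adm}$ is the span of $1$ and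 all admissible brackets, a subalgebra, and $\mathrm{Fil}^W_j(\mathcal{MD}^{adm})$ is the span of $1$ and admissible brackets of weight $\le j$. All these series converge for $0<q<1$. For $g\in\mathrm{Fil}^W_j(\mathcal{MD}^{adm})$ put $Z_j(g)=\lim_{q\to1^-}(1-q)^j g(q)$ (this limit exists). Every $f\in\mathrm{Fil}^W_k(\mathcal{MD})$ can be written as $f=\sum_{j=0}^k g_j\,[1]^{k-j}$ with $g_j\in\mathrm{Fil}^W_j(\mathcal{MD}^{adm})$, the $g_j$ being uniquely determined since $[1]$ is algebraically independent over $\mathcal{MD}^{adm}$; one defines $Z^{alg}_k(f)=\sum_{j=0}^k Z_j(g_j)T^{k-j}\in\mathbb{R}[T]$. *)

(* Defs.v *)
From HB Require Import structures.
From mathcomp Require Import all_boot all_order all_algebra.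
From mathcomp Require Import all_classical all_reals all_analysis.
From mathcomp Require Import complex.

Set Implicit Arguments.
Unset Strict Implicit.
Unset Printing Implicit Defensive.

Import Order.TTheory GRing.Theory Num.Theory.
Import numFieldNormedType.Exports.

Local Open Scope classical_set_scope.
Local Open Scope ring_scope.
Local Open Scope complex_scope.

(* A power series in Q[[q]] is its coefficient sequence.  The pointwise +, *:
   and \sum on functions are those of Q[[q]]; the pointwise * is not, hence
   [psmul]. *)
Definition qseries := nat -> rat.

Definition psmul (f g : qseries) : qseries :=
  fun n => \sum_(i < n.+1) f i * g (n - i)%N.

Definition psone : qseries := fun n => (n == 0%N)%:R.

Definition psexp (f : qseries) (m : nat) : qseries := iter m (psmul f) psone.

(* q d/dq *)
Definition qder (f : qseries) : qseries := fun n => n%:R * f n.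

(* The bound u_i, v_i <= n loses nothing: all u_i, v_i are positive and
   \sum_i u_i v_i = n.  The largest is u_0.  For r = [::] this is 1 at n = 0 and 0 elsewhere; for
   r != [::] it is 0 at n = 0. *)
Definition sigma (r : seq nat) (n : nat) : nat :=
  (\sum_(u : {ffun 'I_(size r) -> 'I_n.+1})
   \sum_(v : {ffun 'I_(size r) -> 'I_n.+1}
         | [&& [forall i, (0 < u i)%N && (0 < v i)%N],
               [forall i : 'I_(size r), forall j : 'I_(size r), (i < j)%N ==> (u j < u i)%N]
             & (\sum_i u i * v i)%N == n])
     \prod_i v i ^ nth 0 r i)%N.

(* By the values of [sigma] above, [bracket [::]] is the constant series 1 and
   the other brackets have no constant term. *)
Definition bracket (s : seq nat) : qseries :=
  fun n => (sigma [seq x.-1 | x <- s] n)%:R / (\prod_(x <- s) (x.-1)`!)%:R.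

Definition is_index (s : seq nat) : bool := all (leq 1) s.

Definition admissible (s : seq nat) : bool :=
  is_index s && (if s is s1 :: _ then (1 < s1)%N else true).

(* The Q-span of the brackets [bracket s] with [S s]. *)
Definition bracket_span (S : pred (seq nat)) (f : qseries) : Prop :=
  exists2 c : seq (rat * seq nat),
    all (fun p => S p.2) c & f = \sum_(p <- c) p.1 *: (bracket p.2 : nat -> rat^o).

Definition FilMD (k : nat) : qseries -> Prop :=
  bracket_span (fun s => is_index s && (sumn s <= k)%N).

Definition FilMDadm (k : nat) : qseries -> Prop :=
  bracket_span (fun s => admissible s && (sumn s <= k)%N).

Section Zalg.
Variable R : realType.

Definition pseval (f : qseries) (q : R) : R :=
  limn (pseries (fun n => ratr (f n)) q).

(* Z_j(g) = z *)
Definition is_Z (j : nat) (g : qseries) (z : R) : Prop :=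
  (1 - q) ^+ j * pseval g q @[q --> (1 : R)^'-] --> z.

Definition bracket1_expansion (k : nat) (f : qseries) (g : nat -> qseries) :=
  (forall j, (j <= k)%N -> FilMDadm j (g j)) /\
  f = \sum_(j < k.+1) (psmul (g j) (psexp (bracket [:: 1%N]) (k - j)) : nat -> rat^o).

(* The graph of Z^alg_k, a map on Fil_k(MD); T is 'X. *)
Definition Zalg_graph (k : nat) (f : qseries) (P : {poly R}) : Prop :=
  FilMD k f /\
  exists (g : nat -> qseries) (z : nat -> R),
    [/\ bracket1_expansion k f g,
        forall j, (j <= k)%N -> is_Z j (g j) (z j)
      & P = \sum_(j < k.+1) z j *: 'X^(k - j)].

(* "Z^alg_k(f) = P": f lies in the domain of Z^alg_k, and the value of Z^alg_k at
   f exists, is unique and equals P.  No default value is involved. *)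
Definition Zalg_eq (k : nat) (f : qseries) (P : {poly R}) : Prop :=
  forall Q : {poly R}, Zalg_graph k f Q <-> Q = P.

(* exp (x + iy) = exp x (cos y + i sin y) *)
Definition cexp (z : R[i]) : R[i] :=
  (expR (complex.Re z))%:C * (cos (complex.Im z) +i* sin (complex.Im z)).

(* q = exp (2 pi i tau) *)
Definition qparam (tau : R[i]) : R[i] := cexp ((0 +i* (2 * pi)) * tau).

(* Modular forms of weight k for SL_2(Z), given as functions on R[i] of which
   only the values on the upper half-plane matter.  Differentiability is over
   the field R[i], i.e. complex differentiability. *)
Definition holomorphic_uhp (F : R[i] -> R[i]) : Prop :=
  forall tau : R[i], 0 < complex.Im tau -> derivable (F : R[i]^o -> R[i]^o) tau 1.

Definition modular_uhp (k : nat) (F : R[i] -> R[i]) : Prop :=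
  forall a b c d : int, a * d - b * c = 1 ->
  forall tau : R[i], 0 < complex.Im tau ->
    F ((a%:~R * tau + b%:~R) / (c%:~R * tau + d%:~R)) =
    (c%:~R * tau + d%:~R) ^+ k * F tau.

Definition has_qexpansion (F : R[i] -> R[i]) (f : qseries) : Prop :=
  forall tau : R[i], 0 < complex.Im tau ->
    (series (fun n => ratr (f n) * qparam tau ^+ n) : nat -> R[i]^o) @ \oo
      --> (F tau : R[i]^o).

(* f is the q-expansion of a cusp form: holomorphy at the cusp is the existence
   of the expansion in nonnegative powers of q, cuspidality is f 0 = 0. *)
Definition is_cusp_form (k : nat) (f : qseries) : Prop :=
  (exists F : R[i] -> R[i],
    [/\ holomorphic_uhp F, modular_uhp k F & has_qexpansion F f]) /\
  f 0%N = 0.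

End Zalg.

Arguments is_cusp_form : clear implicits.

(* Main.v *)
From HB Require Import structures.
Require Import Defs.
From mathcomp Require Import all_boot all_order all_algebra.
From mathcomp Require Import all_classical all_reals all_analysis.
From mathcomp Require Import complex.
From mathcomp Require Import ring lra zify.

(* On Fil_k(MD), Z^alg_k(f) is the unique polynomial P such that
   (1 - q)^k f(q) - P(T(q)) tends to 0 as q tends to 1, where T(q) = (1 - q) [1](q)
   tends to infinity like -log(1 - q).  The reason is that for g in
   Fil_j(MD^adm) the function (1 - q)^j g(q) approaches its limit at the rate
   O(sqrt(1 - q)), up to terms that are a positive power of 1 - q times a power
   of T; this beats every power of T.  Hence Z^alg_k(f) = 0 as soon as
   (1 - q)^k f(q) tends to 0.  For brackets of weight < k this is a growth
   estimate; for df it follows from the estimate n q^n <= 2/(1-q) ((1+q)/2)^n;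
   for a cusp form it follows from tau |-> -1/tau on the imaginary axis.

   Writing [s] in terms of the sums of prod_i K(u_i)^(s_i) over
   u_1 > ... > u_l, with K(u) = q^u/(1 - q^u), turns the product into a
   homogeneous quasi-shuffle product; this gives the expansions in powers of [1].
   That d maps Fil_(k-2) to Fil_k comes from comparing this product with [2] with
   the one obtained after conjugating partitions, where [s] becomes a sum over
   V_1 < ... < V_l of a monomial in the gaps times prod_i K(V_i). *)

Set Implicit Arguments.
Unset Strict Implicit.
Unset Printing Implicit Defensive.

Import Order.TTheory GRing.Theory Num.Theory.
Local Open Scope ring_scope.

(** * The ring of power series *)


(** Two obstacles shape the argument. The series sum_v v^(s-1)/(s-1)! q^(uv) attached to an entry s
    is not a power of K(u), so products of brackets are not homogeneous. Replacing v^(s-1)/(s-1)! by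
    'C(v-1, s-1), which has the same leading coefficient in v and yields K(u)^s exactly, changes a
    bracket only by terms of lower weight; expansions and growth bounds are therefore obtained
    through the modified sums by induction on the weight. Secondly, the bare limit of (1 - q)^j g(q)
    says nothing about its product with a power of T, so a rate is needed. The defect 1/u - (1 - q)
    K(u) is nonnegative and at most both 1/u and 1 - q, hence at most their geometric mean sqrt((1 -
    q)/u). The bound 1 - q alone would lead to a sum of u u^(-2) log^m u, which diverges; the
    geometric mean leaves u^(-3/2) log^m u, which is summable. *)

HB.instance Definition _ := GRing.Lmodule.copy qseries (nat -> rat^o).

Lemma qserD (f g : qseries) n : (f + g) n = f n + g n.
Proof. by []. Qed.

Lemma qserN (f : qseries) n : (- f) n = - f n.
Proof. by []. Qed.

Lemma qserZ c (f : qseries) n : (c *: f) n = c * f n.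
Proof. by []. Qed.

Lemma qser0 n : (0 : qseries) n = 0.
Proof. by []. Qed.

Lemma qser_sum (I : Type) (r : seq I) (P : pred I) (F : I -> qseries) n :
  (\sum_(i <- r | P i) F i) n = \sum_(i <- r | P i) F i n.
Proof. by elim/big_rec2: _ => // i x y _ <-. Qed.

(** The n-th coefficient of a Cauchy product depends only on the coefficients up to n, so the ring
    axioms for [psmul] are inherited from polynomials through truncation. *)
Definition qtrunc (N : nat) (f : qseries) : {poly rat} := \poly_(i < N.+1) f i.

Lemma psmul_qtrunc N n (f g : qseries) : (n <= N)%N ->
  psmul f g n = (qtrunc N f * qtrunc N g)`_n.
Proof.
move=> nN; rewrite coefM; apply: eq_bigr => i _.
by rewrite !coef_poly !ifT //; have := ltn_ord i; lia.
Qed.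

Lemma coef_mul_eq (p p' q : {poly rat}) n :
  (forall i, (i <= n)%N -> p`_i = p'`_i) -> (p * q)`_n = (p' * q)`_n.
Proof.
move=> pp'; rewrite !coefM; apply: eq_bigr => i _; rewrite pp' //.
by have := ltn_ord i; lia.
Qed.

Lemma psmulC : commutative psmul.
Proof.
by move=> f g; apply/funext => n; rewrite !(psmul_qtrunc _ _ (leqnn n)) mulrC.
Qed.

Lemma psmulA : associative psmul.
Proof.
move=> f g h; apply/funext => n; rewrite !(psmul_qtrunc _ _ (leqnn n)).
transitivity ((qtrunc n f * qtrunc n g * qtrunc n h)`_n).
  rewrite -mulrA ![qtrunc n f * _]mulrC; apply: coef_mul_eq => i le_i.
  by rewrite coef_poly ltnS le_i (psmul_qtrunc _ _ le_i).
apply: coef_mul_eq => i le_i.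
by rewrite [RHS]coef_poly ltnS le_i (psmul_qtrunc _ _ le_i).
Qed.

Lemma psmul1l : left_id psone psmul.
Proof.
move=> f; apply/funext => n; rewrite /psmul big_ord_recl big1 => [|i _].
  by rewrite mul1r subn0 addr0.
by rewrite /psone /= mul0r.
Qed.

Lemma psmulDl : left_distributive psmul +%R.
Proof.
move=> f g h; apply/funext => n; rewrite qserD -big_split /=.
by apply: eq_bigr => i _; rewrite qserD mulrDl.
Qed.

Lemma psone_neq0 : psone != 0 :> qseries.
Proof. by apply/eqP => /(congr1 (fun f : qseries => f 0%N)). Qed.

HB.instance Definition _ := GRing.Zmodule_isComNzRing.Build qseries
  psmulA psmulC psmul1l psmulDl psone_neq0.

Lemma psmul_scalel (c : rat) (f g : qseries) : c *: (f * g) = (c *: f) * g.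
Proof.
apply/funext => n; rewrite qserZ [LHS]mulr_sumr; apply: eq_bigr => i _.
by rewrite qserZ mulrA.
Qed.

HB.instance Definition _ := GRing.Lmodule_isLalgebra.Build rat qseries
  psmul_scalel.

Lemma psmul_scaler (c : rat) (f g : qseries) : c *: (f * g) = f * (c *: g).
Proof. by rewrite mulrC psmul_scalel mulrC. Qed.

HB.instance Definition _ := GRing.Lalgebra_isAlgebra.Build rat qseries
  psmul_scaler.


Lemma qserM (f g : qseries) n : (f * g) n = \sum_(i < n.+1) f i * g (n - i)%N.
Proof. by []. Qed.

Lemma qser1 n : (1 : qseries) n = (n == 0%N)%:R.
Proof. by []. Qed.

Lemma psexpE (f : qseries) m : psexp f m = f ^+ m.
Proof. by elim: m => //= m IH; rewrite /psexp /= -/(psexp f m) IH exprS. Qed.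

Lemma qderD (f g : qseries) : qder (f + g) = qder f + qder g.
Proof. by apply/funext => n; rewrite /qder !qserD mulrDr. Qed.

Lemma qderZ (c : rat) (f : qseries) : qder (c *: f) = c *: qder f.
Proof. by apply/funext => n; rewrite /qder !qserZ mulrCA. Qed.

Lemma qder0 : qder (0 : qseries) = 0.
Proof. by apply/funext => n; rewrite /qder qser0 mulr0. Qed.

Lemma qder1 : qder (1 : qseries) = 0.
Proof. by apply/funext => -[|n]; rewrite /qder qser1 ?mul0r ?mulr0. Qed.

Lemma qderM (f g : qseries) : qder (f * g) = qder f * g + f * qder g.
Proof.
apply/funext => n; rewrite /qder qserD !qserM mulr_sumr -big_split /=.
apply: eq_bigr => i _; have -> : n%:R = i%:R + (n - i)%:R :> rat.
  by rewrite -natrD subnKC // -ltnS.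
by rewrite mulrDl; congr (_ + _); ring.
Qed.

(** Congruence modulo q^(N+1). Infinite sums over u are never formed: they are replaced by finite
    sums that agree with them in this sense. *)
Definition eqq (N : nat) (f g : qseries) := forall n, (n <= N)%N -> f n = g n.

Lemma eqqM N f f' g g' : eqq N f f' -> eqq N g g' -> eqq N (f * g) (f' * g').
Proof.
move=> ff gg n nN; rewrite !qserM; apply: eq_bigr => i _.
have := ltn_ord i => iN; rewrite ff ?gg //; lia.
Qed.

Definition qXn (a : nat) : qseries := fun n => (n == a)%:R.

Lemma qXnM a (f : qseries) n :
  (qXn a * f) n = if (a <= n)%N then f (n - a)%N else 0.
Proof.
rewrite qserM; case: leqP => [an|na].
  rewrite (bigD1 (Ordinal (_ : a < n.+1)%N)) //= big1 => [|i /negPf ia].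
    by rewrite /qXn eqxx mul1r addr0.
  rewrite /qXn; move: ia; rewrite -val_eqE /= => ->; exact: mul0r.
rewrite big1 // => i _; rewrite /qXn; case: eqP => [ia|_]; last exact: mul0r.
by have := ltn_ord i; lia.
Qed.

Lemma qXnD a b : qXn (a + b) = qXn a * qXn b.
Proof.
apply/funext => n; rewrite qXnM /qXn; case: leqP => h.
  by have -> : (n == a + b)%N = (n - a == b)%N by lia.
by have -> : (n == a + b)%N = false by lia.
Qed.

Lemma qXn0 : qXn 0 = 1.
Proof. by []. Qed.

(* q^u / (1 - q^u); the condition excludes the exponent 0. *)
Definition lser (u : nat) : qseries := fun n => ((0 < n) && (u %| n))%N%:R.

Lemma lserE u : (0 < u)%N -> lser u = qXn u * (1 + lser u).
Proof.
move=> u0; apply/funext => n; rewrite qXnM qserD qser1 /lser.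
case: (leqP u n) => un; last first.
  by case: n un => // n un; rewrite gtnNdvd.
rewrite dvdn_subl // subn_gt0 subn_eq0.
have [->|nu] := eqVneq n u; first by rewrite dvdnn ltnn leqnn u0 addr0.
have ->: (n <= u)%N = false by apply/negbTE; lia.
have -> : (u < n)%N by lia.
have -> : (0 < n)%N by lia.
by rewrite add0r.
Qed.

(** Differentiating (1 - q^u)(1 + K) = 1, with K = [lser u], gives (1 - q^u) K' = u q^u (1 + K) = u
    K; it remains to multiply by 1 + K, the inverse of 1 - q^u. *)
Lemma qder_lser u : (0 < u)%N ->
  qder (lser u) = u%:R *: (lser u + lser u ^+ 2).
Proof.
move=> u0.
have X1 : (1 - qXn u) * (1 + lser u) = 1.
  by rewrite mulrBl mul1r -lserE // -addrA subrr addr0.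
have dX : qder (qXn u) = u%:R *: qXn u.
  apply/funext => n; rewrite /qder qserZ /qXn.
  by case: eqP => [->|] //; rewrite !mulr0.
have e1 : (1 - qXn u) * qder (lser u) = u%:R *: lser u.
  have := congr1 qder X1; rewrite qderM qder1 !qderD -scaleN1r qderZ qder1 dX.
  rewrite !add0r addrC => /eqP; rewrite addr_eq0 => /eqP ->.
  rewrite scalerA -scalerAl -scaleNr mulN1r opprK; congr (_ *: _).
  by rewrite -lserE.
have : (1 + lser u) * ((1 - qXn u) * qder (lser u)) = qder (lser u).
  by rewrite mulrA [X in X * _]mulrC X1 mul1r.
rewrite e1 => <-; rewrite -scalerAr; congr (_ *: _); ring.
Qed.

(** * Spans of brackets and nested sums *)

Lemma bracket_span_bracket (S : pred (seq nat)) s :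
  S s -> bracket_span S (bracket s).
Proof.
by move=> Ss; exists [:: (1, s)]; rewrite /= ?Ss // big_seq1 scale1r.
Qed.

Lemma bracket_span0 (S : pred (seq nat)) : bracket_span S (0 : qseries).
Proof. by exists [::]; rewrite ?big_nil. Qed.

Lemma bracket_spanD (S : pred (seq nat)) (f g : qseries) :
  bracket_span S f -> bracket_span S g -> bracket_span S (f + g).
Proof.
move=> [c Sc ->] [d Sd ->]; exists (c ++ d); first by rewrite all_cat Sc.
by rewrite big_cat.
Qed.

Lemma bracket_spanZ (S : pred (seq nat)) a (f : qseries) :
  bracket_span S f -> bracket_span S (a *: f).
Proof.
move=> [c Sc ->]; exists [seq (a * p.1, p.2) | p <- c].
  by rewrite all_map.
by rewrite big_map scaler_sumr; apply: eq_bigr => p _; rewrite scalerA.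
Qed.

Lemma bracket_spanB (S : pred (seq nat)) (f g : qseries) :
  bracket_span S f -> bracket_span S g -> bracket_span S (f - g).
Proof.
by move=> Sf Sg; apply: bracket_spanD => //; rewrite -scaleN1r; apply: bracket_spanZ.
Qed.

Lemma bracket_span_sum (S : pred (seq nat)) (I : eqType) (r : seq I)
    (F : I -> qseries) :
  (forall i, i \in r -> bracket_span S (F i)) ->
  bracket_span S (\sum_(i <- r) F i).
Proof.
move=> SF; rewrite big_seq_cond; apply: (big_ind (bracket_span S)).
- exact: bracket_span0.
- exact: bracket_spanD.
- by move=> i; rewrite andbT; apply: SF.
Qed.

Lemma bracket_span_sub (S S' : pred (seq nat)) f :
  (forall s, S s -> S' s) -> bracket_span S f -> bracket_span S' f.
Proof. by move=> SS' [c Sc ->]; exists c => //; apply: sub_all Sc => p; apply: SS'. Qed.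

Lemma bracket_span_rect (S : pred (seq nat)) (P : qseries -> Prop) :
  P 0 -> (forall a f g, P f -> P g -> P (a *: f + g)) ->
  (forall s, S s -> P (bracket s)) ->
  forall f, bracket_span S f -> P f.
Proof.
move=> P0 PD PS f [c Sc ->]; elim: c Sc => [|[a s] c IH] /=; first by rewrite big_nil.
by move=> /andP[Ss /IH Pc]; rewrite big_cons; apply: PD => //; apply: PS.
Qed.

Lemma FilMD_le j k f : (j <= k)%N -> FilMD j f -> FilMD k f.
Proof.
by move=> jk; apply: bracket_span_sub => s /andP[-> /leq_trans->].
Qed.

Lemma FilMDadm_le j k f : (j <= k)%N -> FilMDadm j f -> FilMDadm k f.
Proof.
by move=> jk; apply: bracket_span_sub => s /andP[-> /leq_trans->].
Qed.

(** * Truncated nested sums and their quasi-shuffle product *)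

Section NestedSums.
Variable A : comNzRingType.

(* The sum of f_1(u_1)...f_l(u_l) over N >= u_1 > ... > u_l >= 1. *)
Fixpoint nsum (fs : seq (nat -> A)) (N : nat) : A :=
  if fs is f :: fs' then \sum_(u < N) f u.+1 * nsum fs' u else 1.

(** Used with three choices of x: [lser] for the formal series, u |-> 1/u for truncated multiple
    zeta values, and [kap q] for the q-analogue that interpolates between them. *)
Definition pnsum (x : nat -> A) (s : seq nat) :=
  nsum [seq (fun u => x u ^+ a) | a <- s].

Lemma nsum_cons0 f fs : nsum (f :: fs) 0 = 0.
Proof. by rewrite /= big_ord0. Qed.

Lemma nsum_consS f fs N :
  nsum (f :: fs) N.+1 = nsum (f :: fs) N + f N.+1 * nsum fs N.
Proof. by rewrite /= big_ord_recr. Qed.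

Lemma pnsum_cons0 x a s : pnsum x (a :: s) 0 = 0.
Proof. exact: nsum_cons0. Qed.

Lemma pnsum_consS x a s N :
  pnsum x (a :: s) N.+1 = pnsum x (a :: s) N + x N.+1 ^+ a * pnsum x s N.
Proof. exact: nsum_consS. Qed.

(** The two halves of the quasi-shuffle product of the one-letter word a with s: the new summation
    variable either differs from all u_i, or coincides with one of them. Lists keep the
    multiplicities, which are counted later. *)
Fixpoint insertions (a : nat) (s : seq nat) : seq (seq nat) :=
  if s is b :: s' then (a :: s) :: [seq b :: t | t <- insertions a s']
  else [:: [:: a]].

Fixpoint stuffings (a : nat) (s : seq nat) : seq (seq nat) :=
  if s is b :: s' then (a + b :: s')%N :: [seq b :: t | t <- stuffings a s']
  else [::].

(** The induction is on the bound N, for all s at once: passing to N + 1 adds the terms whose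
    largest variable is N + 1, and in the product this variable belongs to the first factor, to the
    second, or to both, the last case producing the entry a + b. *)
Lemma pnsum_quasi_shuffle x a s N :
  pnsum x [:: a] N * pnsum x s N =
  \sum_(t <- insertions a s) pnsum x t N + \sum_(t <- stuffings a s) pnsum x t N.
Proof.
elim: N s => [|N IH] [|b s].
- by rewrite /= big_seq1 big_nil addr0 mulr1.
- rewrite pnsum_cons0 mul0r /= !big_cons !big_map !pnsum_cons0.
  by rewrite !big1 ?addr0 // => t _; rewrite pnsum_cons0.
- by rewrite /= big_seq1 big_nil addr0 mulr1.
rewrite /= !big_cons !big_map !pnsum_consS.
under eq_bigr do rewrite pnsum_consS.
under [X in _ = _ + (_ + X)]eq_bigr do rewrite pnsum_consS.
rewrite !big_split /= -!mulr_sumr.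
have := IH (b :: s); rewrite /= !big_cons !big_map => IHb.
have := IH s => IHs.
have -> : pnsum x [::] N = 1 by [].
rewrite exprD; move: IHb IHs.
set Pa := pnsum x [:: a] N; set Pb := pnsum x (b :: s) N.
set P := pnsum x s N; set S1 := \sum_(t <- insertions a s) _.
set S2 := \sum_(t <- stuffings a s) _; set S3 := \sum_(t <- insertions a s) _.
set S4 := \sum_(t <- stuffings a s) _.
move=> e1 e2; rewrite mulr1.
(* The product (Pa + x^a)(Pb + x^b P) is expanded so that Pa Pb and Pa P appear, to which the
   induction hypotheses for [b :: s] and [s] apply. *)
transitivity (Pa * Pb + x N.+1 ^+ a * Pb + x N.+1 ^+ b * (Pa * P)
   + x N.+1 ^+ a * x N.+1 ^+ b * P); first by ring.
rewrite e1 e2; ring.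
Qed.

Lemma sumn_insertions a s t : t \in insertions a s -> sumn t = (a + sumn s)%N.
Proof.
elim: s t => [|b s IH] t /=; first by rewrite inE => /eqP->.
by rewrite inE => /orP[/eqP->|/mapP[t' /IH e ->]] //=; rewrite e addnCA.
Qed.

Lemma sumn_stuffings a s t : t \in stuffings a s -> sumn t = (a + sumn s)%N.
Proof.
elim: s t => [|b s IH] t //=.
rewrite inE => /orP[/eqP->|/mapP[t' /IH e ->]] /=; first by rewrite addnA.
by rewrite e addnCA.
Qed.

Lemma index_insertions a s t : (0 < a)%N -> is_index s ->
  t \in insertions a s -> is_index t.
Proof.
move=> a0; elim: s t => [|b s IH] t /=; first by rewrite inE => _ /eqP-> /=; rewrite a0.
move=> /andP[b0 s0]; rewrite inE => /orP[/eqP->|/mapP[t' /(IH _ s0) e ->]] /=.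
  by rewrite a0 b0.
by rewrite b0.
Qed.

Lemma index_stuffings a s t : is_index s -> t \in stuffings a s -> is_index t.
Proof.
elim: s t => [|b s IH] t //=.
move=> /andP[b0 s0]; rewrite inE => /orP[/eqP->|/mapP[t' /(IH _ s0) e ->]] /=.
  by rewrite addn_gt0 b0 orbT.
by rewrite b0.
Qed.

End NestedSums.

(* sum_(v > 0) p(v) q^(u v) *)
Definition polyser (p : {poly rat}) (u : nat) : qseries :=
  fun n => if (0 < n)%N && (u %| n)%N then p.[(n %/ u)%:R] else 0.

Definition pbrt (ps : seq {poly rat}) : nat -> qseries :=
  nsum [seq polyser p | p <- ps].

(** The infinite sum is read on the diagonal: terms with u_1 > n have exponent at least u_1 v_1 > n,
    so the bound N = n already gives the coefficient of q^n. *)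
Definition pbr (ps : seq {poly rat}) : qseries := fun n => pbrt ps n n.

Lemma polyser_small p u n : (n < u)%N -> polyser p u n = 0.
Proof.
rewrite /polyser => nu; case: n nu => [|n] nu //=.
by rewrite gtnNdvd.
Qed.

Lemma pbrt_stable ps N n : (n <= N)%N -> pbrt ps N n = pbr ps n.
Proof.
case: ps => [|p ps]; first by [].
elim: N => [|N IH]; first by rewrite leqn0 => /eqP ->.
rewrite leq_eqVlt => /orP[/eqP->//|]; rewrite ltnS => nN.
rewrite /pbrt /= -/(pbrt ps) big_ord_recr /= qserD.
have -> : (polyser p N.+1 * pbrt ps N) n = 0.
  rewrite qserM big1 // => i _; rewrite polyser_small ?mul0r //.
  by have := ltn_ord i; lia.
by rewrite addr0; apply: IH.
Qed.

Lemma polyserE p x M : (0 < x)%N ->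
  eqq M (polyser p x) (\sum_(y <- iota 1 M) p.[y%:R] *: qXn (x * y)).
Proof.
move=> x0 n nM; rewrite qser_sum; under eq_bigr do rewrite qserZ /qXn.
rewrite /polyser; case: ifP => [/andP[n0 /dvdnP[y yE]]|h].
  have y0 : (0 < y)%N by move: n0; rewrite yE muln_gt0 => /andP[].
  rewrite yE mulnK // (bigD1_seq y) ?iota_uniq //=; last first.
    by rewrite mem_iota; have := leq_pmulr y x0; lia.
  rewrite mulnC eqxx mulr1 big1 ?addr0 // => z zy.
  by rewrite eqn_pmul2l // eq_sym (negPf zy) mulr0.
rewrite big_seq big1 // => y; rewrite mem_iota => /andP[y0 _].
case: eqP => [e|_]; last by rewrite mulr0.
by move: h; rewrite e muln_gt0 x0 y0 dvdn_mulr.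
Qed.

Lemma polyserM p x M (f : qseries) n : (0 < x)%N -> (n <= M)%N ->
  (polyser p x * f) n =
  \sum_(y <- iota 1 M) (if (x * y <= n)%N then p.[y%:R] * f (n - x * y)%N else 0).
Proof.
move=> x0 nM.
have ef : eqq M f f by [].
rewrite (eqqM (polyserE p x0) ef) // mulr_suml qser_sum; apply: eq_bigr => y _.
by rewrite -scalerAl qserZ qXnM; case: ifP; rewrite ?mulr0.
Qed.

(** * Brackets as nested sums *)

(** Tuples with entries in 1..M as explicit lists, so that a sum over tuples unfolds one coordinate
    at a time, like [nsum]; the finite functions in [sigma] do not. *)
Fixpoint poslists (M l : nat) : seq (seq nat) :=
  if l is l'.+1 then [seq x :: t | x <- iota 1 M, t <- poslists M l'] else [:: [::]].

Lemma mem_poslists M l t :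
  (t \in poslists M l) = (size t == l) && all (fun x => 0 < x <= M)%N t.
Proof.
elim: l t => [|l IH] t /=; first by rewrite inE; case: t.
apply/allpairsP/idP => [[[x u] /= [xM]]|].
  rewrite IH => /andP[/eqP<- au] ->; rewrite /= eqxx au.
  by move: xM; rewrite mem_iota => /andP[-> ]; rewrite add1n ltnS => ->.
case: t => [|x t] //= /andP[]; rewrite eqSS => st /andP[/andP[x0 xM] at'].
by exists (x, t); split; rewrite //= ?IH ?st // mem_iota x0 add1n ltnS.
Qed.

Lemma poslists_uniq M l : uniq (poslists M l).
Proof.
elim: l => //= l IH; apply: allpairs_uniq => //; first exact: iota_uniq.
by move=> [x t] [y u] _ _ /= [-> ->].
Qed.

Lemma sum_poslistsS (A : nmodType) M l (F : seq nat -> A) :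
  \sum_(t <- poslists M l.+1) F t =
  \sum_(x <- iota 1 M) \sum_(t <- poslists M l) F (x :: t).
Proof. by rewrite /= big_allpairs_dep. Qed.

Lemma sum_poslistsSn M l (F : seq nat -> nat) :
  (\sum_(t <- poslists M l.+1) F t =
  \sum_(x <- iota 1 M) \sum_(t <- poslists M l) F (x :: t))%N.
Proof. exact: sum_poslistsS. Qed.

Lemma sum_poslists_rev (A : nmodType) M l (F : seq nat -> A) :
  \sum_(t <- poslists M l) F t = \sum_(t <- poslists M l) F (rev t).
Proof.
rewrite -(big_map rev xpredT F); apply: perm_big; apply: uniq_perm.
- exact: poslists_uniq.
- by rewrite map_inj_uniq ?poslists_uniq //; apply: inv_inj; apply: revK.
move=> t; rewrite mem_poslists -{3}(revK t) mem_map; last first.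
  by apply: inv_inj; apply: revK.
by rewrite mem_poslists size_rev all_rev.
Qed.

Definition ffun_list l M (u : {ffun 'I_l -> 'I_M.+1}) : seq nat :=
  [seq val (u i) | i <- enum 'I_l].

Lemma size_ffun_list l M (u : {ffun 'I_l -> 'I_M.+1}) : size (ffun_list u) = l.
Proof. by rewrite size_map size_enum_ord. Qed.

Lemma nth_ffun_list l M (u : {ffun 'I_l -> 'I_M.+1}) (i : 'I_l) :
  nth 0%N (ffun_list u) i = u i.
Proof. by rewrite (nth_map i) ?size_enum_ord // nth_ord_enum. Qed.

Lemma sum_ffun_list (A : nmodType) l M (F : seq nat -> A) :
  \sum_(u : {ffun 'I_l -> 'I_M.+1} | [forall i, (0 < u i)%N]) F (ffun_list u) =
  \sum_(t <- poslists M l) F t.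
Proof.
rewrite -big_filter -(big_map (@ffun_list l M) xpredT F).
apply: perm_big; apply: uniq_perm.
- rewrite map_inj_uniq ?filter_uniq ?index_enum_uniq // => u v uv.
  by apply/ffunP => i; apply: val_inj; rewrite /= -!nth_ffun_list uv.
- exact: poslists_uniq.
move=> t; rewrite mem_poslists; apply/mapP/andP => [[u + ->]|[/eqP st at']].
  rewrite mem_filter => /andP[/forallP u0 _]; rewrite size_ffun_list; split=> //.
  apply/(all_nthP 0%N) => i; rewrite size_ffun_list => il.
  by rewrite (nth_ffun_list u (Ordinal il)) u0 -ltnS ltn_ord.
have tn (i : 'I_l) : (0 < nth 0%N t i <= M)%N.
  by have /(all_nthP 0%N) := at'; apply; rewrite st.
exists [ffun i : 'I_l => inord (nth 0%N t i)].
  rewrite mem_filter mem_index_enum andbT; apply/forallP => i; rewrite ffunE.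
  by have /andP[? ?] := tn i; rewrite inordK.
apply: (@eq_from_nth _ 0%N); rewrite ?size_ffun_list // st => i il.
rewrite (nth_ffun_list _ (Ordinal il)) ffunE inordK //=.
by have /andP[] := tn (Ordinal il).
Qed.

Fixpoint dotl (u v : seq nat) : nat :=
  match u, v with x :: u', y :: v' => (x * y + dotl u' v')%N | _, _ => 0%N end.

Fixpoint monl (r v : seq nat) : nat :=
  match r, v with e :: r', y :: v' => (y ^ e * monl r' v')%N | _, _ => 1%N end.

Lemma dotl_nth u v : size u = size v ->
  dotl u v = (\sum_(i < size u) nth 0 u i * nth 0 v i)%N.
Proof.
elim: u v => [|x u IH] [|y v] //= => [_|[suv]]; first by rewrite big_ord0.
by rewrite big_ord_recl IH.
Qed.

Lemma monl_nth r v : size r = size v ->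
  monl r v = (\prod_(i < size r) nth 0 v i ^ nth 0 r i)%N.
Proof.
elim: r v => [|x r IH] [|y v] //= => [_|[sv]]; first by rewrite big_ord0.
by rewrite big_ord_recl IH.
Qed.

Lemma dotl_rev u v : size u = size v -> dotl (rev u) (rev v) = dotl u v.
Proof.
move=> suv; rewrite !dotl_nth ?size_rev //.
rewrite (reindex_inj rev_ord_inj); apply: eq_bigr => i _.
have := ltn_ord i => il.
have jl : (size u - i.+1 < size u)%N by lia.
rewrite /= !nth_rev -?suv //.
by congr (nth _ _ _ * nth _ _ _)%N; lia.
Qed.

Lemma monl_rev r v : size r = size v -> monl (rev r) (rev v) = monl r v.
Proof.
move=> suv; rewrite !monl_nth ?size_rev //.
rewrite (reindex_inj rev_ord_inj); apply: eq_bigr => i _.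
have := ltn_ord i => il.
have jl : (size r - i.+1 < size r)%N by lia.
rewrite /= !nth_rev -?suv //.
by congr (nth _ _ _ ^ nth _ _ _)%N; lia.
Qed.

Lemma sigmaE r n : sigma r n =
  (\sum_(v <- poslists n (size r)) \sum_(u <- poslists n (size r))
    if sorted gtn u && (dotl u v == n) then monl r v else 0)%N.
Proof.
rewrite [RHS]exchange_big -sum_ffun_list /= /sigma [RHS]big_mkcond /=.
apply: eq_bigr => u _; rewrite -sum_ffun_list.
case: ifP => [/forallP u0|/negbT/forallPn[i ui]]; last first.
  rewrite big1 // => v /and3P[/forallP/(_ i)]; by rewrite (negPf ui).
rewrite big_mkcond [RHS]big_mkcond /=; apply: eq_bigr => v _.
have -> : [forall i, (0 < u i)%N && (0 < v i)%N] = [forall i, (0 < v i)%N].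
  by apply: eq_forallb => i; rewrite u0.
case: forallP => [v0|] //=.
have -> : [forall i : 'I_(size r), forall j : 'I_(size r), (i < j)%N ==> (u j < u i)%N]
  = sorted gtn (ffun_list u).
  rewrite sorted_pairwise; last by move=> a b c /= ab bc; apply: ltn_trans ab.
  apply/forallP/(pairwiseP 0%N) => [h i j|h i].
    rewrite !inE size_ffun_list => il jl ij.
    rewrite (nth_ffun_list u (Ordinal il)) (nth_ffun_list u (Ordinal jl)).
    by have /forallP/(_ (Ordinal jl))/implyP := h (Ordinal il); apply.
  apply/forallP => j; apply/implyP => ij.
  by rewrite -!nth_ffun_list; apply: h => //; rewrite inE size_ffun_list.
rewrite dotl_nth ?monl_nth ?size_ffun_list //.
under [in RHS]eq_bigr do rewrite !nth_ffun_list.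
by under [X in if _ then X else _]eq_bigr do rewrite -nth_ffun_list.
Qed.

Lemma pbrt_cons p ps N :
  pbrt (p :: ps) N = \sum_(u < N) polyser p u.+1 * pbrt ps u.
Proof. by []. Qed.

Lemma sum_iota_ord M N (F : nat -> nat) : (N <= M)%N ->
  (forall x, (N < x)%N -> F x = 0%N) ->
  (\sum_(x <- iota 1 M) F x = \sum_(x < N) F x.+1)%N.
Proof.
move=> NM F0; have -> : iota 1 M = iota 1 N ++ iota N.+1 (M - N).
  by rewrite -add1n -iotaD subnKC.
rewrite big_cat /= [X in (_ + X)%N]big1_seq ?addn0 => [|x]; last first.
  by rewrite mem_iota => /andP[_ /andP[/F0]].
have -> : iota 1 N = [seq i.+1 | i <- iota 0 N] by rewrite -(iotaDl 1 0).
by rewrite big_map -[in iota 0 N](subn0 N) -/(index_iota 0 N) big_mkord.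
Qed.

(** The bound M on all entries is kept apart from N and n because both of these shrink in the
    induction: once u_1 = x and v_1 = y are fixed, x bounds the remaining u_i and n - x y is the
    number left to represent. *)
Lemma pbrtE r M N n : (N <= M)%N -> (n <= M)%N ->
  pbrt [seq 'X^x | x <- r] N n =
  (\sum_(u <- poslists M (size r)) \sum_(v <- poslists M (size r))
    if path gtn N.+1 u && (dotl u v == n) then monl r v else 0)%N%:R.
Proof.
elim: r N n => [|e r IH] N n NM nM.
  by rewrite /= !big_seq1 /pbrt /= qser1 eq_sym; case: eqP.
rewrite [size _]/= sum_poslistsSn pbrt_cons qser_sum.
rewrite (sum_iota_ord NM) => [|x xN]; last first.
  by rewrite big1 // => u _; rewrite big1 // => v _; rewrite /= ltnS (leqNgt x N) xN.
rewrite natr_sum; apply: eq_bigr => -[x xN] _; rewrite [nat_of_ord _]/=.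
rewrite (polyserM _ _ _ nM) //.
under [in RHS]eq_bigr => u _ do rewrite sum_poslistsSn.
rewrite exchange_big natr_sum; apply: eq_bigr => y _.
rewrite IH; [|lia..].
rewrite hornerXn -!natrX; case: ifP => [le_n|gt_n].
  rewrite -natrM; congr (_%:R); rewrite big_distrr; apply: eq_bigr => u _.
  rewrite big_distrr; apply: eq_bigr => v _ /=.
  rewrite ltnS xN /=.
  have -> : (dotl u v == n - x.+1 * y)%N = (x.+1 * y + dotl u v == n)%N by lia.
  by case: ifP; rewrite ?muln0.
rewrite big1 // => u _; rewrite big1 // => v _ /=.
have -> : (x.+1 * y + dotl u v == n)%N = false by lia.
by rewrite andbF.
Qed.

Lemma sigma_pbr r n : (sigma r n)%:R = pbr [seq 'X^x | x <- r] n.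
Proof.
rewrite /pbr (pbrtE _ (leqnn n) (leqnn n)) sigmaE exchange_big /=; congr (_%:R).
rewrite [LHS]big_seq [RHS]big_seq; apply: eq_bigr => u.
rewrite mem_poslists => /andP[_ au]; apply: eq_bigr => v _.
congr (if _ && _ then _ else _).
case: u au => [|x u] //= /andP[/andP[_ xn] _].
by rewrite ltnS xn.
Qed.

(** * Expansion in powers of [1] *)

Lemma polyser_lin a p q u : polyser (a *: p + q) u = a *: polyser p u + polyser q u.
Proof.
apply/funext => n; rewrite qserD qserZ /polyser; case: ifP => _.
  by rewrite hornerD hornerZ.
by rewrite mulr0 addr0.
Qed.

Lemma polyserZ a p u : polyser (a *: p) u = a *: polyser p u.
Proof.
apply/funext => n; rewrite qserZ /polyser; case: ifP => _; last by rewrite mulr0.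
by rewrite hornerZ.
Qed.

Lemma pbrt_lin pre post N a p q :
  pbrt (pre ++ (a *: p + q) :: post) N =
  a *: pbrt (pre ++ p :: post) N + pbrt (pre ++ q :: post) N.
Proof.
elim: pre N => [|r pre IH] N; rewrite ?cat_cons ?cat0s !pbrt_cons scaler_sumr -big_split /=.
  by apply: eq_bigr => u _; rewrite polyser_lin mulrDl scalerAl.
by apply: eq_bigr => u _; rewrite IH mulrDr scalerAr.
Qed.

Lemma pbr_lin pre post a p q :
  pbr (pre ++ (a *: p + q) :: post) =
  a *: pbr (pre ++ p :: post) + pbr (pre ++ q :: post).
Proof. by apply/funext => n; rewrite qserD qserZ /pbr pbrt_lin qserD qserZ. Qed.

Lemma pbr_sum pre post (I : Type) (r : seq I) (c : I -> rat) (F : I -> {poly rat}) :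
  pbr (pre ++ (\sum_(i <- r) c i *: F i) :: post) =
  \sum_(i <- r) c i *: pbr (pre ++ F i :: post).
Proof.
elim: r => [|i r IH]; last by rewrite !big_cons pbr_lin IH.
rewrite !big_nil; have := pbr_lin pre post (-1) 0 0.
by rewrite scaler0 addr0 scaleN1r addNr.
Qed.

Lemma pbrt_scale (T : Type) (c : T -> rat) (F : T -> {poly rat}) s N :
  pbrt [seq c x *: F x | x <- s] N =
  (\prod_(x <- s) c x) *: pbrt [seq F x | x <- s] N.
Proof.
elim: s N => [|x s IH] N; first by rewrite big_nil scale1r.
rewrite /= !pbrt_cons big_cons scaler_sumr; apply: eq_bigr => u _.
by rewrite IH polyserZ -scalerAr -scalerAl scalerA mulrC.
Qed.

Definition monp (r : nat) : {poly rat} := (r`!%:R)^-1 *: 'X^r.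

Lemma bracketE s : bracket s = pbr [seq monp x.-1 | x <- s].
Proof.
apply/funext => n; rewrite /bracket sigma_pbr /pbr pbrt_scale qserZ mulrC.
by rewrite natr_prod prodfV -map_comp.
Qed.

Lemma pbr_monom r :
  pbr [seq 'X^x | x <- r] = (\prod_(x <- r) x`!)%:R *: bracket [seq x.+1 | x <- r].
Proof.
apply/funext => n; rewrite qserZ /bracket -map_comp map_id big_map sigma_pbr /=.
rewrite mulrCA divff ?mulr1 // pnatr_eq0 -lt0n prodn_gt0 // => i; exact: fact_gt0.
Qed.

(** Polynomials are expanded into monomials from left to right, r holding the exponents already
    chosen. A polynomial of size at most n only yields exponents i < n, that is, bracket entries i +
    1 <= n. *)
Lemma pbr_FilMD_monom r ps s : all2 (fun p n => size (p : {poly rat}) <= n)%N ps s ->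
  FilMD (sumn r + size r + sumn s) (pbr ([seq 'X^x | x <- r] ++ ps)).
Proof.
elim: ps r s => [|p ps IH] r [|n s] //=.
  move=> _; rewrite cats0 pbr_monom addn0; apply: bracket_spanZ.
  apply: bracket_span_bracket; apply/andP; split; first by rewrite /is_index all_map; apply/allP.
  by elim: r => //= x r IHr; lia.
move=> /andP[pn pss].
rewrite -[p]coefK poly_def pbr_sum; apply: bracket_span_sum => i _.
apply: bracket_spanZ; rewrite -cat_rcons -map_rcons.
apply: FilMD_le (IH (rcons r i) s pss); rewrite sumn_rcons size_rcons.
by have := leq_trans (ltn_ord i) pn; lia.
Qed.

Lemma pbr_FilMD ps s : all2 (fun p n => size (p : {poly rat}) <= n)%N ps s ->
  FilMD (sumn s) (pbr ps).
Proof. exact: (@pbr_FilMD_monom [::]). Qed.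

Lemma pbr_subr pre p q post :
  pbr (pre ++ p :: post) - pbr (pre ++ q :: post) = pbr (pre ++ (p - q) :: post).
Proof. by rewrite addrC -[p - q]addrC -!scaleN1r pbr_lin. Qed.

Lemma all2_cat (T U : Type) (r : T -> U -> bool) s1 s2 t1 t2 :
  all2 r s1 t1 -> all2 r s2 t2 -> all2 r (s1 ++ s2) (t1 ++ t2).
Proof. by elim: s1 t1 => [|x s IH] [|y t] //= /andP[-> /IH h] /h. Qed.

(** Telescoping: the polynomials f a are exchanged for g a one at a time, those already exchanged
    being stored in [pre]. Each exchange leaves a series with one polynomial f a - g a, whose
    smaller degree lowers the weight by one. *)
Lemma pbr_FilMD_sub (f g : nat -> {poly rat}) pre s0 s :
    (forall a, 0 < a -> size (f a) <= a)%N -> (forall a, 0 < a -> size (g a) <= a)%N ->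
    (forall a, 0 < a -> size (f a - g a)%R <= a.-1)%N ->
  all2 (fun p n => size (p : {poly rat}) <= n)%N pre s0 -> is_index s ->
  FilMD (sumn s0 + sumn s).-1
    (pbr (pre ++ [seq f x | x <- s]) - pbr (pre ++ [seq g x | x <- s])).
Proof.
move=> fS gS fgS; elim: s pre s0 => [|a s IH] pre s0 pre0 /=.
  by rewrite subrr => _; apply: bracket_span0.
move=> /andP[a0 s1].
rewrite -(subrK (pbr (pre ++ g a :: [seq f x | x <- s])) (pbr (pre ++ f a :: _))).
rewrite pbr_subr -addrA; apply: bracket_spanD.
  have all2f : all2 (fun p n => size (p : {poly rat}) <= n)%N [seq f x | x <- s] s.
    elim: s s1 {IH} => //= b s IH /andP[b0 /IH ->]; by rewrite fS.
  have := @pbr_FilMD (pre ++ (f a - g a) :: [seq f x | x <- s]) (s0 ++ a.-1 :: s).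
  rewrite sumn_cat /=; have -> : (sumn s0 + (a.-1 + sumn s) = (sumn s0 + (a + sumn s)).-1)%N by lia.
  by apply; apply: all2_cat => //=; rewrite fgS.
rewrite -!cat_rcons; have := IH (rcons pre (g a)) (rcons s0 a).
rewrite sumn_rcons addnA; apply => //.
by rewrite -!cats1; apply: all2_cat => //=; rewrite gS.
Qed.

(* binp r takes the value 'C(v - 1, r) at v > 0, and its lser-series is a pure power. *)
Fixpoint binp (r : nat) : {poly rat} :=
  if r is r'.+1 then (r%:R)^-1 *: (binp r' * ('X - r%:R%:P)) else 1.

Lemma binpE r v : (0 < v)%N -> (binp r).[v%:R] = 'C(v.-1, r)%:R.
Proof.
case: v => // v _; elim: r => [|r IH]; first by rewrite hornerC bin0.
rewrite [binp _]/= hornerZ hornerM IH hornerXsubC /=.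
apply: (mulfI (_ : r.+1%:R != 0)); first by rewrite pnatr_eq0.
rewrite mulrA divff ?pnatr_eq0 // mul1r -natrM mul_bin_left.
have [rv|vr] := leqP r v; last by rewrite bin_small // mul0r muln0.
by rewrite mulrC -!natrB // natrM subSS.
Qed.

Lemma size_binp r : (size (binp r) <= r.+1)%N.
Proof.
elim: r => [|r IH]; first by rewrite size_poly1.
apply: leq_trans (size_scale_leq _ _) _; apply: leq_trans (size_polyMleq _ _) _.
by rewrite size_XsubC addn2.
Qed.

Lemma size_monp r : (size (monp r) <= r.+1)%N.
Proof. by apply: leq_trans (size_scale_leq _ _) _; rewrite size_polyXn. Qed.

(** Both polynomials have leading coefficient 1/r!. The induction multiplies by 'X in one case and
    by 'X - (r + 1) in the other, with the same factor 1/(r + 1). *)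
Lemma size_monp_sub r : (size (monp r - binp r)%R <= r)%N.
Proof.
elim: r => [|r IH]; first by rewrite /monp fact0 invr1 scale1r expr0 subrr size_poly0.
have -> : monp r.+1 - binp r.+1 =
    (r.+1%:R)^-1 *: ((monp r - binp r) * 'X + r.+1%:R *: binp r).
  have -> : monp r.+1 = (r.+1%:R)^-1 *: (monp r * 'X).
    by rewrite /monp factS natrM invfM exprSr -scalerAl scalerA.
  have -> : binp r.+1 = (r.+1%:R)^-1 *: (binp r * 'X - r.+1%:R *: binp r).
    by rewrite /= mulrBr [_ * _%:P]mulrC mul_polyC.
  rewrite -scalerBr mulrBl; congr (_ *: _).
  by rewrite opprB addrA addrAC.
apply: leq_trans (size_scale_leq _ _) _; apply: leq_trans (size_polyD _ _) _.
rewrite geq_max (leq_trans (size_scale_leq _ _) (size_binp _)) andbT.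
by apply: leq_trans (size_polyMleq _ _) _; rewrite size_polyX addn2.
Qed.

Lemma lser_inv u : (0 < u)%N -> (1 - qXn u) * (1 + lser u) = 1.
Proof. by move=> u0; rewrite mulrBl mul1r -lserE // -addrA subrr addr0. Qed.

(** Pascal's rule for 'C(v - 1, r + 1); multiplication by q^u is the shift v - 1 |-> v. The boundary
    term v = 1 is harmless since 'C(0, r + 1) = 0. *)
Lemma polyser_binpS r u : (0 < u)%N ->
  polyser (binp r.+1) u = qXn u * (polyser (binp r.+1) u + polyser (binp r) u).
Proof.
move=> u0; apply/funext => n; rewrite qXnM qserD.
case: (leqP u n) => un; last by rewrite polyser_small.
rewrite /polyser; have n0 : (0 < n)%N by lia.
rewrite n0 dvdn_subl // subn_gt0.
case: (boolP (u %| n)%N) => [/dvdnP[m nE]|_]; last by rewrite !andbF addr0.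
have m0 : (0 < m)%N by move: n0; rewrite nE muln_gt0 => /andP[].
rewrite andbT nE -[X in (X < _)%N]mul1n ltn_pmul2r //.
have -> : (m * u - u = m.-1 * u)%N by rewrite -subn1 mulnBl mul1n.
rewrite !mulnK //.
case: m m0 {nE} => // -[|m] _; first by rewrite (binpE _ (ltn0Sn 0)) addr0 bin0n.
by rewrite !(binpE _ (ltn0Sn _)) /= binS natrD.
Qed.

(** Pascal's recursion reads (1 - q^u) P_(r+1) = q^u P_r, so each step multiplies by q^u/(1 -
    q^u). *)
Lemma polyser_binp r u : (0 < u)%N -> polyser (binp r) u = lser u ^+ r.+1.
Proof.
move=> u0; elim: r => [|r IH].
  by apply/funext => n; rewrite /polyser hornerC expr1 /lser; case: ifP.
have e : (1 - qXn u) * polyser (binp r.+1) u = qXn u * lser u ^+ r.+1.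
  by rewrite mulrBl mul1r [X in X - _]polyser_binpS // mulrDr IH addrC addKr.
rewrite -[LHS]mul1r -(lser_inv u0) mulrAC e mulrAC -lserE // -exprS //.
Qed.

(** The homogeneous sums over u_1 > ... > u_l of the products of K(u_i)^(s_i), known as q-multiple
    zeta values of Schlesinger-Zudilin type. *)
Definition kbr (s : seq nat) : qseries := pbr [seq binp x.-1 | x <- s].

Lemma eq_nsum (A : comNzRingType) (T : eqType) (f g : T -> nat -> A) s N :
  (forall x u, x \in s -> f x u.+1 = g x u.+1) ->
  nsum [seq f x | x <- s] N = nsum [seq g x | x <- s] N.
Proof.
elim: s N => //= x s IH N fg; apply: eq_bigr => u _; rewrite fg ?mem_head //.
by congr (_ * _); apply: IH => y v ys; apply: fg; rewrite inE ys orbT.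
Qed.

Lemma kbr_pnsum s N : is_index s -> eqq N (kbr s) (pnsum lser s N).
Proof.
move=> /allP s1 n nN; rewrite /kbr -(pbrt_stable _ nN) /pbrt /pnsum -map_comp.
apply: (congr1 (fun f : qseries => f n)).
apply: (@eq_nsum _ _ (polyser \o (fun x => binp x.-1)) (fun a u => lser u ^+ a)).
move=> x u xs /=; by rewrite polyser_binp // prednK // s1.
Qed.

Lemma bracket_nil : bracket [::] = 1.
Proof. by rewrite bracketE. Qed.

Lemma kbr_nil : kbr [::] = 1.
Proof. by []. Qed.

Lemma kbr1 : kbr [:: 1%N] = bracket [:: 1%N].
Proof. by rewrite bracketE /kbr /= /monp fact0 invr1 scale1r expr0. Qed.

Lemma kbr_FilMD s : is_index s -> FilMD (sumn s) (kbr s).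
Proof.
move=> s1; apply: pbr_FilMD; elim: s s1 => //= a s IH /andP[a0 /IH ->].
by rewrite andbT (leq_trans (size_binp _)) // prednK.
Qed.

(** Equal leading terms make the change between the two families unitriangular for the weight. For
    the empty index the truncated predecessor of 0 does no harm, since the difference is 0. *)
Lemma bracket_kbr s : is_index s -> FilMD (sumn s).-1 (bracket s - kbr s).
Proof.
move=> s1; rewrite bracketE.
apply: (@pbr_FilMD_sub (fun a => monp a.-1) (fun a => binp a.-1) [::] [::] s) => //.
- by move=> a a0; rewrite (leq_trans (size_monp _)) // prednK.
- by move=> a a0; rewrite (leq_trans (size_binp _)) // prednK.
- by move=> a a0; apply: size_monp_sub.
Qed.

Lemma kbr_quasi_shuffle a s : (0 < a)%N -> is_index s ->
  kbr [:: a] * kbr s =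
  \sum_(t <- insertions a s) kbr t + \sum_(t <- stuffings a s) kbr t.
Proof.
move=> a0 s1; apply/funext => n.
have ea : is_index [:: a] by rewrite /= a0.
rewrite (eqqM (kbr_pnsum ea) (kbr_pnsum s1) (leqnn n)) pnsum_quasi_shuffle.
rewrite !qserD !qser_sum; congr (_ + _); rewrite big_seq [RHS]big_seq.
  by apply: eq_bigr => t /(index_insertions a0 s1) t1; rewrite (kbr_pnsum t1 (leqnn n)).
by apply: eq_bigr => t /(index_stuffings s1) t1; rewrite (kbr_pnsum t1 (leqnn n)).
Qed.

(** Strong induction on w: on [kbr s] the quasi-shuffle product is homogeneous of weight a + sumn s,
    and the correction [bracket s - kbr s] has lower weight. *)
Lemma kbrM_FilMD a w f : (0 < a)%N -> FilMD w f -> FilMD (a + w) (kbr [:: a] * f).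
Proof.
move=> a0; elim/ltn_ind: w f => w IH.
apply: bracket_span_rect => [|c f g Pf Pg|s /andP[s1 sw]].
- by rewrite mulr0; apply: bracket_span0.
- by rewrite mulrDr -scalerAr; apply: bracket_spanD => //; apply: bracket_spanZ.
have kk : FilMD (a + w) (kbr [:: a] * kbr s).
  rewrite kbr_quasi_shuffle //; apply: bracket_spanD; apply: bracket_span_sum => t ts.
    apply: FilMD_le (kbr_FilMD (index_insertions a0 s1 ts)).
    by rewrite (sumn_insertions ts) leq_add2l.
  apply: FilMD_le (kbr_FilMD (index_stuffings s1 ts)).
  by rewrite (sumn_stuffings ts) leq_add2l.
(* For the empty index the predecessor of the weight does not drop, so the induction hypothesis
   would not apply. *)
case: s s1 sw kk => [|b s] s1 sw kk; first by rewrite bracket_nil -kbr_nil.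
rewrite -(subrK (kbr (b :: s)) (bracket _)) mulrDr; apply: bracket_spanD => //.
have b0 : (0 < b)%N by case/andP: s1.
have lw : ((sumn (b :: s)).-1 < w)%N by move: sw; rewrite /=; lia.
by apply: FilMD_le (IH _ lw _ (bracket_kbr s1)); rewrite leq_add2l ltnW.
Qed.

Definition expandable (k : nat) (f : qseries) := exists g : nat -> qseries,
  (forall j, (j <= k)%N -> FilMDadm j (g j)) /\
  f = \sum_(j < k.+1) g j * bracket [:: 1%N] ^+ (k - j).

Lemma expandable_expansion k f g : bracket1_expansion k f g <->
  (forall j, (j <= k)%N -> FilMDadm j (g j)) /\
  f = \sum_(j < k.+1) g j * bracket [:: 1%N] ^+ (k - j).
Proof.
rewrite /bracket1_expansion.
have -> : \sum_(j < k.+1) (psmul (g j) (psexp (bracket [:: 1%N]) (k - j)) : nat -> rat^o)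
  = \sum_(j < k.+1) g j * bracket [:: 1%N] ^+ (k - j) :> qseries.
  by apply: eq_bigr => j _; rewrite psexpE.
by [].
Qed.

Lemma expandable0 k : expandable k 0.
Proof.
exists (fun=> 0); split; first by move=> j _; apply: bracket_span0.
by rewrite big1 // => i _; rewrite mul0r.
Qed.

Lemma expandableD k f g : expandable k f -> expandable k g -> expandable k (f + g).
Proof.
move=> [f' [Af ->]] [g' [Ag ->]]; exists (fun j => f' j + g' j); split.
  by move=> j jk; apply: bracket_spanD; [apply: Af | apply: Ag].
by rewrite -big_split; apply: eq_bigr => j _; rewrite mulrDl.
Qed.

Lemma expandableZ k a f : expandable k f -> expandable k (a *: f).
Proof.
move=> [f' [Af ->]]; exists (fun j => a *: f' j); split.
  by move=> j jk; apply: bracket_spanZ; apply: Af.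
by rewrite scaler_sumr; apply: eq_bigr => j _; rewrite scalerAl.
Qed.

Lemma expandable_sum k (I : eqType) (r : seq I) (F : I -> qseries) :
  (forall i, i \in r -> expandable k (F i)) -> expandable k (\sum_(i <- r) F i).
Proof.
move=> SF; rewrite big_seq_cond; apply: (big_ind (expandable k)).
- exact: expandable0.
- exact: expandableD.
- by move=> i; rewrite andbT; apply: SF.
Qed.

Lemma expandable_adm k f : FilMDadm k f -> expandable k f.
Proof.
move=> kf; exists (fun j => if j == k then f else 0); split.
  by move=> j _; case: eqP => [->|_] //; apply: bracket_span0.
rewrite big_ord_recr /= eqxx subnn mulr1 big1 ?add0r // => i _.
by rewrite ltn_eqF ?mul0r.
Qed.

Lemma expandableS k f : expandable k f -> expandable k.+1 f.
Proof.
move=> [g [Ag ->]]; exists (fun j => if j is i.+1 then g i else 0); split.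
  by case=> [|j] jk; [apply: bracket_span0|apply: FilMDadm_le (Ag j jk)].
by rewrite [RHS]big_ord_recl mul0r add0r; apply: eq_bigr => j _.
Qed.

Lemma expandableM1 k f : expandable k f -> expandable k.+1 (bracket [:: 1%N] * f).
Proof.
move=> [g [Ag ->]]; exists (fun j => if (j <= k)%N then g j else 0); split.
  by move=> j jk; case: leqP => h; [apply: Ag|apply: bracket_span0].
rewrite [RHS]big_ord_recr /= ltnn mul0r addr0 mulr_sumr; apply: eq_bigr => j _.
by rewrite -ltnS ltn_ord mulrCA -exprS subSn // -ltnS.
Qed.

(** Measure for the elimination of non-admissible indices: among indices it is 0 exactly on the
    admissible ones. *)
Fixpoint lead1 (s : seq nat) : nat :=
  if s is 1%N :: s' then (lead1 s').+1 else 0%N.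

(** Inserting 1 before, between or just after the m leading ones of s gives [1 :: s] each time,
    hence m + 1 copies; any later insertion comes after an entry at least 2 and does not lengthen
    the initial run of ones. *)
Lemma insertions1_perm s : is_index s -> exists rest,
  perm_eq (insertions 1 s) (nseq (lead1 s).+1 (1%N :: s) ++ rest) /\
  all (fun t => lead1 t <= lead1 s)%N rest.
Proof.
elim: s => [|b s IH]; first by exists [::].
case: b => [|[|b]] // /andP[_ /IH[rest [pr ar]]].
  exists [seq 1%N :: t | t <- rest]; split; last by rewrite all_map.
  rewrite [insertions _ _]/= [nseq _ _]/= cat_cons perm_cons.
  by rewrite (perm_trans (perm_map _ pr)) // map_cat map_nseq.
exists [seq b.+2 :: t | t <- insertions 1 s]; split=> //.
by rewrite all_map; apply/allP.
Qed.

Lemma lead1_stuffings s t : is_index s -> t \in stuffings 1 s -> (lead1 t <= lead1 s)%N.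
Proof.
elim: s t => // b s IH t /andP[b0 s1] /=.
case: b b0 => // b _; rewrite inE => /orP[/eqP->//|/mapP[t' /(IH _ s1) h ->]].
by case: b => //=; rewrite ltnS.
Qed.

(** Inner induction on the number of leading ones. With none, s is admissible and [kbr s] differs
    from [bracket s] by lower weight. Otherwise s = 1 :: s', and the product of [1] with [kbr s'] is
    a nonzero multiple of [kbr s] plus terms with fewer leading ones. *)
Lemma kbr_expandable w s : is_index s -> sumn s = w.+1 ->
  (forall f, FilMD w f -> expandable w f) -> expandable w.+1 (kbr s).
Proof.
move=> + + IHw; have [m] := ubnP (lead1 s); elim: m s => // m IH s.
rewrite ltnS leq_eqVlt => /orP[/eqP sm s1 sw|]; last exact: IH.
have [s0|s0] := posnP (lead1 s).
  have adm : admissible s.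
    by rewrite /admissible s1; case: s s0 s1 {sm sw} => // -[|[|b]].
  rewrite -(subrK (bracket s) (kbr s)); apply: expandableD.
    apply: expandableS; apply: IHw; rewrite -opprB -scaleN1r.
    by apply: bracket_spanZ; have := bracket_kbr s1; rewrite sw.
  apply: expandable_adm; apply: bracket_span_bracket.
  by rewrite adm sw leqnn.
case: s s0 s1 sm sw => // -[|[|b]] // s _ /andP[_ s1] [sm] [sw].
rewrite add0n in sw.
have [rest [pr /allP ar]] := insertions1_perm s1.
have e := kbr_quasi_shuffle (ltn0Sn 0) s1.
rewrite (perm_big _ pr) big_cat big_nseq iter_addr_0 in e.
(* The multiplicity [(lead1 s).+1] of [1 :: s] among the insertions is invertible in Q, so the
   quasi-shuffle relation can be solved for this term. *)
have e2 : kbr (1%N :: s) = (lead1 s).+1%:R^-1 *: (kbr [:: 1%N] * kbr s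
   - \sum_(t <- rest) kbr t - \sum_(t <- stuffings 1 s) kbr t).
  rewrite e -addrA -opprD -[X in X - _]addrA addrK -scaler_nat scalerA.
  by rewrite mulVf ?scale1r // pnatr_eq0.
rewrite e2; apply: expandableZ; apply: expandableD; [apply: expandableD|].
- rewrite kbr1; apply: expandableM1; apply: IHw.
  by have := kbr_FilMD s1; rewrite sw.
- rewrite -scaleN1r; apply: expandableZ; apply: expandable_sum => t tr.
  have ti : t \in insertions 1 s by rewrite (perm_mem pr) mem_cat tr orbT.
  apply: IH; last by rewrite (sumn_insertions ti) sw add1n.
    by rewrite -sm ltnS ar.
  exact: index_insertions ti.
- rewrite -scaleN1r; apply: expandableZ; apply: expandable_sum => t tr.
  apply: IH; last by rewrite (sumn_stuffings tr) sw add1n.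
    by rewrite -sm ltnS lead1_stuffings.
  exact: index_stuffings tr.
Qed.

Lemma FilMD_expandable k f : FilMD k f -> expandable k f.
Proof.
elim: k f => [|k IH].
  apply: bracket_span_rect => [|c f g Pf Pg|s /andP[s1 sw]].
  - exact: expandable0.
  - by apply: expandableD => //; apply: expandableZ.
  apply: expandable_adm; apply: bracket_span_bracket; rewrite sw andbT.
  by case: s s1 sw => // -[].
apply: bracket_span_rect => [|c f g Pf Pg|s /andP[s1 sw]].
- exact: expandable0.
- by apply: expandableD => //; apply: expandableZ.
move: sw; rewrite leq_eqVlt => /orP[/eqP sw|]; last first.
  rewrite ltnS => sk; apply: expandableS; apply: IH; apply: bracket_span_bracket.
  by rewrite s1.
rewrite -(subrK (kbr s) (bracket s)); apply: expandableD.
  by apply: expandableS; apply: IH; have := bracket_kbr s1; rewrite sw.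
exact: kbr_expandable.
Qed.

(** * The derivation *)

(** The generating series of q^(u_1 v_1 + ... + u_l v_l) over 0 < u_1 < ... < u_l: in terms of the
    gaps of u it is a product of geometric series in the suffix sums of v. *)
Fixpoint suflser (v : seq nat) : qseries :=
  if v is w :: t then lser (w + sumn t) * suflser t else 1.

Lemma sum_qXn_lser M m V : (0 < V)%N ->
  eqq M (\sum_(x <- iota 1 M) if (m < x)%N then qXn (x * V) else 0)
        (qXn (m * V) * lser V).
Proof.
move=> V0 n nM; rewrite qXnM qser_sum /lser.
have e x : (if (m < x)%N then qXn (x * V) else 0) n = ((m < x) && (n == x * V))%N%:R.
  by case: ifP.
under eq_bigr do rewrite e.
have [/dvdnP[y nE]|nV] := boolP (V %| n)%N; last first.
  rewrite big1 => [|x _]; last first.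
    by case: eqP => [nE|_]; rewrite ?andbF //; move: nV; rewrite nE dvdn_mull.
  by case: ifP => // mV; rewrite dvdn_subl ?dvdn_mull // (negPf nV) andbF.
move: nM; rewrite nE => nM.
rewrite leq_pmul2r // -mulnBl muln_gt0 V0 dvdn_mull // !andbT.
rewrite subn_gt0.
under eq_bigr do rewrite eqn_pmul2r //.
have [my|ym] := ltnP m y; last first.
  rewrite big1 ?if_same // => x _.
  by case: eqP => [<-|_]; rewrite ?andbF // ltnNge ym.
rewrite (ltnW my) (bigD1_seq y) ?iota_uniq ?mem_iota //=; last first.
  have := leq_pmulr y V0; lia.
rewrite my eqxx big1 ?addr0 // => x xy.
by rewrite eq_sym (negPf xy) andbF.
Qed.

(** For u_1 = x the larger entries contribute q^(x sumn t) times [suflser t] by induction; what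
    remains is the geometric sum of q^(x V) over x > m, with V = w + sumn t, equal to q^(m V)
    K(V). *)
Lemma count_increasing M m v n : all (leq 1) v -> (n <= M)%N ->
  (\sum_(u <- poslists M (size v)) (path ltn m u && (dotl u v == n)))%N%:R
  = (qXn (m * sumn v) * suflser v) n.
Proof.
elim: v m n => [|w t IH] m n /=.
  by rewrite big_seq1 muln0 mulr1 /= eq_sym.
move=> /andP[w0 t0] nM.
have V0 : (0 < w + sumn t)%N by lia.
have ef : eqq M (suflser t) (suflser t) by [].
rewrite mulrA -(eqqM (sum_qXn_lser m V0) ef nM) mulr_suml qser_sum.
rewrite -/(poslists M (size t).+1) sum_poslistsSn natr_sum; apply: eq_bigr => x _.
have -> : ((if (m < x)%N then qXn (x * (w + sumn t)) else 0) * suflser t) n =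
    if (m < x)%N then (qXn (x * (w + sumn t)) * suflser t) n else 0.
  by case: ifP => //; rewrite mul0r.
rewrite mulnDr qXnD -mulrA qXnM.
case: ifP => mx; last by rewrite big1 // => u _; rewrite /= mx.
case: leqP => xn; last first.
  rewrite big1 // => u _ /=.
  have -> : (x * w + dotl u t == n)%N = false by lia.
  by rewrite andbF.
rewrite -IH //; last by lia.
congr (_%:R); apply: eq_bigr => u _ /=; rewrite mx.
by have -> : (x * w + dotl u t == n)%N = (dotl u t == n - x * w)%N by lia.
Qed.

(** Conjugation of partitions: u is summed out for fixed v. Since u decreases in [sigma], both
    tuples are reversed first, which also reverses the exponents. *)
Lemma sigma_suflser r n : (sigma r n)%:R =
  \sum_(v <- poslists n (size r)) (monl (rev r) v)%:R * suflser v n.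
Proof.
rewrite sigmaE natr_sum [LHS]sum_poslists_rev.
rewrite [LHS]big_seq [RHS]big_seq; apply: eq_bigr => v.
rewrite mem_poslists => /andP[/eqP sv av].
have v1 : all (leq 1) v by apply: sub_all av => x /andP[].
have := count_increasing 0 v1 (leqnn n); rewrite mul0n qXn0 mul1r => <-.
rewrite -natrM big_distrr /=; congr (_%:R); rewrite sv.
rewrite (_ : (\sum_(u <- _) _)%N = \sum_(u <- poslists n (size r))
  (if sorted gtn u && (dotl u (rev v) == n) then monl r (rev v) else 0)) //.
rewrite sum_poslists_rev.
rewrite [LHS]big_seq [RHS]big_seq; apply: eq_bigr => u.
rewrite mem_poslists => /andP[/eqP su au].
rewrite rev_sorted dotl_rev ?su ?sv //.
have -> : monl r (rev v) = monl (rev r) v.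
  by rewrite -(monl_rev (_ : size r = size (rev v))) ?size_rev // revK.
have -> : sorted (fun x y : nat => gtn y x) u = path ltn 0 u.
  by case: u au {su} => //= x u /andP[/andP[->]].
by case: (_ && _); rewrite ?muln1 ?muln0.
Qed.

(* The sum over all subsets A of {1, ..., N}, listed in decreasing order, of
   phi A times the product of the q^V / (1 - q^V) for V in A. *)
Fixpoint subsum (phi : seq nat -> rat) (N : nat) : qseries :=
  if N is N'.+1
  then subsum phi N' + lser N * subsum (fun A => phi (N :: A)) N'
  else phi [::] *: 1.

(** Positive tuples correspond to finite sets of positive integers in decreasing order: suffix sums
    in one direction, gaps in the other. [suflser v] is the product of K(V) over the set
    [sufs v]. *)
Fixpoint sufs (v : seq nat) : seq nat :=
  if v is w :: t then (w + sumn t)%N :: sufs t else [::].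

Lemma size_sufs v : size (sufs v) = size v.
Proof. by elim: v => //= w v ->. Qed.

Lemma subsumS phi N :
  subsum phi N.+1 = subsum phi N + lser N.+1 * subsum (fun A => phi (N.+1 :: A)) N.
Proof. by []. Qed.

Lemma subsum_lin a phi psi N :
  subsum (fun A => a * phi A + psi A) N = a *: subsum phi N + subsum psi N.
Proof.
elim: N phi psi => [|N IH] phi psi; first by rewrite /= scalerDl scalerA.
rewrite !subsumS IH (IH (fun A => phi (N.+1 :: A))) mulrDr -scalerAr scalerDr.
by rewrite addrACA.
Qed.

Lemma subsum0 N : subsum (fun=> 0) N = 0.
Proof.
have := subsum_lin (-1) (fun=> 0) (fun=> 0) N; rewrite mulr0 addr0.
by rewrite scaleN1r addNr.
Qed.

Lemma subsumD phi psi N :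
  subsum (fun A => phi A + psi A) N = subsum phi N + subsum psi N.
Proof.
by have := subsum_lin 1 phi psi N; rewrite scale1r => <-; congr subsum;
  apply/funext => A; rewrite mul1r.
Qed.

Lemma subsumZ a phi N : subsum (fun A => a * phi A) N = a *: subsum phi N.
Proof.
have := subsum_lin a phi (fun=> 0) N; rewrite subsum0 addr0 => <-; congr subsum.
by apply/funext => A; rewrite addr0.
Qed.

Lemma subsum_unroll phi N : subsum phi N =
  phi [::] *: 1 + \sum_(V < N) lser V.+1 * subsum (fun A => phi (V.+1 :: A)) V.
Proof.
elim: N => [|N IH]; first by rewrite big_ord0 addr0.
by rewrite subsumS IH big_ord_recr addrA.
Qed.

Lemma subsum_stable phi N n : (n <= N)%N -> subsum phi N n = subsum phi n n.
Proof.
elim: N => [|N IH]; first by rewrite leqn0 => /eqP ->.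
rewrite leq_eqVlt => /orP[/eqP->//|]; rewrite ltnS => nN.
rewrite subsumS qserD IH //.
rewrite [X in _ + X]qserM big1 ?addr0 // => i _.
have iN : (i < N.+1)%N by rewrite (leq_trans (ltn_ord i)).
by rewrite /lser; case: (val i) iN => [|j] jN /=; rewrite ?mul0r // gtnNdvd // mul0r.
Qed.

(** Change of variable between the largest element w + s of a set and its first gap w, where s is
    the next element. *)
Lemma sum_shift M N s (h : nat -> qseries) : (N <= M)%N ->
  \sum_(V < N | (s <= V)%N) h V.+1 =
  \sum_(w <- iota 1 M) if (w + s <= N)%N then h (w + s)%N else 0.
Proof.
move=> NM.
have -> : iota 1 M = [seq i.+1 | i <- index_iota 0 M].
  by rewrite /index_iota subn0 -(iotaDl 1 0).
rewrite big_map -(big_mkord (fun V => s <= V)%N (fun V => h V.+1)).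
rewrite -big_mkcond /=.
have [sN|Ns] := leqP s N; last first.
  rewrite !big1_seq // => i; rewrite mem_index_iota => /andP[h1 h2]; first by lia.
  by move: h1; lia.
rewrite (big_cat_nat (leq0n s) sN) /= [X in X + _]big1_seq ?add0r; last first.
  by move=> i; rewrite mem_index_iota => /andP[h1 /andP[_ h2]]; lia.
rewrite -{1}[s]add0n big_addn (big_nat_widen 0 (N - s) M) ?(leq_trans (leq_subr _ _)) //.
apply: eq_big => i; first by lia.
by rewrite addSn.
Qed.

Lemma subsumE M l N phi : (N <= M)%N ->
  subsum (fun A => if size A == l then phi A else 0) N =
  \sum_(v <- poslists M l)
     if (sumn v <= N)%N then phi (sufs v) *: suflser v else 0.
Proof.
elim: l N phi => [|l IH] N phi NM.
  rewrite subsum_unroll big1 ?addr0 => [|V _]; last by rewrite subsum0 mulr0.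
  by rewrite big_seq1.
rewrite subsum_unroll /= scale0r add0r -/(poslists M l.+1) sum_poslistsS.
rewrite exchange_big /=.
under eq_bigr => V _.
  rewrite (IH _ (fun A => phi (V.+1 :: A))) ?(leq_trans (ltnW (ltn_ord V))) //.
  rewrite mulr_sumr; over.
rewrite exchange_big /=; apply: eq_bigr => t _.
rewrite -(sum_shift (sumn t) (fun V => phi (V :: sufs t) *: (lser V * suflser t)) NM).
rewrite [RHS]big_mkcond; apply: eq_bigr => V _.
by case: ifP; rewrite ?mulr0 // -scalerAr.
Qed.

(** The sum of a phi(A \ {a}) over a in A. It is the coefficient function of the off-diagonal part,
    b not in A, of the product of sum_b b K(b) with sum_A phi(A) K(A). *)
Fixpoint delta (phi : seq nat -> rat) (A : seq nat) : rat :=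
  if A is a :: A' then a%:R * phi A' + delta (fun B => phi (a :: B)) A' else 0.

(** Truncation of [2], written as a sum over V rather than as the generating series of divisor
    sums. *)
Definition hser (N : nat) : qseries := \sum_(b < N) b.+1%:R *: lser b.+1.

(** The inductive step of [qder_subsum], isolated over an abstract ring with the rational scalar
    turned into a ring element, so that it becomes a plain polynomial identity. *)
Lemma qder_subsum_step (A : comNzRingType) (a K P Q h s1 s2 d1 d2 : A) :
  h * P + s1 - d1 + (a * (K + K ^+ 2) * Q + K * (h * Q + s2 - d2)) =
  (h + a * K) * (P + K * Q) + (s1 + K * (a * Q + s2)) - (d1 + K * (a * P + d2)).
Proof. ring. Qed.

(* With K_V = q^V/(1 - q^V) one has qder K_V = V K_V + V K_V^2; the squares are
   the diagonal terms of the product of hser N with the products of the K_V. *)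
Lemma qder_subsum N phi :
  qder (subsum phi N) = hser N * subsum phi N
    + subsum (fun A => (sumn A)%:R * phi A) N - subsum (delta phi) N.
Proof.
elim: N phi => [|N IH] phi.
  rewrite /= /hser big_ord0 mul0r !add0r mul0r scale0r subrr.
  by rewrite qderZ qder1 scaler0.
have sE : subsum (fun A => (sumn (N.+1 :: A))%:R * phi (N.+1 :: A)) N =
    N.+1%:R *: subsum (fun A => phi (N.+1 :: A)) N
    + subsum (fun A => (sumn A)%:R * phi (N.+1 :: A)) N.
  rewrite -subsumZ -subsumD; congr subsum; apply/funext => A /=.
  by rewrite natrD mulrDl.
have dE : subsum (fun A => delta phi (N.+1 :: A)) N =
    N.+1%:R *: subsum phi N + subsum (delta (fun A => phi (N.+1 :: A))) N.
  by rewrite -subsumZ -subsumD.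
rewrite !subsumS qderD qderM !IH sE dE qder_lser //.
have -> : hser N.+1 = hser N + N.+1%:R *: lser N.+1 by rewrite /hser big_ord_recr.
set a := N.+1%:R; set K := lser _; set P := subsum phi N.
set Q := subsum (fun A => phi (N.+1 :: A)) N.
pose b : qseries := a%:A.
have e (x : qseries) : a *: x = b * x by rewrite mulr_algl.
clearbody b; rewrite !e; exact: qder_subsum_step.
Qed.

(** Polynomial functions of degree at most d in the elements of a set, entries past the end being
    read as 0. They are given by generators because the coefficients produced by the derivation only
    call for closure properties. *)
Inductive polfun : nat -> (seq nat -> rat) -> Prop :=
| polfun_const c : polfun 0 (fun=> c)
| polfun_nth i : polfun 1 (fun A => (nth 0%N A i)%:R)
| polfun_add d f g : polfun d f -> polfun d g -> polfun d (fun A => f A + g A)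
| polfun_mul d e f g : polfun d f -> polfun e g -> polfun (d + e) (fun A => f A * g A)
| polfun_le d e f : (d <= e)%N -> polfun d f -> polfun e f.

Lemma polfun_sum d n (F : nat -> seq nat -> rat) :
  (forall i, polfun d (F i)) -> polfun d (fun A => \sum_(i < n) F i A).
Proof.
move=> dF; elim: n => [|n IH].
  have -> : (fun A => \sum_(i < 0) F i A) = fun=> 0 by apply/funext => A; rewrite big_ord0.
  exact: polfun_le (leq0n d) (polfun_const 0).
have -> : (fun A => \sum_(i < n.+1) F i A) = fun A => \sum_(i < n) F i A + F n A.
  by apply/funext => A; rewrite big_ord_recr.
exact: polfun_add.
Qed.

Lemma polfun_exp d e f : polfun d f -> polfun (e * d) (fun A => f A ^+ e).
Proof.
move=> df; elim: e => [|e IH]; first by apply: polfun_le (polfun_const 1); lia.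
by have := polfun_mul df IH; under eq_fun do rewrite -exprS; rewrite -mulSn.
Qed.

Definition remnth (j : nat) (A : seq nat) : seq nat := take j A ++ drop j.+1 A.

Lemma nth_remnth j A i :
  nth 0%N (remnth j A) i = if (i < j)%N then nth 0%N A i else nth 0%N A i.+1.
Proof.
elim: j A i => [|j IH] A i; first by rewrite /remnth take0 nth_drop.
case: A => [|a A]; first by rewrite !nth_nil if_same.
case: i => // i; by rewrite /remnth /= -/(remnth j A) IH ltnS.
Qed.

Lemma polfun_remnth d f j : polfun d f -> polfun d (fun A => f (remnth j A)).
Proof.
elim=> [c|i|e g h _ IHg _ IHh|e e' g h _ IHg _ IHh|e e' g le _ IHg].
- exact: polfun_const.
- under eq_fun do rewrite nth_remnth.
  by case: (i < j)%N; apply: polfun_nth.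
- exact: polfun_add.
- exact: polfun_mul.
- exact: polfun_le IHg.
Qed.

Lemma deltaE phi A : delta phi A =
  \sum_(j < size A) (nth 0%N A j)%:R * phi (remnth j A).
Proof.
elim: A phi => [|a A IH] phi /=; first by rewrite big_ord0.
rewrite big_ord_recl IH /remnth /= drop0; congr (_ + _).
Qed.

Lemma size_remnth j A : (j < size A)%N -> (size (remnth j A)).+1 = size A.
Proof. by move=> jA; rewrite size_cat size_take size_drop jA; lia. Qed.

Lemma delta_size l phi :
  delta (fun A => if size A == l then phi A else 0) =
  fun A => if size A == l.+1
    then \sum_(j < l.+1) (nth 0%N A j)%:R * phi (remnth j A) else 0.
Proof.
apply/funext => A; rewrite deltaE; case: eqP => [sA|sA].
  rewrite sA; apply: eq_bigr => j _.
  by rewrite -eqSS size_remnth ?sA // eqxx.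
rewrite big1 // => j _; rewrite -eqSS size_remnth //.
by case: eqP => //; rewrite mulr0.
Qed.

(** The explicit counterpart of [polfun], in the gaps v instead of the elements: combinations of
    monomials in exactly l variables, from which brackets can be read off. *)
Definition polcomb l d (f : seq nat -> rat) :=
  exists2 c : seq (rat * seq nat),
    all (fun p => (size p.2 == l) && (sumn p.2 <= d)%N) c &
    forall v, size v = l -> f v = \sum_(p <- c) p.1 * (monl p.2 v)%:R.

Lemma polcomb_le l d e f : (d <= e)%N -> polcomb l d f -> polcomb l e f.
Proof.
move=> de [c ac fc]; exists c => //; apply: sub_all ac => p /andP[-> /leq_trans]; exact.
Qed.

Lemma polcomb_add l d f g : polcomb l d f -> polcomb l d g ->
  polcomb l d (fun v => f v + g v).
Proof.
move=> [c ac fc] [c' ac' fc']; exists (c ++ c'); first by rewrite all_cat ac.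
by move=> v sv; rewrite big_cat fc ?fc'.
Qed.

Definition adds (e f : seq nat) := [seq (p.1 + p.2)%N | p <- zip e f].

Lemma monl_adds e f v : size e = size f ->
  monl (adds e f) v = (monl e v * monl f v)%N.
Proof.
elim: e f v => [|x e IH] [|y f] [|z v] //= [sef].
by rewrite /adds /= -/(adds e f) IH // expnD; lia.
Qed.

Lemma size_adds e f : size e = size f -> size (adds e f) = size f.
Proof. by move=> ef; rewrite size_map size_zip ef minnn. Qed.

Lemma sumn_adds e f : size e = size f -> sumn (adds e f) = (sumn e + sumn f)%N.
Proof.
elim: e f => [|x e IH] [|y f] //= [sef].
by rewrite /adds /= -/(adds e f) IH //; lia.
Qed.

Lemma polcomb_mul l d e f g : polcomb l d f -> polcomb l e g ->
  polcomb l (d + e) (fun v => f v * g v).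
Proof.
move=> [c ac fc] [c' ac' fc'].
exists [seq (p.1 * p'.1, adds p.2 p'.2) | p <- c, p' <- c'].
  apply/allP => q /allpairsP[[p p'] [/= pc pc' ->]] /=.
  have /andP[/eqP s1 d1] := allP ac _ pc; have /andP[/eqP s2 d2] := allP ac' _ pc'.
  by rewrite size_adds ?sumn_adds ?s1 ?s2 // eqxx leq_add.
move=> v sv; rewrite fc ?fc' // big_allpairs_dep mulr_suml /=.
rewrite [LHS]big_seq [RHS]big_seq; apply: eq_bigr => p pc.
rewrite mulr_sumr [LHS]big_seq [RHS]big_seq; apply: eq_bigr => p' pc' /=.
have /andP[/eqP s1 d1] := allP ac _ pc; have /andP[/eqP s2 d2] := allP ac' _ pc'.
by rewrite monl_adds ?s1 ?s2 // natrM mulrACA.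
Qed.

Lemma monl_nseq0 l v : monl (nseq l 0%N) v = 1%N.
Proof. by elim: l v => [|l IH] [|x v] //=; rewrite IH. Qed.

Lemma polcomb_const l c : polcomb l 0 (fun=> c).
Proof.
exists [:: (c, nseq l 0%N)]; first by rewrite /= size_nseq eqxx sumn_nseq.
by move=> v _; rewrite big_seq1 monl_nseq0 mulr1.
Qed.

Lemma polcomb_ext l d f g : (forall v, size v = l -> f v = g v) ->
  polcomb l d g -> polcomb l d f.
Proof. by move=> fg [c ac fc]; exists c => // v sv; rewrite fg ?fc. Qed.

Lemma polcomb_cons l d f : polcomb l d f -> polcomb l.+1 d (fun v => f (behead v)).
Proof.
move=> [c ac fc]; exists [seq (p.1, 0%N :: p.2) | p <- c].
  by rewrite all_map; apply: sub_all ac => p /=.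
case=> // x v [sv]; rewrite big_map /= fc //; apply: eq_bigr => p _.
by rewrite expn0 mul1n.
Qed.

Lemma polcomb_sumn l : polcomb l 1 (fun v => (sumn v)%:R).
Proof.
elim: l => [|l IH].
  by apply: (polcomb_ext (g := fun=> 0)) => [[]|] //; apply: polcomb_le (polcomb_const _ _).
apply: (polcomb_ext (g := fun v => (head 0%N v)%:R + (sumn (behead v))%:R)).
  by case=> // x v _; rewrite -natrD.
apply: polcomb_add; last exact: polcomb_cons IH.
exists [:: (1, 1%N :: nseq l 0%N)]; first by rewrite /= size_nseq eqxx sumn_nseq.
by case=> // x v _; rewrite big_seq1 /= monl_nseq0 mul1r expn1 muln1.
Qed.

Lemma polcomb_nth l i : polcomb l 1 (fun v => (nth 0%N (sufs v) i)%:R).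
Proof.
elim: l i => [|l IH] i.
  by apply: (polcomb_ext (g := fun=> 0)) => [[|//] _|]; [rewrite nth_nil|apply: polcomb_le (polcomb_const _ _)].
case: i => [|i].
  by apply: polcomb_ext (polcomb_sumn _) => -[].
by apply: polcomb_ext (polcomb_cons (IH i)) => -[].
Qed.

(** Elements are sums of gaps, so a polynomial in the elements is one of the same degree bound in
    the gaps. *)
Lemma polfun_polcomb l d f : polfun d f -> polcomb l d (fun v => f (sufs v)).
Proof.
elim=> [c|i|e g h _ IHg _ IHh|e e' g h _ IHg _ IHh|e e' g le _ IHg].
- exact: polcomb_const.
- exact: polcomb_nth.
- exact: polcomb_add.
- exact: polcomb_mul.
- exact: polcomb_le IHg.
Qed.

(** The full series over all sets of size l, read on the diagonal as for [pbr]: a set with an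
    element above n does not contribute to q^n. *)
Definition diagsum l (phi : seq nat -> rat) : qseries :=
  fun n => subsum (fun A => if size A == l then phi A else 0) n n.

Lemma diagsumE l phi n :
  diagsum l phi n = \sum_(v <- poslists n l) phi (sufs v) * suflser v n.
Proof.
rewrite /diagsum (subsumE _ _ (leqnn n)) qser_sum; apply: eq_bigr => v _.
(* If [sumn v] exceeds n, the first factor of [suflser v] is [lser (sumn v)], which has no term up
   to q^n; the bound on [sumn v] can thus be dropped. *)
rewrite -qserZ; case: leqP => // vn; rewrite qserZ.
case: v vn => // w t vn; rewrite [suflser _]/= qserM big1 ?mulr0 // => i _.
have iN : (i < w + sumn t)%N by apply: leq_trans vn; exact: ltn_ord.
by rewrite /lser; case: (val i) iN => [|j] jN /=; rewrite ?mul0r // gtnNdvd // mul0r.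
Qed.

Lemma diagsum_monl l phi r : size r = l ->
  (forall v, size v = l -> phi (sufs v) = (monl r v)%:R) ->
  diagsum l phi = (\prod_(x <- rev r) x`!)%:R *: bracket [seq x.+1 | x <- rev r].
Proof.
move=> sr phir; rewrite -pbr_monom; apply/funext => n.
rewrite -sigma_pbr sigma_suflser revK size_rev sr diagsumE.
rewrite big_seq [RHS]big_seq; apply: eq_bigr => v.
by rewrite mem_poslists => /andP[/eqP sv _]; rewrite phir.
Qed.

(** A monomial of degree e in the l gaps gives, up to factorials, a bracket whose entries are the
    exponents plus one, of weight l + e. *)
Lemma diagsum_FilMD l d phi : polfun d phi -> FilMD (l + d) (diagsum l phi).
Proof.
move=> /(polfun_polcomb l)[c ac phic].
have -> : diagsum l phi = \sum_(p <- c) p.1 *: pbr [seq 'X^x | x <- rev p.2].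
  apply/funext => n; rewrite qser_sum diagsumE.
  transitivity (\sum_(v <- poslists n l) \sum_(p <- c) p.1 * ((monl p.2 v)%:R * suflser v n)).
    rewrite big_seq [RHS]big_seq; apply: eq_bigr => v.
    rewrite mem_poslists => /andP[/eqP sv _]; rewrite phic // mulr_suml.
    by apply: eq_bigr => p _; rewrite mulrA.
  rewrite exchange_big big_seq [RHS]big_seq; apply: eq_bigr => p pc.
  have /andP[/eqP s1 _] := allP ac _ pc.
  by rewrite qserZ -mulr_sumr -sigma_pbr sigma_suflser revK size_rev s1.
apply: bracket_span_sum => p pc; apply: bracket_spanZ.
have /andP[/eqP s1 d1] := allP ac _ pc.
have := @pbr_FilMD_monom (rev p.2) [::] [::] isT.
rewrite cats0 size_rev sumn_rev s1 addn0; apply: FilMD_le.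
by rewrite addnC leq_add2l.
Qed.

(** A monomial in v rewritten in the elements of the set, v_i being a_i - a_(i+1); the default
    [head 0%N] makes the last gap equal to the last element. *)
Fixpoint gapmon (r A : seq nat) : rat :=
  match r, A with
  | e :: r', a :: A' => (a%:R - (head 0%N A')%:R) ^+ e * gapmon r' A'
  | _, _ => 1
  end.

Lemma gapmon_sufs r v : gapmon r (sufs v) = (monl r v)%:R.
Proof.
elim: r v => [|e r IH] [|w t] //=; rewrite IH natrM natrX; congr (_ ^+ _ * _).
by case: t => [|x t] /=; rewrite ?addn0 ?subr0 // natrD addrK.
Qed.

Lemma polfun_behead d f : polfun d f -> polfun d (fun A => f (behead A)).
Proof.
elim=> [c|i|e g h _ IHg _ IHh|e e' g h _ IHg _ IHh|e e' g le _ IHg].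
- exact: polfun_const.
- by under eq_fun do rewrite nth_behead; apply: polfun_nth.
- exact: polfun_add.
- exact: polfun_mul.
- exact: polfun_le IHg.
Qed.

Lemma polfun_gapmon r : exists2 phi, polfun (sumn r) phi &
  forall A, size A = size r -> gapmon r A = phi A.
Proof.
elim: r => [|e r [phi pphi ephi]]; first by exists (fun=> 1) => //; apply: polfun_const.
exists (fun A => ((nth 0%N A 0)%:R + -1 * (nth 0%N A 1)%:R) ^+ e * phi (behead A)).
  apply: polfun_mul; last exact: polfun_behead.
  apply: (@polfun_le (e * 1)); first by rewrite muln1.
  apply: polfun_exp; apply: polfun_add; first exact: polfun_nth.
  by apply: (polfun_mul (d := 0)); [apply: polfun_const|apply: polfun_nth].
by case=> // a A [sA]; rewrite /= ephi // mulN1r -nth0; case: A {sA}.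
Qed.

Lemma hserE N : hser N = subsum (fun A => if size A == 1%N then (head 0%N A)%:R else 0) N.
Proof.
rewrite subsum_unroll /= scale0r add0r; apply: eq_bigr => V _.
transitivity (lser V.+1 * (V.+1%:R *: 1)); first by rewrite -scalerAr mulr1.
congr (_ * _).
have := subsumE 0 (fun=> V.+1%:R) (leqnn V); rewrite /= big_seq1 /= => <-.
by congr subsum; apply/funext => -[].
Qed.

(** From v = 'C(v - 1, 1) + 'C(v - 1, 0). *)
Lemma bracket2E : bracket [:: 2%N] = kbr [:: 2%N] + kbr [:: 1%N].
Proof.
have e : monp 1 = 1 *: binp 1 + binp 0.
  by rewrite /monp /= invr1 !scale1r mul1r subrK expr1.
by rewrite bracketE /kbr /= e (pbr_lin [::] [::]) scale1r.
Qed.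

Lemma bracket2_hser N : eqq N (hser N) (bracket [:: 2%N]).
Proof.
move=> n nN; rewrite hserE subsum_stable //.
have := @diagsum_monl 1 (fun A => (head 0%N A)%:R) [:: 1%N] erefl.
rewrite /= big_seq1 scale1r /diagsum => <- //.
by case=> [|x []] //= _; rewrite addn0 muln1.
Qed.

Lemma bracket2M_FilMD w f : FilMD w f -> FilMD (2 + w) (bracket [:: 2%N] * f).
Proof.
move=> wf; rewrite bracket2E mulrDl; apply: bracket_spanD; first exact: kbrM_FilMD.
by apply: FilMD_le (kbrM_FilMD _ wf); lia.
Qed.

Lemma qder_bracket_FilMD s : is_index s -> FilMD (sumn s).+2 (qder (bracket s)).
Proof.
move=> s1; set r := rev [seq x.-1 | x <- s]; set l := size r.
have [phi pphi ephi] := polfun_gapmon r.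
have dE : diagsum l phi = (\prod_(x <- rev r) x`!)%:R *: bracket s.
  rewrite (diagsum_monl (r := r)) //; last first.
    by move=> v sv; rewrite -ephi ?size_sufs // gapmon_sufs.
  rewrite revK -map_comp; congr (_ *: bracket _).
  by rewrite -[RHS]map_id; apply/eq_in_map => x xs /=; rewrite prednK // (allP s1).
have c0 : (\prod_(x <- rev r) x`!)%:R != 0 :> rat.
  by rewrite pnatr_eq0 -lt0n prodn_gt0 // => i; exact: fact_gt0.
have sr : (sumn r + l)%N = sumn s.
  rewrite /l /r size_rev sumn_rev size_map; elim: s s1 {r l phi pphi ephi dE c0} => //= a s IH.
  by move=> /andP[a0 /IH]; lia.
have bE : bracket s = (\prod_(x <- rev r) x`!)%:R^-1 *: diagsum l phi.
  by rewrite dE scalerA mulVf // scale1r.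
rewrite bE qderZ; apply: bracket_spanZ.
(* [qder_subsum] taken at N = n for each coefficient. With w = [sumn s] the three terms have weight
   at most w + 2 (product with [2]), w + 1 (one more degree, same size) and w + 2 (one more degree
   and one more element). *)
have -> : qder (diagsum l phi) = bracket [:: 2%N] * diagsum l phi
   + diagsum l (fun A => (\sum_(i < l) (nth 0%N A i)%:R) * phi A)
   - diagsum l.+1 (fun A => \sum_(j < l.+1) (nth 0%N A j)%:R * phi (remnth j A)).
  apply/funext => n.
  have := congr1 (fun f : qseries => f n)
    (qder_subsum n (fun A => if size A == l then phi A else 0)).
  rewrite {1 2}/qder -/(diagsum l phi n) => ->; rewrite !qserD !qserN delta_size.
  congr (_ + _ + _); last first.
    rewrite /diagsum; congr (subsum _ n n); apply/funext => A.
    case: eqP => [sA|_]; last by rewrite mulr0.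
    congr (_ * _); rewrite sumnE natr_sum (big_nth 0%N) big_mkord sA.
    by [].
  have dn : eqq n (subsum (fun A => if size A == l then phi A else 0) n) (diagsum l phi).
    by move=> i ni; rewrite subsum_stable.
  by rewrite (eqqM (@bracket2_hser n) dn).
apply: bracket_spanB; first apply: bracket_spanD.
- have lF : FilMD (l + sumn r) (diagsum l phi) by exact: diagsum_FilMD.
  by apply: FilMD_le (bracket2M_FilMD lF); lia.
- have := @diagsum_FilMD l (1 + sumn r) (fun A => (\sum_(i < l) (nth 0%N A i)%:R) * phi A).
  move=> h; apply: FilMD_le (h _); first by lia.
  apply: polfun_mul => //; apply: (@polfun_sum _ l (fun i A => (nth 0%N A i)%:R)).
  by move=> i; apply: polfun_nth.
- have := @diagsum_FilMD l.+1 (1 + sumn r) (fun A =>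
    \sum_(j < l.+1) (nth 0%N A j)%:R * phi (remnth j A)).
  move=> h; apply: FilMD_le (h _); first by lia.
  apply: (@polfun_sum _ l.+1 (fun j A => (nth 0%N A j)%:R * phi (remnth j A))) => j.
  by apply: polfun_mul; [apply: polfun_nth|apply: polfun_remnth].
Qed.

Lemma qder_FilMD k f : FilMD (k - 2) f -> FilMD k (qder f).
Proof.
move: f; apply: (@bracket_span_rect _ (fun f => FilMD k (qder f))) => [|c f g Pf Pg|s /andP[s1 sk]].
- by rewrite qder0; apply: bracket_span0.
- by rewrite qderD qderZ; apply: bracket_spanD => //; apply: bracket_spanZ.
(* A nonempty index has positive weight, so for it k - 2 is a genuine difference; the empty index,
   present for every k, is killed by the derivation. *)
case: s s1 sk => [|a s] s1 sk.
  by rewrite bracket_nil qder1; apply: bracket_span0.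
apply: FilMD_le (qder_bracket_FilMD s1).
by move: s1 sk => /andP[a0 _] /=; lia.
Qed.

Import numFieldNormedType.Exports.
Local Open Scope classical_set_scope.

(** * Evaluation of power series *)

Lemma size_poslists M l : size (poslists M l) = (M ^ l)%N.
Proof. by elim: l => //= l IH; rewrite size_allpairs size_iota IH expnS. Qed.

Lemma leq_expn2 m n e : (m <= n)%N -> (m ^ e <= n ^ e)%N.
Proof. by case: e => // e; rewrite leq_exp2r. Qed.

Lemma monl_le M r v : all (fun x => x <= M)%N v -> (monl r v <= M.+1 ^ sumn r)%N.
Proof.
elim: r v => [|e r IH] [|x v] //= => [_|/andP[xM vM]]; first by rewrite expn_gt0.
by rewrite expnD leq_mul ?IH // leq_expn2 // ltnW.
Qed.

Lemma sigma_le r n : (sigma r n <= n.+1 ^ (size r + size r + sumn r))%N.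
Proof.
rewrite sigmaE.
apply: (@leq_trans (\sum_(v <- poslists n (size r)) \sum_(u <- poslists n (size r)) n.+1 ^ sumn r)).
  rewrite big_seq [leqRHS]big_seq; apply: leq_sum => v; rewrite mem_poslists => /andP[_ av].
  apply: leq_sum => u _; case: ifP => // _; apply: monl_le.
  by apply: sub_all av => x /andP[].
rewrite !big_const_seq !count_predT !iter_addn_0 size_poslists -mulnA mulnC !expnD.
by do 2?[apply: leq_mul]; rewrite ?leq_expn2.
Qed.

Section Evaluation.
Variable R : realType.
Implicit Types (f g : qseries) (q : R).

(** Absolute convergence on [0, 1), phrased with bounded partial sums so that closure under sums,
    products and [qder] reduces to finite inequalities. *)
Definition tempered f := forall q, 0 <= q < 1 ->
  exists C : R, forall N, \sum_(n < N) `|ratr (f n)| * q ^+ n <= C.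

Lemma tempered_le f g : (forall n, `|f n| <= `|g n|) -> tempered g -> tempered f.
Proof.
move=> fg tg q /[dup] q01 /tg[C gC]; exists C => N; apply: le_trans (gC N).
apply: ler_sum => n _; apply: ler_wpM2r; first by rewrite exprn_ge0 //; case/andP: q01.
by rewrite -!ratr_norm ler_rat.
Qed.

Lemma temperedD f g : tempered f -> tempered g -> tempered (f + g).
Proof.
move=> tf tg q /[dup] q01 /[dup] /tf[C fC] /tg[D gD]; exists (C + D) => N.
apply: le_trans (lerD (fC N) (gD N)); rewrite -big_split /=; apply: ler_sum => n _.
rewrite -mulrDl; apply: ler_wpM2r; first by rewrite exprn_ge0 //; case/andP: q01.
by rewrite qserD rmorphD ler_normD.
Qed.

Lemma temperedZ a f : tempered f -> tempered (a *: f).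
Proof.
move=> tf q /[dup] q01 /tf[C fC]; exists (`|ratr a| * C) => N.
apply: le_trans (ler_wpM2l (normr_ge0 _) (fC N)).
by rewrite mulr_sumr; apply: ler_sum => n _; rewrite qserZ rmorphM normrM mulrA.
Qed.

Lemma tempered0 : tempered 0.
Proof.
move=> q _; exists 0 => N; rewrite big1 // => n _.
by rewrite qser0 rmorph0 normr0 mul0r.
Qed.

Lemma sum_triangle (a b : nat -> R) N :
  \sum_(n < N) \sum_(i < n.+1) a i * b (n - i)%N =
  \sum_(i < N) \sum_(j < N | (i + j < N)%N) a i * b j.
Proof.
transitivity (\sum_(0 <= n < N) \sum_(0 <= i < N | (i <= n)%N) a i * b (n - i)%N).
  rewrite big_mkord; apply: eq_bigr => n _.
  rewrite -(big_mkord xpredT (fun i => a i * b (n - i)%N)).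
  by rewrite (big_nat_widen 0 n.+1 N).
rewrite (exchange_big_dep xpredT) //= big_mkord; apply: eq_bigr => i _.
rewrite -(big_mkord (fun j => i + j < N)%N (fun j => a i * b j)).
rewrite [LHS]big_mkcond /=.
rewrite (big_cat_nat (leq0n i) (ltnW (ltn_ord i))) /= big1_seq ?add0r; last first.
  by move=> n; rewrite mem_index_iota => /andP[_ /andP[_ ni]]; rewrite leqNgt ni.
rewrite -{1}[i : nat]add0n big_addn (big_nat_widen 0 (N - i) N) ?leq_subr //.
apply: eq_big => j; first by lia.
by move=> _; rewrite leq_addl addnK.
Qed.

Lemma sum_ord_norm (a b : nat -> R) N :
  \sum_(n < N) `|\sum_(i < n.+1) a i * b (n - i)%N| <=
  (\sum_(i < N) `|a i|) * (\sum_(i < N) `|b i|).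
Proof.
apply: (@le_trans _ _ (\sum_(n < N) \sum_(i < n.+1) `|a i| * `|b (n - i)%N|)).
  apply: ler_sum => n _; apply: le_trans (ler_norm_sum _ _ _) _.
  by apply: ler_sum => i _; rewrite normrM.
rewrite (sum_triangle (fun i => `|a i|) (fun i => `|b i|)) mulr_suml.
apply: ler_sum => i _; rewrite mulr_sumr big_mkcond.
by apply: ler_sum => j _; case: ifP => // _; rewrite mulr_ge0.
Qed.

(** A pair (i, j) with i + j >= N has an entry outside the lower half of the range, so the
    discrepancy is bounded by the full square minus the half square of the absolute sums. Both tend
    to the same limit, which proves convergence of the Cauchy product. *)
Lemma cauchy_product_bound (a b : nat -> R) N :
  `|(\sum_(i < N) a i) * (\sum_(i < N) b i)
    - \sum_(n < N) \sum_(i < n.+1) a i * b (n - i)%N| <=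
  (\sum_(i < N) `|a i|) * (\sum_(i < N) `|b i|)
  - (\sum_(i < N./2) `|a i|) * (\sum_(i < N./2) `|b i|).
Proof.
have MN : (N./2 <= N)%N by have := odd_double_half N; rewrite -addnn; lia.
rewrite sum_triangle (big_ord_widen _ (fun i => `|a i|) MN).
rewrite (big_ord_widen _ (fun i => `|b i|) MN) !mulr_suml [X in _ <= _ - X]big_mkcond /=.
rewrite -!sumrB; apply: le_trans (ler_norm_sum _ _ _) _; apply: ler_sum => i _.
rewrite !mulr_sumr [X in _ - X]big_mkcond -!sumrB.
case: ifP => iM; last first.
  rewrite subr0; apply: le_trans (ler_norm_sum _ _ _) _; apply: ler_sum => j _.
  by case: ifP; rewrite ?subrr ?normr0 ?mulr_ge0 // subr0 normrM.
rewrite [X in _ <= _ - X]big_mkcond -sumrB.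
apply: le_trans (ler_norm_sum _ _ _) _; apply: ler_sum => j _.
case: ifP => ij; first by rewrite subrr normr0 subr_ge0; case: ifP => // _; rewrite mulr_ge0.
have -> : (j < N./2)%N = false.
  apply/negbTE; move: ij iM (odd_double_half N); rewrite -addnn; case: (odd N); lia.
by rewrite !subr0 normrM.
Qed.

Lemma ratr_mulE f g q n : ratr ((f * g) n) * q ^+ n =
  \sum_(i < n.+1) (ratr (f i) * q ^+ i) * (ratr (g (n - i)%N) * q ^+ (n - i)) :> R.
Proof.
rewrite qserM rmorph_sum mulr_suml; apply: eq_bigr => i _.
rewrite rmorphM [RHS]mulrACA -exprD subnKC //.
by rewrite -ltnS ltn_ord.
Qed.

Lemma term_norm f q n : 0 <= q -> `|ratr (f n)| * q ^+ n = `|ratr (f n) * q ^+ n| :> R.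
Proof. by move=> q0; rewrite [RHS]normrM (ger0_norm (exprn_ge0 n q0)). Qed.

Lemma temperedM f g : tempered f -> tempered g -> tempered (f * g).
Proof.
move=> tf tg q /[dup] q01 /[dup] /tf[C fC] /tg[D gD]; exists (C * D) => N.
have q0 : 0 <= q by case/andP: q01.
apply: (@le_trans _ _ ((\sum_(i < N) `|ratr (f i) * q ^+ i|) *
                       (\sum_(i < N) `|ratr (g i) * q ^+ i|))).
  under eq_bigr => n _ do rewrite term_norm // ratr_mulE.
  exact: sum_ord_norm (fun i => ratr (f i) * q ^+ i) (fun i => ratr (g i) * q ^+ i) N.
apply: ler_pM; do ?[exact: sumr_ge0].
  by have := fC N; under eq_bigr do rewrite term_norm //.
by have := gD N; under eq_bigr do rewrite term_norm //.
Qed.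

Lemma tempered_const1 : tempered (fun=> 1).
Proof.
move=> q /andP[q0 q1]; exists ((1 - q)^-1) => N.
have -> : \sum_(n < N) `|ratr 1| * q ^+ n = (1 - q)^-1 * (1 - q ^+ N).
  elim: N => [|N IH]; first by rewrite big_ord0 expr0 subrr mulr0.
  rewrite big_ord_recr /= IH rmorph1 normr1 mul1r exprS; field.
  by rewrite subr_eq0 gt_eqF.
rewrite ler_piMr ?invr_ge0 ?subr_ge0 ?(ltW q1) // lerBlDr lerDl.
by rewrite exprn_ge0.
Qed.

(* The mean value estimate for p^n - q^n with p = (1 + q)/2. *)
Lemma natmul_expr_le q n : 0 <= q < 1 ->
  n%:R * q ^+ n <= 2 / (1 - q) * ((1 + q) / 2) ^+ n.
Proof.
move=> /andP[q0 q1]; set p := (1 + q) / 2.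
have qp : p = q + (1 - q) / 2 by rewrite /p; field.
have pq : q <= p by rewrite qp lerDl divr_ge0 // subr_ge0 ltW.
have key : n%:R * ((1 - q) / 2) * q ^+ n <= p ^+ n.
  elim: n => [|n IH]; first by rewrite !mul0r expr0.
  rewrite !exprS; have h1 : 0 <= q ^+ n by rewrite exprn_ge0.
  have h2 : q ^+ n <= p ^+ n by rewrite lerXn2r // nnegrE ?(le_trans q0).
  have h3 : p * p ^+ n = q * p ^+ n + (1 - q) / 2 * p ^+ n by rewrite {1}qp mulrDl.
  have h4 : q * (n%:R * ((1 - q) / 2) * q ^+ n) <= q * p ^+ n by rewrite ler_wpM2l.
  have h5 : (1 - q) / 2 * q ^+ n * q <= (1 - q) / 2 * p ^+ n.
    have e0 : 0 <= (1 - q) / 2 by rewrite divr_ge0 // subr_ge0 ltW.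
    rewrite -mulrA; apply: ler_wpM2l => //; apply: le_trans h2.
    by rewrite ler_piMr // ltW.
  rewrite h3 -natr1; lra.
have q1' : 0 < 1 - q by rewrite subr_gt0.
have -> : n%:R * q ^+ n = 2 / (1 - q) * (n%:R * ((1 - q) / 2) * q ^+ n).
  by field; rewrite gt_eqF.
by rewrite ler_wpM2l // divr_ge0 // ltW.
Qed.

Lemma tempered_qder f : tempered f -> tempered (qder f).
Proof.
move=> tf q /[dup] q01 /andP[q0 q1].
have p01 : 0 <= (1 + q) / 2 < 1 by lra.
have [C fC] := tf _ p01; exists (2 / (1 - q) * C) => N.
have e0 : 0 <= 2 / (1 - q) by rewrite divr_ge0 // subr_ge0 ltW.
apply: le_trans (ler_wpM2l e0 (fC N)); rewrite mulr_sumr; apply: ler_sum => n _.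
have -> : `|ratr (qder f n)| * q ^+ n = `|ratr (f n)| * (n%:R * q ^+ n) :> R.
  have -> : ratr (qder f n) = n%:R * ratr (f n) :> R.
    by rewrite /qder (rmorphM (ratr : rat -> R)) /= ratr_nat.
  by rewrite (normrM n%:R) normr_nat; ring.
by rewrite [leRHS]mulrCA ler_wpM2l // natmul_expr_le.
Qed.

(** Polynomial growth comes from applying [qder] to the geometric series: (n+1)^(d+1) = n (n+1)^d +
    (n+1)^d. *)
Lemma tempered_nat_exp d : tempered (fun n => n.+1%:R ^+ d).
Proof.
elim: d => [|d IH]; first exact: tempered_const1.
have -> : (fun n => n.+1%:R ^+ d.+1) =
    qder (fun n => n.+1%:R ^+ d) + (fun n => n.+1%:R ^+ d) :> qseries.
  by apply/funext => n; rewrite qserD /qder exprS -natr1 mulrDl mul1r.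
exact: temperedD (tempered_qder IH) IH.
Qed.

Lemma tempered_bracket s : tempered (bracket s).
Proof.
set r := [seq x.-1 | x <- s].
apply: (tempered_le _ (tempered_nat_exp (size r + size r + sumn r))) => n.
rewrite /bracket -/r normf_div !normr_nat -natrX normr_nat.
apply: (@le_trans _ _ (sigma r n)%:R).
  rewrite ler_piMr // invf_le1 ?ler1n ?ltr0n prodn_gt0 // => i; exact: fact_gt0.
by rewrite ler_nat sigma_le.
Qed.

Lemma tempered_span (S : pred (seq nat)) f : bracket_span S f -> tempered f.
Proof.
apply: bracket_span_rect => [|a g h tg th|s _]; first exact: tempered0.
  by apply: temperedD => //; apply: temperedZ.
exact: tempered_bracket.
Qed.

Lemma tempered_qXn a : tempered (qXn a).
Proof.
apply: tempered_le tempered_const1 => n; rewrite /qXn normr1.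
by case: eqP; rewrite ?normr1 ?normr0.
Qed.

Lemma tempered_lser u : tempered (lser u).
Proof.
apply: tempered_le tempered_const1 => n; rewrite /lser normr1.
by case: (_ && _); rewrite ?normr1 ?normr0.
Qed.

Lemma tempered1 : tempered 1.
Proof. by rewrite -qXn0; apply: tempered_qXn. Qed.

Lemma temperedX f m : tempered f -> tempered (f ^+ m).
Proof.
move=> tf; elim: m => [|m IH]; first exact: tempered1.
by rewrite exprS; apply: temperedM.
Qed.

Lemma tempered_sum (I : Type) (r : seq I) (F : I -> qseries) :
  (forall i, tempered (F i)) -> tempered (\sum_(i <- r) F i).
Proof.
by move=> tF; apply: big_ind => //; [exact: tempered0|exact: temperedD].
Qed.

Lemma pseries_psum f q N :
  pseries (fun n => ratr (f n)) q N = \sum_(n < N) ratr (f n) * q ^+ n.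
Proof. by rewrite /pseries /= /series /= big_mkord. Qed.

Lemma tempered_normed_cvg f q : tempered f -> 0 <= q < 1 ->
  cvgn (fun N => \sum_(n < N) `|ratr (f n) * q ^+ n|).
Proof.
move=> tf /[dup] q01 /tf[C fC]; have q0 : 0 <= q by case/andP: q01.
apply: nondecreasing_is_cvgn.
  apply/nondecreasing_seqP => n; rewrite big_ord_recr /= lerDl //.
exists C => _ [N _ <-]; apply: le_trans (fC N); apply: ler_sum => n _.
by rewrite term_norm.
Qed.

Lemma pseval_cvg f q : tempered f -> 0 <= q < 1 ->
  pseries (fun n => ratr (f n)) q @ \oo --> pseval f q.
Proof.
move=> tf q01; have := tempered_normed_cvg tf q01.
have -> : (fun N => \sum_(n < N) `|ratr (f n) * q ^+ n|) =
    [normed series (fun n => ratr (f n) * q ^+ n)].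
  by apply/funext => N; rewrite /= /series /= big_mkord.
exact: (@normed_cvg R R).
Qed.

Lemma psevalD f g q : tempered f -> tempered g -> 0 <= q < 1 ->
  pseval (f + g) q = pseval f q + pseval g q.
Proof.
move=> tf tg q01; apply: cvg_lim => //.
have -> : pseries (fun n => ratr ((f + g) n)) q =
    pseries (fun n => ratr (f n)) q \+ pseries (fun n => ratr (g n)) q.
  apply/funext => N; rewrite /= !pseries_psum -big_split /=; apply: eq_bigr => n _.
  by rewrite qserD rmorphD mulrDl.
exact: cvgD (pseval_cvg tf q01) (pseval_cvg tg q01).
Qed.

Lemma psevalZ a f q : tempered f -> 0 <= q < 1 ->
  pseval (a *: f) q = ratr a * pseval f q.
Proof.
move=> tf q01; apply: cvg_lim => //.
have -> : pseries (fun n => ratr ((a *: f) n)) q =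
    (fun N => ratr a * pseries (fun n => ratr (f n)) q N).
  apply/funext => N; rewrite !pseries_psum mulr_sumr; apply: eq_bigr => n _.
  by rewrite qserZ rmorphM mulrA.
by apply: cvgM; [exact: cvg_cst|exact: pseval_cvg].
Qed.

Lemma cvg_half : (fun N : nat => N./2) @ \oo --> \oo.
Proof.
move=> P [N _ PN]; exists N.*2 => // n /= Nn; apply: PN => /=.
by rewrite -(doubleK N) half_leq.
Qed.

Lemma psevalM f g q : tempered f -> tempered g -> 0 <= q < 1 ->
  pseval (f * g) q = pseval f q * pseval g q.
Proof.
move=> tf tg q01; apply: cvg_lim => //.
set a := fun n => ratr (f n) * q ^+ n; set b := fun n => ratr (g n) * q ^+ n.
have ca := tempered_normed_cvg tf q01; have cb := tempered_normed_cvg tg q01.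
set A := fun N => \sum_(n < N) `|a n| in ca; set B := fun N => \sum_(n < N) `|b n| in cb.
have AB : A \* B @ \oo --> limn A * limn B by apply: cvgM.
have AB2 : (fun N : nat => A N./2 * B N./2) @ \oo --> limn A * limn B.
  exact: cvg_comp cvg_half AB.
have D0 : (fun N => A N * B N - A N./2 * B N./2) @ \oo --> (0 : R).
  by rewrite -(subrr (limn A * limn B)); apply: cvgB.
have E0 : (fun N => (\sum_(i < N) a i) * (\sum_(i < N) b i)
    - \sum_(n < N) \sum_(i < n.+1) a i * b (n - i)%N) @ \oo --> (0 : R).
  apply/norm_cvg0P; apply: (squeeze_cvgr _ (@cvg_cst _ _ _ _ _) D0).
  by near=> N; rewrite normr_ge0 cauchy_product_bound.
have fg := cvgM (pseval_cvg tf q01) (pseval_cvg tg q01).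
rewrite -[X in _ --> X]subr0.
have -> : pseries (fun n => ratr ((f * g) n)) q = fun N =>
  (pseries (fun n => ratr (f n)) q \* pseries (fun n => ratr (g n)) q) N -
  ((\sum_(i < N) a i) * (\sum_(i < N) b i)
    - \sum_(n < N) \sum_(i < n.+1) a i * b (n - i)%N).
  apply/funext => N /=; rewrite !pseries_psum opprB addrC subrK.
  by apply: eq_bigr => n _; rewrite ratr_mulE.
exact: (cvgB (fg _) E0).
Unshelve. all: by end_near. Qed.

Lemma pseval_qXn a q : 0 <= q < 1 -> pseval (qXn a) q = q ^+ a.
Proof.
move=> q01; apply: cvg_lim => //; apply: cvg_near_cst.
exists a.+1 => // N /= aN; rewrite pseries_psum (bigD1 (Ordinal aN)) //=.
rewrite big1 ?addr0 ?/qXn ?eqxx ?rmorph1 ?mul1r // => i.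
by rewrite -val_eqE /= => /negPf ->; rewrite rmorph0 mul0r.
Qed.

Lemma pseval1 q : 0 <= q < 1 -> pseval 1 q = 1.
Proof. by move=> q01; rewrite -qXn0 pseval_qXn. Qed.

Lemma pseval0 q : 0 <= q < 1 -> pseval 0 q = 0.
Proof.
move=> q01; rewrite -(scale0r (1 : qseries)) psevalZ // ?rmorph0 ?mul0r //.
exact: tempered1.
Qed.

Lemma psevalX f m q : tempered f -> 0 <= q < 1 -> pseval (f ^+ m) q = pseval f q ^+ m.
Proof.
move=> tf q01; elim: m => [|m IH]; first by rewrite pseval1.
by rewrite !exprS psevalM ?IH //; apply: temperedX.
Qed.

Lemma pseval_sum (I : Type) (r : seq I) (F : I -> qseries) q :
  (forall i, tempered (F i)) -> 0 <= q < 1 ->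
  pseval (\sum_(i <- r) F i) q = \sum_(i <- r) pseval (F i) q.
Proof.
move=> tF q01; elim: r => [|i r IH]; first by rewrite !big_nil pseval0.
by rewrite !big_cons psevalD ?IH //; apply: tempered_sum.
Qed.

Lemma pseval_lser u q : (0 < u)%N -> 0 <= q < 1 ->
  pseval (lser u) q = q ^+ u / (1 - q ^+ u).
Proof.
move=> u0 /[dup] q01 /andP[q0 q1].
have tl := tempered_lser u; have t1 := tempered1.
have := congr1 (fun f => pseval f q) (lserE u0).
rewrite /= (psevalM (tempered_qXn u) (temperedD t1 tl) q01) (psevalD t1 tl q01).
rewrite pseval1 // pseval_qXn //.
have : q ^+ u < 1 by rewrite exprn_ilt1 // -lt0n.
move=> qu e; apply: (mulIf (_ : 1 - q ^+ u != 0)); first by rewrite subr_eq0 gt_eqF.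
rewrite mulfVK; last by rewrite subr_eq0 gt_eqF.
by rewrite mulrBr mulr1 {1}e mulrDr mulr1 mulrC addrK.
Qed.

Lemma psum_le_pseval f q N : tempered f -> (forall n, 0 <= f n) -> 0 <= q < 1 ->
  \sum_(n < N) ratr (f n) * q ^+ n <= pseval f q.
Proof.
move=> tf f0 q01; rewrite -pseries_psum.
apply: nondecreasing_cvgn_le; last by apply/cvg_ex; exists (pseval f q); apply: pseval_cvg.
apply/nondecreasing_seqP => n; rewrite !pseries_psum big_ord_recr /= lerDl.
by rewrite mulr_ge0 ?ler0q ?exprn_ge0 //; case/andP: q01.
Qed.

Lemma pseval_le f g q : tempered f -> tempered g -> 0 <= q < 1 ->
  (forall n, f n <= g n) -> pseval f q <= pseval g q.
Proof.
move=> tf tg q01 fg; have q0 : 0 <= q by case/andP: q01.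
apply: (ler_lim _ _ (_ : \forall N \near \oo, _ <= _)).
- by apply/cvg_ex; exists (pseval f q); apply: pseval_cvg.
- by apply/cvg_ex; exists (pseval g q); apply: pseval_cvg.
near=> N; rewrite !pseries_psum; apply: ler_sum => n _.
by rewrite ler_wpM2r ?exprn_ge0 // ler_rat.
Unshelve. all: by end_near. Qed.

(** A squeeze: agreement up to order N and positivity place [pseval (F N) q] between the N-th
    partial sum of f at q and [pseval f q]. *)
Lemma pseval_stable (F : nat -> qseries) f q : (forall N, tempered (F N)) -> tempered f ->
  0 <= q < 1 -> (forall N n, 0 <= F N n <= f n) -> (forall N, eqq N (F N) f) ->
  (fun N => pseval (F N) q) @ \oo --> pseval f q.
Proof.
move=> tF tf q01 Ff eF.
have f0 n : 0 <= f n by have /andP[h] := Ff 0%N n; apply: le_trans.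
apply: (@squeeze_cvgr _ _ _ _ (pseries (fun n => ratr (f n)) q) (cst (pseval f q)));
  [|exact: pseval_cvg|exact: cvg_cst].
near=> N; apply/andP; split; last by apply: pseval_le => // n; case/andP: (Ff N n).
rewrite pseries_psum; apply: (@le_trans _ _ (\sum_(n < N) ratr (F N n) * q ^+ n)).
  by apply: ler_sum => n _; rewrite eF // ltnW.
by apply: psum_le_pseval => // n; case/andP: (Ff N n).
Unshelve. all: by end_near. Qed.

End Evaluation.

(** * Real nested sums *)

Section RealNestedSums.
Variable R : realType.
Implicit Types (q e : R) (s : seq nat) (x y : nat -> R).

Lemma pnsum_cons x a s N : pnsum x (a :: s) N = \sum_(u < N) x u.+1 ^+ a * pnsum x s u.
Proof. by []. Qed.

Lemma pnsum_ge0 x s N : (forall u, 0 <= x u.+1) -> 0 <= pnsum x s N.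
Proof.
move=> x0; elim: s N => [|a s IH] N; first exact: ler01.
by rewrite pnsum_cons; apply: sumr_ge0 => u _; rewrite mulr_ge0 ?exprn_ge0.
Qed.

Lemma pnsum_le x y s N : (forall u, 0 <= x u.+1) -> (forall u, x u.+1 <= y u.+1) ->
  pnsum x s N <= pnsum y s N.
Proof.
move=> x0 xy; elim: s N => [|a s IH] N; first by [].
rewrite !pnsum_cons; apply: ler_sum => u _; apply: ler_pM => //.
- exact: exprn_ge0.
- exact: pnsum_ge0.
- by rewrite lerXn2r // nnegrE ?(le_trans (x0 u)).
Qed.

Lemma pnsum_mono x s N M : (forall u, 0 <= x u.+1) -> (N <= M)%N ->
  pnsum x s N <= pnsum x s M.
Proof.
move=> x0 NM; case: s => [|a s]; first by [].
rewrite !pnsum_cons (big_ord_widen _ (fun u => x u.+1 ^+ a * pnsum x s u) NM).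
rewrite big_mkcond; apply: ler_sum => u _; case: ifP => // _.
by rewrite mulr_ge0 ?exprn_ge0 ?pnsum_ge0.
Qed.

Lemma pnsum_le_expr x s N : (forall u, 0 <= x u.+1 <= 1) -> is_index s ->
  pnsum x s N <= (\sum_(u < N) x u.+1) ^+ size s.
Proof.
move=> x01; have x0 u : 0 <= x u.+1 by case/andP: (x01 u).
elim: s N => [|a s IH] N; first by [].
move=> /andP[a0 s1]; rewrite pnsum_cons exprS mulr_suml; apply: ler_sum => u _.
apply: ler_pM; rewrite ?exprn_ge0 ?pnsum_ge0 //.
  by case: a a0 => // a _; rewrite exprS ler_piMr // exprn_ile1 //; case/andP: (x01 u).
apply: le_trans (IH _ s1) _; rewrite lerXn2r ?nnegrE ?sumr_ge0 //.
rewrite (big_ord_widen _ (fun u => x u.+1) (ltnW (ltn_ord u))) big_mkcond.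
by apply: ler_sum => v _; case: ifP.
Qed.

Lemma pnsum_scale c x s N :
  pnsum (fun u => c * x u) s N = c ^+ sumn s * pnsum x s N.
Proof.
elim: s N => [|a s IH] N /=; first by rewrite mul1r.
rewrite !pnsum_cons mulr_sumr; apply: eq_bigr => u _.
by rewrite IH exprMn exprD mulrACA.
Qed.

Lemma subrXX_le (x0 y0 d : R) a : 0 <= x0 <= y0 -> 0 <= d -> y0 - x0 <= d * y0 ->
  y0 ^+ a - x0 ^+ a <= a%:R * d * y0 ^+ a.
Proof.
move=> /andP[x00 xy] d0 dxy; have y00 := le_trans x00 xy.
elim: a => [|a IH]; first by rewrite subrr !mul0r.
have h1 : y0 * (y0 ^+ a - x0 ^+ a) <= y0 * (a%:R * d * y0 ^+ a) by rewrite ler_wpM2l.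
have h2 : (y0 - x0) * x0 ^+ a <= d * y0 * y0 ^+ a.
  by rewrite ler_pM ?subr_ge0 ?exprn_ge0 // lerXn2r.
by rewrite !exprS -natr1; lra.
Qed.

(** Relative errors e w(u_i) of the factors add up with multiplicity s_i, and all are at most e
    w(u_1) since u_1 is the largest variable and w is nondecreasing. The weight w(u_1) stays inside
    the outer sum, where an admissible first entry can absorb it. *)
Lemma pnsum_sub_cons x y (w : nat -> R) (e : R) a s N :
    (forall u, 0 <= x u.+1 <= y u.+1) -> 0 <= e -> (forall u, 0 <= w u <= w u.+1) ->
    (forall u, y u.+1 - x u.+1 <= e * w u.+1 * y u.+1) ->
    (forall M, pnsum y s M - pnsum x s M <= (sumn s)%:R * e * w M * pnsum y s M) ->
  pnsum y (a :: s) N - pnsum x (a :: s) N <=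
  (sumn (a :: s))%:R * e * \sum_(u < N) w u.+1 * y u.+1 ^+ a * pnsum y s u.
Proof.
move=> xy e0 w0 yx ss; rewrite !pnsum_cons -sumrB mulr_sumr; apply: ler_sum => u _.
have /andP[x0u xyu] := xy u; have /andP[wu wwu] := w0 u.
have y0u := le_trans x0u xyu.
have w1 := le_trans wu wwu.
have Sy0 : 0 <= pnsum y s u.
  by apply: pnsum_ge0 => v; have /andP[h1 h2] := xy v; apply: le_trans h2.
have h1 := @subrXX_le _ _ (e * w u.+1) a (xy u) (mulr_ge0 e0 w1) (yx u).
have h2 := ler_wpM2r Sy0 h1.
have xa : 0 <= x u.+1 ^+ a by rewrite exprn_ge0.
have xya : x u.+1 ^+ a <= y u.+1 ^+ a by rewrite lerXn2r // nnegrE.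
have h3 : x u.+1 ^+ a * (pnsum y s u - pnsum x s u) <=
    y u.+1 ^+ a * ((sumn s)%:R * e * w u.+1 * pnsum y s u).
  apply: le_trans (ler_wpM2l xa (ss u)) _; apply: ler_pM => //.
    by rewrite !mulr_ge0.
  by rewrite ler_wpM2r // ler_wpM2l // mulr_ge0.
rewrite /= natrD; move: h2 h3; set Y := y _ ^+ a; set X := x _ ^+ a.
set SY := pnsum y s u; set SX := pnsum x s u => h2 h3.
have -> : Y * SY - X * SX = (Y - X) * SY + X * (SY - SX) by ring.
apply: le_trans (lerD h2 h3) _.
rewrite le_eqVlt; apply/orP; left; apply/eqP; ring.
Qed.

(** Version for the tail, with w pulled out at its largest value. For the whole index this would
    leave an unbounded factor w N, hence the separate treatment of the head in [pnsum_sub_cons]. *)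
Lemma pnsum_sub_le x y (w : nat -> R) (e : R) s N :
    (forall u, 0 <= x u.+1 <= y u.+1) -> 0 <= e -> (forall u, 0 <= w u <= w u.+1) ->
    (forall u, y u.+1 - x u.+1 <= e * w u.+1 * y u.+1) ->
  pnsum y s N - pnsum x s N <= (sumn s)%:R * e * w N * pnsum y s N.
Proof.
move=> xy e0 w0 yx; elim: s N => [|a s IH] N; first by rewrite subrr !mul0r.
apply: le_trans (pnsum_sub_cons a N xy e0 w0 yx IH) _.
rewrite -!mulrA ler_wpM2l // ler_wpM2l // pnsum_cons mulr_sumr.
apply: ler_sum => u _; rewrite -mulrA; apply: ler_wpM2r.
  rewrite mulr_ge0 ?exprn_ge0 //; last apply: pnsum_ge0 => v.
    by have /andP[h1 h2] := xy u; apply: le_trans h2.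
  by have /andP[h1 h2] := xy v; apply: le_trans h2.
have wm : {homo w : m n / (m <= n)%N >-> m <= n}.
  by apply/nondecreasing_seqP => n; case/andP: (w0 n).
exact: wm.
Qed.

(** * Powers of harmonic numbers and convergence of weighted multiple zeta sums *)

Definition harm (N : nat) : R := \sum_(u < N) u.+1%:R^-1.

Lemma harm_ge0 N : 0 <= harm N.
Proof. by apply: sumr_ge0 => u _; rewrite invr_ge0. Qed.

Lemma harmS N : harm N.+1 = harm N + N.+1%:R^-1.
Proof. by rewrite /harm big_ord_recr. Qed.

Lemma harm_ge1 N : 1 <= harm N.+1.
Proof.
by rewrite /harm big_ord_recl /= invr1 lerDl sumr_ge0 // => u _; rewrite invr_ge0.
Qed.

(** The exponential form of H_n <= 1 + log n. The step needs exp(1/(N+2)) <= (N+2)/(N+1), the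
    inverse of exp(-1/(N+2)) >= 1 - 1/(N+2). *)
Lemma expR_harm N : expR (harm N.+1) <= expR 1 * N.+1%:R.
Proof.
elim: N => [|N IH].
  by rewrite /harm big_ord_recl big_ord0 /= invr1 addr0 mulr1.
rewrite harmS expRD.
have -> : expR 1 * N.+2%:R = expR 1 * N.+1%:R * (N.+2%:R / N.+1%:R) :> R.
  by field; rewrite addrC natr1 pnatr_eq0.
apply: ler_pM; rewrite ?expR_ge0 //.
rewrite -[leRHS]invrK -[expR _]invrK lef_pV2 ?posrE ?invr_gt0 ?expR_gt0 ?divr_gt0 ?ltr0n //.
rewrite -expRN invf_div; apply: le_trans (expR_ge1Dx _).
have -> : N.+1%:R / N.+2%:R = 1 + - N.+2%:R^-1 :> R; last by [].
by rewrite -(natr1 N.+1); field; rewrite nat1r natr1 pnatr_eq0.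
Qed.

(** The inequality x^m/m! <= exp x at a harmonic number, combined with [expR_harm]. *)
Lemma harm_exp m : exists2 C : R, 1 <= C & forall N, harm N.+1 ^+ m <= C * N.+1%:R.
Proof.
case: m => [|m]; first by exists 1 => // N; rewrite expr0 mul1r ler1n.
exists ((m.+1)`!%:R * expR 1).
  rewrite -[leLHS]mulr1 ler_pM // ?ler1n ?fact_gt0 //.
  by apply: le_trans (expR_ge1Dx _); rewrite lerDl.
move=> N; rewrite -mulrA; apply: le_trans (ler_wpM2l _ (expR_harm N)) => //.
have := @expR_ge1Dxn R (harm N.+1) m (harm_ge0 _).
have f0 : 0 < (m.+1)`!%:R :> R by rewrite ltr0n fact_gt0.
move=> h; rewrite -ler_pdivrMl //; rewrite mulrC.
by apply: le_trans h; rewrite lerDr.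
Qed.

(** The fourth root dominates every power of the harmonic numbers up to a constant, and is small
    enough that sqrt(u) u^(-2) u^(1/4) = u^(-5/4) remains summable. *)
Definition root4 (n : nat) : R := Num.sqrt (Num.sqrt n%:R).

Lemma root4_exp2 n : root4 n ^+ 2 = Num.sqrt n%:R.
Proof. by rewrite sqr_sqrtr // sqrtr_ge0. Qed.

Lemma root4_exp4 n : root4 n ^+ 4 = n%:R.
Proof. by rewrite (exprM _ 2 2) root4_exp2 sqr_sqrtr. Qed.

Lemma root4_ge0 n : 0 <= root4 n.
Proof. exact: sqrtr_ge0. Qed.

Lemma root4_ge1 n : 1 <= root4 n.+1.
Proof.
rewrite -[leLHS]sqrtr1 ler_sqrt ?sqrtr_ge0 // -[leLHS]sqrtr1 ler_sqrt //.
by rewrite ler1n.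
Qed.

Lemma root4_gt0 n : 0 < root4 n.+1.
Proof. exact: lt_le_trans ltr01 (root4_ge1 n). Qed.

(** [harm_exp] with exponent 4m, compared after raising to the fourth power; C >= 1 is what gives C
    <= C^4. *)
Lemma harm_root4 m : exists2 C : R, 1 <= C & forall N, harm N ^+ m <= C * root4 N.+1.
Proof.
have [C C1 hC] := harm_exp (m * 4); exists C => // N.
have C0 : 0 <= C by apply: le_trans C1.
apply: (@le_trans _ _ (harm N.+1 ^+ m)).
  by rewrite lerXn2r ?nnegrE ?harm_ge0 // harmS lerDl invr_ge0.
rewrite -(@ler_pXn2r _ 4) ?nnegrE ?exprn_ge0 ?harm_ge0 ?mulr_ge0 ?root4_ge0 //.
rewrite -exprM (le_trans (hC N)) // exprMn root4_exp4 ler_wpM2r //.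
by rewrite exprS ler_peMr // exprn_ege1.
Qed.

(** Comparison with the primitive -4 x^(-1/4) of x^(-5/4). For a^4 = b^4 + 1 the increment amounts
    to b <= 4 (a - b) a^4, which follows by factoring a^4 - b^4 = 1. *)
Lemma sum_root4_le N : \sum_(u < N.+1) (root4 u.+1 ^+ 5)^-1 <= 5 - 4 / root4 N.+1.
Proof.
elim: N => [|N IH].
  by rewrite big_ord_recl big_ord0 /root4 !sqrtr1 expr1n invr1; lra.
rewrite big_ord_recr /=; apply: le_trans (lerD IH (lexx _)) _.
have b1 := root4_gt0 N; have a1 := root4_gt0 N.+1.
have := root4_exp4 N.+2; have := root4_exp4 N.+1; rewrite -[in RHS]natr1 => eb ea.
have : root4 N.+2 ^+ 4 = root4 N.+1 ^+ 4 + 1 by rewrite ea eb -!natr1.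
move: b1 a1; set b := root4 N.+1; set a := root4 N.+2 => b0 a0 ab.
have a0' := ltW a0; have b0' := ltW b0.
have ba : b <= a by rewrite -(@ler_pXn2r _ 4) ?nnegrE // ab lerDl.
have h1 : (a - b) * (a ^+ 3 + a ^+ 2 * b + a * b ^+ 2 + b ^+ 3) = 1.
  by transitivity (a ^+ 4 - b ^+ 4); [ring|rewrite ab addrAC subrr add0r].
have ab0 : 0 <= a - b by rewrite subr_ge0.
have h2 : a ^+ 3 + a ^+ 2 * b + a * b ^+ 2 + b ^+ 3 <= 4 * a ^+ 3.
  have e2 : a ^+ 2 * b <= a ^+ 3 by rewrite [a ^+ 3]exprSr ler_wpM2l // exprn_ge0.
  have e3 : a * b ^+ 2 <= a ^+ 3.
    by rewrite [a ^+ 3]exprS ler_wpM2l // lerXn2r // nnegrE.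
  have e4 : b ^+ 3 <= a ^+ 3 by rewrite lerXn2r // nnegrE.
  by lra.
have h3 : 1 <= (a - b) * (4 * a ^+ 3) by have := ler_wpM2l ab0 h2; rewrite h1.
have h4 : b <= 4 * (a - b) * a ^+ 4.
  apply: le_trans ba _; have := ler_wpM2r (ltW a0) h3; rewrite mul1r.
  by have -> : 4 * (a - b) * a ^+ 4 = (a - b) * (4 * a ^+ 3) * a by ring.
have -> : 5 - 4 / b + (a ^+ 5)^-1 = 5 - 4 / a + (b - 4 * (a - b) * a ^+ 4) / (b * a ^+ 5).
  by field; rewrite !gt_eqF.
by rewrite gerDl pmulr_lle0 ?subr_le0 // invr_gt0 mulr_gt0 // exprn_gt0.
Qed.

Lemma sum_root4_le5 N : \sum_(u < N) (root4 u.+1 ^+ 5)^-1 <= 5.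
Proof.
case: N => [|N]; first by rewrite big_ord0.
by apply: le_trans (sum_root4_le N) _; rewrite gerBl divr_ge0 ?root4_ge0.
Qed.

Definition recip (n : nat) : R := n%:R^-1.

Lemma recip_bounds u : 0 <= recip u.+1 <= 1.
Proof. by rewrite invr_ge0 ler0n invf_le1 ?ltr0n // ler1n. Qed.

(** Admissibility bounds the first factor by u^(-2), and the tail is at most a power of a harmonic
    number, hence O(u^(1/4)). The weight sqrt(u) is the one arising from [recip_sub_kap]. *)
Lemma pnsum_recip_adm_weighted a s : (1 < a)%N -> is_index s ->
  exists2 C : R, 0 <= C & forall N,
   \sum_(u < N) Num.sqrt u.+1%:R * recip u.+1 ^+ a * pnsum recip s u <= C.
Proof.
move=> a1 s1; have [C C1 hC] := harm_root4 (size s).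
have C0 : 0 <= C by apply: le_trans C1.
exists (C * 5) => [|N]; first by rewrite mulr_ge0.
apply: le_trans (ler_wpM2l C0 (sum_root4_le5 N)); rewrite mulr_sumr.
apply: ler_sum => u _; have r0 := root4_gt0 u.
have /andP[rc0 rc1] := recip_bounds u.
have h1 : pnsum recip s u <= C * root4 u.+1.
  exact: le_trans (pnsum_le_expr u recip_bounds s1) (hC u).
have h2 : recip u.+1 ^+ a <= recip u.+1 ^+ 2.
  by rewrite -(subnK a1) exprD ler_piMl ?exprn_ge0 // exprn_ile1.
apply: (@le_trans _ _ (Num.sqrt u.+1%:R * recip u.+1 ^+ 2 * (C * root4 u.+1))).
  apply: ler_pM; rewrite ?mulr_ge0 ?sqrtr_ge0 ?exprn_ge0 //.
    by apply: pnsum_ge0 => v; case/andP: (recip_bounds v).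
  by rewrite ler_wpM2l ?sqrtr_ge0.
rewrite -root4_exp2 /recip -root4_exp4 le_eqVlt; apply/orP; left; apply/eqP.
by field; rewrite gt_eqF.
Qed.

Lemma pnsum_recip_adm a s : (1 < a)%N -> is_index s ->
  exists C : R, forall N, pnsum recip (a :: s) N <= C.
Proof.
move=> a1 s1; have [C C0 hC] := pnsum_recip_adm_weighted a1 s1.
exists C => N; apply: le_trans (hC N); rewrite pnsum_cons; apply: ler_sum => u _.
rewrite -mulrA ler_peMl ?mulr_ge0 ?exprn_ge0 //.
- by case/andP: (recip_bounds u).
- by apply: pnsum_ge0 => v; case/andP: (recip_bounds v).
by rewrite -[leLHS]sqrtr1 ler_sqrt // ler1n.
Qed.

End RealNestedSums.

(** * Asymptotics as q tends to 1 *)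

Section Asymptotics.
Variable R : realType.
Implicit Types (q : R) (s : seq nat) (f g : qseries).

(** The normalised factor (1 - q) K(n), which increases to 1/n as q tends to 1; distributing (1 -
    q)^(sumn s) over the factors of [kbr s] turns each K into it. *)
Definition kap q n : R := (1 - q) * (q ^+ n / (1 - q ^+ n)).

Lemma lser_coef_ge0 u n : 0 <= lser u n :> rat.
Proof. exact: ler0n. Qed.

Lemma qserM_ge0 f g : (forall n, 0 <= f n) -> (forall n, 0 <= g n) ->
  forall n, 0 <= (f * g) n.
Proof. by move=> f0 g0 n; rewrite qserM; apply: sumr_ge0 => i _; rewrite mulr_ge0. Qed.

Lemma pnsum_lser_ge0 s N n : 0 <= pnsum lser s N n.
Proof.
elim: s N n => [|a s IH] N n; first by rewrite /pnsum /= qser1 ler0n.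
rewrite /pnsum /= qser_sum; apply: sumr_ge0 => u _; apply: qserM_ge0 => m; last exact: IH.
elim: a m => [|a IHa] m; first by rewrite expr0 qser1 ler0n.
by rewrite exprS; apply: qserM_ge0 => // i; apply: lser_coef_ge0.
Qed.

Lemma pnsum_lser_mono s N M n : (N <= M)%N -> pnsum lser s N n <= pnsum lser s M n.
Proof.
case: s => [|a s] //; elim: M => [|M IH]; first by rewrite leqn0 => /eqP->.
rewrite leq_eqVlt => /orP[/eqP->//|]; rewrite ltnS => /IH/le_trans; apply.
rewrite pnsum_consS qserD lerDl; apply: qserM_ge0 => m; last exact: pnsum_lser_ge0.
elim: a {IH} m => [|a IHa] m; first by rewrite expr0 qser1 ler0n.
by rewrite exprS; apply: qserM_ge0 => // i; apply: lser_coef_ge0.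
Qed.

Lemma pnsum_lser_le_kbr s N n : is_index s -> 0 <= pnsum lser s N n <= kbr s n.
Proof.
move=> s1; rewrite pnsum_lser_ge0 /=.
have nM : (n <= maxn n N)%N by rewrite leq_maxl.
by rewrite (kbr_pnsum s1 nM) pnsum_lser_mono // leq_maxr.
Qed.

Lemma tempered_pnsum_lser s N : tempered R (pnsum lser s N).
Proof.
elim: s N => [|a s IH] N; first exact: tempered1.
rewrite /pnsum /=; apply: tempered_sum => u; apply: temperedM; last exact: IH.
exact/temperedX/tempered_lser.
Qed.

Lemma pseval_pnsum_lser s N q : 0 <= q < 1 ->
  pseval (pnsum lser s N) q = pnsum (fun u => q ^+ u / (1 - q ^+ u)) s N.
Proof.
move=> q01; elim: s N => [|a s IH] N; first exact: pseval1.
rewrite /pnsum /= pseval_sum // => [|u].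
  apply: eq_bigr => u _; rewrite psevalM ?psevalX ?pseval_lser //.
  - by congr (_ * _); exact: IH.
  - exact: tempered_lser.
  - exact/temperedX/tempered_lser.
  - exact: tempered_pnsum_lser.
apply: temperedM; first exact/temperedX/tempered_lser.
exact: tempered_pnsum_lser.
Qed.

Lemma tempered_kbr s : is_index s -> tempered R (kbr s).
Proof. by move=> s1; apply: tempered_span (kbr_FilMD s1). Qed.

Lemma pnsum_kap_cvg s q : is_index s -> 0 <= q < 1 ->
  pnsum (kap q) s @ \oo --> (1 - q) ^+ sumn s * pseval (kbr s) q.
Proof.
move=> s1 q01.
have -> : pnsum (kap q) s = fun N => (1 - q) ^+ sumn s * pseval (pnsum lser s N) q.
  by apply/funext => N; rewrite pseval_pnsum_lser // -pnsum_scale.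
apply: cvgM; first exact: cvg_cst.
apply: pseval_stable => //.
- by move=> N; apply: tempered_pnsum_lser.
- exact: tempered_kbr.
- by move=> N n; apply: pnsum_lser_le_kbr.
- by move=> N n nN; rewrite (kbr_pnsum s1 nN).
Qed.

(** In 1 - q^n = (1 - q)(1 + ... + q^(n-1)) each power is at least q^n; bounding them by 1 gives the
    companion [exprB_le]. *)
Lemma natmul_exprB q n : 0 <= q <= 1 -> n%:R * (1 - q) * q ^+ n <= 1 - q ^+ n.
Proof.
move=> /andP[q0 q1]; elim: n => [|n IH]; first by rewrite !mul0r subrr.
have h1 := ler_wpM2l q0 IH; have e0 : 0 <= 1 - q by rewrite subr_ge0.
have h2 : q ^+ n.+1 <= 1 by rewrite exprn_ile1.
have h3 : (1 - q) * q ^+ n.+1 <= (1 - q) * 1 by rewrite ler_wpM2l.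
have := ler_wpM2l q0 (_ : q ^+ n.+1 <= 1); move: h1 h3; rewrite exprS -natr1.
move=> h1 h3 _; nra.
Qed.

Lemma exprB_le q n : 0 <= q <= 1 -> 1 - q ^+ n <= n%:R * (1 - q).
Proof.
move=> /andP[q0 q1]; elim: n => [|n IH]; first by rewrite subrr mul0r.
have h2 : q ^+ n <= 1 by rewrite exprn_ile1.
have e0 : 0 <= 1 - q by rewrite subr_ge0.
have h3 : (1 - q) * q ^+ n <= (1 - q) * 1 by rewrite ler_wpM2l.
rewrite exprS -natr1; nra.
Qed.

Lemma exprn_lt1 q n : 0 < q < 1 -> 0 < 1 - q ^+ n.+1.
Proof. by move=> /andP[q0 q1]; rewrite subr_gt0 exprn_ilt1 // ltW. Qed.

Lemma kap_ge0 q n : 0 < q < 1 -> 0 <= kap q n.+1.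
Proof.
move=> q01; have := exprn_lt1 n q01; case/andP: (q01) => q0 q1 h.
by rewrite !mulr_ge0 ?invr_ge0 ?exprn_ge0 ?subr_ge0 // ltW // -subr_gt0.
Qed.

Lemma kap_le q n : 0 < q < 1 -> kap q n.+1 <= recip R n.+1.
Proof.
move=> q01; have h := exprn_lt1 n q01; case/andP: (q01) => q0 q1.
have q01' : 0 <= q <= 1 by rewrite !ltW.
rewrite /kap /recip mulrA ler_pdivrMr // [leRHS]mulrC ler_pdivlMr ?ltr0n //.
by have := natmul_exprB n.+1 q01'; rewrite [leLHS]mulrC [_%:R * _]mulrC mulrA [q ^+ _ * _]mulrC.
Qed.

Lemma kap_ge q n : 0 < q < 1 -> recip R n.+1 - (1 - q) <= kap q n.+1.
Proof.
move=> q01; have h := exprn_lt1 n q01; case/andP: (q01) => q0 q1.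
have q01' : 0 <= q <= 1 by rewrite !ltW.
have h2 := exprB_le n.+1 q01'; have n0 : 0 < n.+1%:R :> R by rewrite ltr0n.
have e0 : 0 < 1 - q by rewrite subr_gt0.
apply: (@le_trans _ _ (q ^+ n.+1 / n.+1%:R)).
  rewrite /recip ler_pdivlMr // mulrBl mulVf ?gt_eqF //.
  by rewrite lerBlDr -lerBlDl [_ * n.+1%:R]mulrC.
rewrite /kap mulrCA ler_wpM2l ?exprn_ge0 ?(ltW q0) //.
rewrite ler_pdivlMr // [leLHS]mulrC ler_pdivrMr //.
by rewrite mulrC.
Qed.

(** The square of the left side is bounded by (1 - q)/n, one factor being estimated by [kap_ge] and
    the other by 1/n. *)
Lemma recip_sub_kap q n : 0 < q < 1 ->
  recip R n.+1 - kap q n.+1 <= Num.sqrt (1 - q) * Num.sqrt n.+1%:R * recip R n.+1.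
Proof.
move=> q01; have k0 := kap_ge0 n q01; have k1 := kap_le n q01; have k2 := kap_ge n q01.
case/andP: (q01) => q0 q1.
have e0 : 0 <= 1 - q by rewrite subr_ge0 ltW.
have r0 : 0 <= recip R n.+1 by rewrite invr_ge0.
rewrite -(@ler_pXn2r _ 2) ?nnegrE ?subr_ge0 ?mulr_ge0 ?sqrtr_ge0 //.
rewrite !exprMn !sqr_sqrtr // ?ler0n //.
have -> : (1 - q) * n.+1%:R * recip R n.+1 ^+ 2 = (1 - q) * recip R n.+1.
  by rewrite /recip expr2; field; rewrite addrC natr1 pnatr_eq0.
rewrite expr2; apply: ler_pM; rewrite ?subr_ge0 //; first by rewrite lerBlDr -lerBlDl.
by rewrite lerBlDr lerDl.
Qed.

Lemma kap_le1 q u : 0 < q < 1 -> 0 <= kap q u.+1 <= 1.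
Proof.
move=> q01; rewrite kap_ge0 //=; apply: le_trans (kap_le u q01) _.
by case/andP: (recip_bounds R u).
Qed.

(** * Growth of T(q) *)

Definition Tval q : R := (1 - q) * pseval (bracket [:: 1%N]) q.

Lemma pnsum_kap1 q N : pnsum (kap q) [:: 1%N] N = \sum_(u < N) kap q u.+1.
Proof. by apply: eq_bigr => u _; rewrite expr1 mulr1. Qed.

Lemma Tval_cvg q : 0 <= q < 1 -> (fun N => \sum_(u < N) kap q u.+1) @ \oo --> Tval q.
Proof.
move=> q01; have := pnsum_kap_cvg (isT : is_index [:: 1%N]) q01.
rewrite kbr1 /= expr1.
by have -> : pnsum (kap q) [:: 1%N] = fun N => \sum_(u < N) kap q u.+1
  by apply/funext => N; rewrite pnsum_kap1.
Qed.

Lemma Tval_ge_sum q N : 0 < q < 1 -> \sum_(u < N) kap q u.+1 <= Tval q.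
Proof.
move=> q01; have q01' : 0 <= q < 1 by case/andP: q01 => /ltW -> ->.
have c := Tval_cvg q01'; rewrite -(cvg_lim _ c) //.
apply: (nondecreasing_cvgn_le (u_ := fun N => \sum_(u < N) kap q u.+1)).
  by apply/nondecreasing_seqP => n; rewrite big_ord_recr lerDl kap_ge0.
by apply/cvg_ex; exists (Tval q).
Qed.

Lemma Tval_le q C : 0 <= q < 1 -> (forall N, \sum_(u < N) kap q u.+1 <= C) -> Tval q <= C.
Proof.
move=> q01 h; have c := Tval_cvg q01; rewrite -(cvg_lim _ c) //.
apply: limr_le; first by apply/cvg_ex; exists (Tval q).
by near=> N; apply: h.
Unshelve. all: by end_near. Qed.

Lemma Tval_ge0 q : 0 < q < 1 -> 0 <= Tval q.
Proof. by move=> q01; have := Tval_ge_sum 0 q01; rewrite big_ord0. Qed.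

Lemma Tval_ge_harm q N : 0 < q < 1 -> harm R N - N%:R * (1 - q) <= Tval q.
Proof.
move=> q01; apply: le_trans (Tval_ge_sum N q01).
apply: (@le_trans _ _ (\sum_(u < N) (recip R u.+1 - (1 - q)))).
  by rewrite sumrB sumr_const card_ord mulr_natl lexx.
by apply: ler_sum => u _; apply: kap_ge.
Qed.

(** The terms u <= N are at most 1/u. For u > N one has q^u <= q^N <= 1/2, as N (1 - q) q^N <= 1 -
    q^N, so the remaining terms are at most 2 (1 - q) q^u, with sum at most 2. *)
Lemma Tval_le_harm q N : 0 < q < 1 -> 1 <= N%:R * (1 - q) -> Tval q <= harm R N + 2.
Proof.
move=> q01 Ne; have q01' : 0 <= q < 1 by case/andP: q01 => /ltW -> ->.
have q01'' : 0 <= q <= 1 by case/andP: q01 => /ltW -> /ltW ->.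
case/andP: (q01) => q0 q1; have e0 : 0 < 1 - q by rewrite subr_gt0.
have qN : q ^+ N <= 1 / 2.
  have := natmul_exprB N q01''; have h := exprn_ge0 N (ltW q0).
  by have := ler_wpM2r h Ne; rewrite mul1r; lra.
apply: Tval_le => // M.
apply: (@le_trans _ _ (\sum_(u < M) ((if (u < N)%N then recip R u.+1 else 0)
    + 2 * ((1 - q) * q ^+ u.+1)))).
  apply: ler_sum => u _; case: ltnP => uN.
    apply: le_trans (kap_le u q01) _; rewrite lerDl !mulr_ge0 ?exprn_ge0 ?ltW //.
  rewrite add0r /kap [leRHS]mulrCA ler_wpM2l ?(ltW e0) // [leRHS]mulrC.
  rewrite ler_wpM2l ?exprn_ge0 ?(ltW q0) //.
  have h : q ^+ u.+1 <= 1 / 2.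
    by apply: le_trans qN; apply: ler_wiXn2l; rewrite ?ltW // ltnW.
  by rewrite invf_ple ?posrE //; lra.
rewrite big_split /=; apply: lerD.
  have MK := leq_maxl M N; have NK := leq_maxr M N.
  rewrite /harm (big_ord_widen _ (fun u => u.+1%:R^-1) NK).
  rewrite (big_ord_widen _ (fun u => if (u < N)%N then recip R u.+1 else 0) MK).
  rewrite big_mkcond [leRHS]big_mkcond; apply: ler_sum => u _.
  by case: ifP => // _; case: ifP => // _; rewrite invr_ge0.
rewrite -mulr_sumr -[leRHS]mulr1 ler_wpM2l //.
have -> : \sum_(u < M) (1 - q) * q ^+ u.+1 = q * (1 - q ^+ M).
  elim: M => [|M IH]; first by rewrite big_ord0 expr0 subrr mulr0.
  by rewrite big_ord_recr /= IH !exprS; ring.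
have qM : 0 <= q ^+ M <= 1 by rewrite exprn_ge0 ?exprn_ile1 // ltW.
by rewrite -[leRHS]mulr1 ler_pM //; lra.
Qed.

(* T is at most harm N + 2 with N about 1/(1 - q). *)
Lemma Tval_exp m : exists2 C : R, 0 <= C &
  forall q, 0 < q < 1 -> (1 - q) * Tval q ^+ m <= C.
Proof.
have [C C1 hC] := harm_exp R m; have C0 : 0 <= C by apply: le_trans C1.
exists (3 ^+ m * C * 2) => [|q q01]; first by rewrite !mulr_ge0 ?exprn_ge0.
case/andP: (q01) => q0 q1; have e0 : 0 < 1 - q by rewrite subr_gt0.
set N := Num.truncn (1 - q)^-1.
have Nlt : (1 - q)^-1 < N.+1%:R by apply: truncnS_gt.
have Nle : N%:R <= (1 - q)^-1 by rewrite truncn_le invr_ge0 ltW.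
have Ne : 1 <= N.+1%:R * (1 - q) by rewrite -ler_pdivrMr // div1r ltW.
have Ne2 : N.+1%:R * (1 - q) <= 2.
  rewrite -natr1 mulrDl mul1r; have := ler_wpM2r (ltW e0) Nle.
  by rewrite mulVf ?gt_eqF //; lra.
have T0 := Tval_ge0 q01.
have T3 : Tval q <= 3 * harm R N.+1.
  by apply: le_trans (Tval_le_harm q01 Ne) _; have := harm_ge1 R N; lra.
have Tm : Tval q ^+ m <= 3 ^+ m * (C * N.+1%:R).
  apply: le_trans (_ : (3 * harm R N.+1) ^+ m <= _).
    by rewrite lerXn2r // nnegrE mulr_ge0 // harm_ge0.
  by rewrite exprMn ler_wpM2l ?exprn_ge0.
apply: le_trans (ler_wpM2l (ltW e0) Tm) _.
have h : 0 <= 3 ^+ m * C by rewrite mulr_ge0 ?exprn_ge0.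
have := ler_wpM2l h Ne2.
by have -> : (1 - q) * (3 ^+ m * (C * N.+1%:R)) = 3 ^+ m * C * (N.+1%:R * (1 - q)) by ring.
Qed.

Lemma near_left1 (P : R -> Prop) :
  (forall q, 0 < q < 1 -> P q) -> \forall q \near (1 : R)^'-, P q.
Proof.
move=> h; near=> q; apply: h; apply/andP; split; near: q.
  exact: nbhs_left_gt.
exact: nbhs_left_lt.
Unshelve. all: by end_near. Qed.

Lemma harm_cvgy : harm R @ \oo --> +oo.
Proof.
have -> : harm R = series (@harmonic R).
  by apply/funext => N; rewrite /harm /series /= big_mkord.
apply: nondecreasing_dvgn_lt; last exact: dvg_harmonic.
by apply: nondecreasing_series => n _ _; rewrite invr_ge0.
Qed.

Lemma Tval_cvgy : Tval @ (1 : R)^'- --> +oo.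
Proof.
apply/cvgryPge => A; have /cvgryPge/(_ (A + 1))[N _ hN] := harm_cvgy.
have NA : A + 1 <= harm R N by apply: hN => /=.
near=> q; have q01 : 0 < q < 1 by near: q; apply: near_left1.
apply: le_trans (Tval_ge_harm N q01).
have e1 : 1 - q < N.+1%:R^-1.
  by near: q; apply: nbhs_left_ltBl; rewrite invr_gt0 ltr0n.
have : N%:R * (1 - q) <= 1.
  apply: (@le_trans _ _ (N.+1%:R * (1 - q))).
    by rewrite ler_wpM2r ?ler_nat // subr_ge0; case/andP: q01 => _ /ltW.
  by rewrite mulrC -ler_pdivlMr ?ltr0n // div1r ltW.
by move: NA; lra.
Unshelve. all: by end_near. Qed.

Lemma near_Tval_ge1 : \forall q \near (1 : R)^'-, 1 <= Tval q.
Proof. by have /cvgryPge := Tval_cvgy; apply. Qed.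

(** The class of error terms in which (1 - q)^k f(q) is compared with a polynomial in T; it absorbs
    factors of growth T^L. *)
Definition negligibleT (a : R -> R) := forall m,
  (fun q => a q * Tval q ^+ m) @ (1 : R)^'- --> (0 : R).

Lemma negligibleT_near (a b : R -> R) : (\forall q \near (1 : R)^'-, a q = b q) ->
  negligibleT a -> negligibleT b.
Proof.
move=> ab na m; apply: cvg_trans (na m); apply: near_eq_cvg.
by near=> q; rewrite -(near ab q).
Unshelve. all: by end_near. Qed.

(** By [Tval_exp] with exponent 2(m + 1), sqrt(1 - q) T^(m+1) is bounded; the spare factor T then
    yields a bound of order 1/T, which tends to 0. *)
Lemma negligibleT_sqrt (a : R -> R) (C : R) :
  (forall q, 0 < q < 1 -> `|a q| <= C * Num.sqrt (1 - q)) -> negligibleT a.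
Proof.
move=> aC m; have [D D0 hD] := Tval_exp (m.+1 * 2).
apply/norm_cvg0P.
have T0 : (fun q => `|C| * Num.sqrt D * (Tval q)^-1) @ (1 : R)^'- --> (0 : R).
  rewrite -(mulr0 (`|C| * Num.sqrt D)); apply: cvgM; first exact: cvg_cst.
  apply/gtr0_cvgV0; last exact: Tval_cvgy.
  by near=> q; apply: lt_le_trans ltr01 _; near: q; apply: near_Tval_ge1.
apply: (squeeze_cvgr _ (@cvg_cst _ _ _ _ _) T0).
near=> q; rewrite normr_ge0 /=.
have q01 : 0 < q < 1 by near: q; apply: near_left1.
have T1 : 1 <= Tval q by near: q; apply: near_Tval_ge1.
have Tp : 0 < Tval q by apply: lt_le_trans T1.
have e0 : 0 <= 1 - q by case/andP: q01 => _ /ltW; rewrite subr_ge0.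
have h : Num.sqrt (1 - q) * Tval q ^+ m.+1 <= Num.sqrt D.
  rewrite -(@ler_pXn2r _ 2) ?nnegrE ?mulr_ge0 ?sqrtr_ge0 ?exprn_ge0 ?(ltW Tp) //.
  by rewrite exprMn !sqr_sqrtr // -exprM hD.
rewrite normrM [`|_ ^+ m|]ger0_norm ?exprn_ge0 ?(ltW Tp) //.
rewrite ler_pdivlMr // -mulrA -exprSr.
apply: (@le_trans _ _ (`|C| * Num.sqrt (1 - q) * Tval q ^+ m.+1)).
  apply: ler_wpM2r; first by rewrite exprn_ge0 // ltW.
  by apply: le_trans (aC q q01) _; rewrite ler_wpM2r ?sqrtr_ge0 // ler_norm.
by rewrite -mulrA ler_wpM2l.
Unshelve. all: by end_near. Qed.

Lemma negligibleT_lin (c : R) (a b : R -> R) : negligibleT a -> negligibleT b ->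
  negligibleT (fun q => c * a q + b q).
Proof.
move=> na nb m.
have -> : (fun q => (c * a q + b q) * Tval q ^+ m) =
    (fun q => c * (a q * Tval q ^+ m) + b q * Tval q ^+ m).
  by apply/funext => q; rewrite mulrDl mulrA.
have -> : (0 : R) = c * 0 + 0 by rewrite mulr0 addr0.
apply: cvgD; last exact: nb.
by apply: cvgM; [apply: cvg_cst|exact: na].
Qed.

Lemma negligibleT0 : negligibleT (fun=> 0).
Proof.
by move=> m; under eq_fun do rewrite mul0r; apply: cvg_cst.
Qed.

Definition growthT (b : R -> R) := exists C : R, exists L : nat,
  \forall q \near (1 : R)^'-, `|b q| <= C * Tval q ^+ L.

Lemma negligibleT_growth (a b : R -> R) : negligibleT a -> growthT b ->
  negligibleT (fun q => a q * b q).
Proof.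
move=> na [C [L hb]] m; apply/norm_cvg0P.
have h0 : (fun q => `|C| * `|a q * Tval q ^+ (L + m)|) @ (1 : R)^'- --> (0 : R).
  rewrite -(mulr0 `|C|); apply: cvgM; first exact: cvg_cst.
  by apply/norm_cvg0P.
apply: (squeeze_cvgr _ (@cvg_cst _ _ _ _ _) h0).
near=> q; rewrite normr_ge0 /=.
have T0 : 0 <= Tval q by apply: le_trans ler01 _; near: q; apply: near_Tval_ge1.
have bq : `|b q| <= C * Tval q ^+ L by near: q.
have T1 k : `|Tval q ^+ k| = Tval q ^+ k by rewrite ger0_norm // exprn_ge0.
rewrite !normrM !T1 exprD mulrCA -mulrA ler_wpM2l // mulrA ler_wpM2r ?exprn_ge0 //.
by apply: le_trans bq _; rewrite ler_wpM2r ?exprn_ge0 // ler_norm.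
Unshelve. all: by end_near. Qed.

Lemma growth_raise (t c C : R) L M : 1 <= t -> c <= C * t ^+ L ->
  c <= `|C| * t ^+ (L + M).
Proof.
move=> t1 cC; have t0 := le_trans ler01 t1; apply: le_trans cC _.
apply: (@le_trans _ _ (`|C| * t ^+ L)); first by rewrite ler_wpM2r ?exprn_ge0 // ler_norm.
by rewrite ler_wpM2l // exprD ler_peMr ?exprn_ge0 // exprn_ege1.
Qed.

Lemma growthT_lin (c : R) (a b : R -> R) : growthT a -> growthT b ->
  growthT (fun q => c * a q + b q).
Proof.
move=> [C [L ha]] [D [M hb]]; exists (`|c| * `|C| + `|D|), (L + M)%N.
near=> q.
have T1 : 1 <= Tval q by near: q; apply: near_Tval_ge1.
have aq : `|a q| <= C * Tval q ^+ L by near: q.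
have bq : `|b q| <= D * Tval q ^+ M by near: q.
apply: le_trans (ler_normD _ _) _; rewrite mulrDl normrM -mulrA; apply: lerD.
  by rewrite ler_wpM2l // growth_raise.
by rewrite addnC growth_raise.
Unshelve. all: by end_near. Qed.

Lemma pseval_kbr_bounds s q : is_index s -> 0 < q < 1 ->
  0 <= (1 - q) ^+ sumn s * pseval (kbr s) q <= Tval q ^+ size s.
Proof.
move=> s1 q01; have q01' : 0 <= q < 1 by case/andP: q01 => /ltW -> ->.
have c := pnsum_kap_cvg s1 q01'.
apply/andP; split.
  apply: (cvgr_to_ge c); near=> N; apply: pnsum_ge0 => u; by case/andP: (kap_le1 u q01).
apply: (cvgr_to_le c); near=> N.
apply: le_trans (pnsum_le_expr N (fun u => kap_le1 u q01) s1) _.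
rewrite lerXn2r ?nnegrE ?Tval_ge0 ?Tval_ge_sum // sumr_ge0 // => u _.
exact: kap_ge0.
Unshelve. all: by end_near. Qed.

Lemma growthT_le (a b : R -> R) : (\forall q \near (1 : R)^'-, `|a q| <= `|b q|) ->
  growthT b -> growthT a.
Proof.
move=> ab [C [L hb]]; exists C, L; near=> q.
have h : `|a q| <= `|b q| by near: q.
by apply: le_trans h _; near: q.
Unshelve. all: by end_near. Qed.

Lemma tempered_FilMD w f : FilMD w f -> tempered R f.
Proof. exact: tempered_span. Qed.

(** Transfers a property of functions near 1 from brackets to their span; applied both to growth
    bounds and to existence of limits with rate. *)
Lemma bracket_span_psevalP (S : pred (seq nat)) k (P : (R -> R) -> Prop) :
  (forall a b : R -> R, (\forall q \near (1 : R)^'-, a q = b q) -> P a -> P b) ->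
  P (fun=> 0) -> (forall c a b, P a -> P b -> P (fun q => c * a q + b q)) ->
  (forall s, S s -> P (fun q => (1 - q) ^+ k * pseval (bracket s) q)) ->
  forall f, bracket_span S f -> P (fun q => (1 - q) ^+ k * pseval f q).
Proof.
move=> Pe P0 Pl Pb f [c Sc ->]; elim: c Sc => [|[a s] c IH] /= Sc.
  apply: Pe P0; apply: near_left1 => q /andP[q0 q1].
  by rewrite big_nil pseval0 ?mulr0 // ltW.
have {Sc}/andP[Ss Sc] := Sc.
apply: Pe (Pl (ratr a) _ _ (Pb s Ss) (IH Sc)); apply: near_left1 => q /andP[q0 q1].
have q01 : 0 <= q < 1 by rewrite ltW.
rewrite big_cons psevalD ?psevalZ //; first by rewrite mulrDr mulrCA.
- exact: tempered_bracket.
- exact/temperedZ/tempered_bracket.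
by apply: (@tempered_span R S); exists c.
Qed.

Lemma growthT_near (a b : R -> R) : (\forall q \near (1 : R)^'-, a q = b q) ->
  growthT a -> growthT b.
Proof.
move=> ab; apply: growthT_le; near=> q.
by rewrite (near ab q).
Unshelve. all: by end_near. Qed.

Lemma growthT0 : growthT (fun=> 0).
Proof.
exists 1, 0%N; near=> q; rewrite normr0 mul1r expr0; exact: ler01.
Unshelve. all: by end_near. Qed.

Lemma exprB_le1 q n : 0 < q < 1 -> 0 <= (1 - q) ^+ n <= 1.
Proof.
move=> /andP[q0 q1]; have e0 : 0 <= 1 - q by rewrite subr_ge0 ltW.
by rewrite exprn_ge0 // exprn_ile1 // gerBl ltW.
Qed.

Lemma growthT_weight w k f : (w <= k)%N -> growthT (fun q => (1 - q) ^+ w * pseval f q) ->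
  growthT (fun q => (1 - q) ^+ k * pseval f q).
Proof.
move=> wk; apply: growthT_le; apply: near_left1 => q q01.
rewrite -(subnK wk) exprD -mulrA normrM ler_piMl //.
by have /andP[h0 h1] := exprB_le1 (k - w) q01; rewrite ger0_norm.
Qed.

Lemma growthT_kbr s : is_index s ->
  growthT (fun q => (1 - q) ^+ sumn s * pseval (kbr s) q).
Proof.
move=> s1; exists 1, (size s); apply: near_left1 => q q01.
by have /andP[h0 h1] := pseval_kbr_bounds s1 q01; rewrite mul1r ger0_norm.
Qed.

Lemma pseval_bracket_kbr s q : is_index s -> 0 <= q < 1 ->
  pseval (bracket s) q = pseval (bracket s - kbr s) q + pseval (kbr s) q.
Proof.
move=> s1 q01; rewrite -psevalD ?subrK //; last exact: tempered_kbr.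
exact: tempered_FilMD (bracket_kbr s1).
Qed.

(** For [kbr s] the normalised value is at most T to the power [size s]; the difference with
    [bracket s] has lower weight and falls under the induction. *)
Lemma FilMD_growthT w f : FilMD w f -> growthT (fun q => (1 - q) ^+ w * pseval f q).
Proof.
elim/ltn_ind: w f => w IH.
apply: (bracket_span_psevalP growthT_near growthT0 growthT_lin) => s /andP[s1 sw].
apply: (growthT_weight sw).
have [s0|s0] := eqVneq s [::].
  exists 1, 0%N; apply: near_left1 => q /andP[q0 q1].
  by rewrite s0 bracket_nil pseval1 ?mulr1 ?expr0 ?normr1 // ltW.
have sgt : (0 < sumn s)%N.
  by case: s s0 s1 {sw} => // a s _ /andP[a0 _]; rewrite /= addn_gt0 a0.
have lw : ((sumn s).-1 < w)%N by rewrite prednK.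
have h := growthT_weight (leq_pred _) (IH _ lw _ (bracket_kbr s1)).
apply: growthT_near (growthT_lin 1 h (growthT_kbr s1)).
apply: near_left1 => q /andP[q0 q1].
by rewrite (pseval_bracket_kbr s1) ?mulrDr ?mul1r // ltW.
Qed.

Lemma negligibleT_exprB n : negligibleT (fun q => (1 - q) ^+ n.+1).
Proof.
apply: (@negligibleT_sqrt _ 1) => q q01; case/andP: (q01) => q0 q1.
have e0 : 0 <= 1 - q by rewrite subr_ge0 ltW.
have e1 : 1 - q <= 1 by rewrite gerBl ltW.
rewrite mul1r ger0_norm ?exprn_ge0 // exprS.
apply: (@le_trans _ _ (1 - q)); first by rewrite ler_piMr // exprn_ile1.
rewrite -{1}[1 - q]sqr_sqrtr // expr2 ler_piMl ?sqrtr_ge0 //.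
by rewrite -[leRHS]sqrtr1 ler_sqrt.
Qed.

Lemma FilMD_negligibleT w k f : (w < k)%N -> FilMD w f ->
  negligibleT (fun q => (1 - q) ^+ k * pseval f q).
Proof.
move=> wk wf; have := negligibleT_growth (negligibleT_exprB (k - w).-1) (FilMD_growthT wf).
apply: negligibleT_near; apply: near_left1 => q _.
by rewrite mulrA -exprD prednK ?subn_gt0 // subnK // ltnW.
Qed.

(** The limit is the multiple zeta value of [a :: s]. The error estimate is made for truncated sums,
    with x = [kap q], y = [recip R], w the square root and e = sqrt(1 - q), and its constant is
    uniform in N. *)
Lemma kbr_adm_limit a s : (1 < a)%N -> is_index s -> exists z : R,
  negligibleT (fun q => (1 - q) ^+ sumn (a :: s) * pseval (kbr (a :: s)) q - z).
Proof.
move=> a1 s1; have as1 : is_index (a :: s) by rewrite /= (ltnW a1).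
have [D hD] := @pnsum_recip_adm R a s a1 s1.
have [C C0 hC] := @pnsum_recip_adm_weighted R a s a1 s1.
have r0 u : 0 <= recip R u.+1 by case/andP: (recip_bounds R u).
have cz : cvgn (pnsum (recip R) (a :: s)).
  apply: nondecreasing_is_cvgn; first by move=> m n mn; apply: pnsum_mono.
  by exists D => _ [N _ <-].
exists (limn (pnsum (recip R) (a :: s))).
apply: (@negligibleT_sqrt _ ((sumn (a :: s))%:R * C)) => q q01.
have q01' : 0 <= q < 1 by case/andP: q01 => /ltW -> ->.
have ck := pnsum_kap_cvg as1 q01'.
rewrite distrC.
have cd := cvgB cz ck.
rewrite ger0_norm; last first.
  apply: (cvgr_to_ge (cd _)); near=> N; rewrite subr_ge0; apply: pnsum_le => u.
    exact: kap_ge0.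
  exact: kap_le.
apply: (cvgr_to_le (cd _)); near=> N.
apply: le_trans (pnsum_sub_cons (w := fun n => Num.sqrt n%:R) (e := Num.sqrt (1 - q)) a N _ _ _ _ _) _.
- by move=> u; rewrite kap_ge0 // kap_le.
- exact: sqrtr_ge0.
- by move=> u; rewrite sqrtr_ge0 /= ler_sqrt ?ler0n // ler_nat leqnSn.
- by move=> u; apply: recip_sub_kap.
- move=> M; apply: (@pnsum_sub_le _ _ _ (fun n => Num.sqrt n%:R) (Num.sqrt (1 - q)) s M).
  + by move=> u; rewrite kap_ge0 // kap_le.
  + exact: sqrtr_ge0.
  + by move=> u; rewrite sqrtr_ge0 /= ler_sqrt ?ler0n // ler_nat leqnSn.
  + by move=> u; apply: recip_sub_kap.
rewrite -!mulrA ler_wpM2l // mulrC ler_wpM2r ?sqrtr_ge0 //.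
Unshelve. all: by end_near. Qed.

Lemma negligibleT_lin_lim (c z w : R) (a b : R -> R) :
  negligibleT (fun q => a q - z) -> negligibleT (fun q => b q - w) ->
  negligibleT (fun q => c * a q + b q - (c * z + w)).
Proof.
move=> ha hb; apply: negligibleT_near (negligibleT_lin c ha hb).
by near=> q; ring.
Unshelve. all: by end_near. Qed.

Lemma FilMDadm_limit j g : FilMDadm j g -> exists z : R,
  negligibleT (fun q => (1 - q) ^+ j * pseval g q - z).
Proof.
apply: (@bracket_span_psevalP _ j
  (fun a : R -> R => exists z : R, negligibleT (fun q => a q - z))).
- move=> a b ab [z hz]; exists z; apply: negligibleT_near hz.
  by near=> q; rewrite (near ab q).
- exists 0; under eq_fun do rewrite subrr; exact: negligibleT0.
- move=> c a b [z hz] [w hw]; exists (c * z + w); exact: negligibleT_lin_lim.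
move=> s /andP[sadm sj]; have s1 : is_index s by case/andP: sadm.
(* Brackets of weight below j have limit 0; at weight exactly j the limit is 1 for the empty index
   and a multiple zeta value otherwise. *)
case: (ltnP (sumn s) j) => sj'.
  exists 0; under eq_fun do rewrite subr0.
  apply: (FilMD_negligibleT sj'); apply: bracket_span_bracket.
  by rewrite s1 leqnn.
have {sj sj'} <- : sumn s = j by apply/eqP; rewrite eqn_leq sj.
case: s s1 sadm => [|a s] s1 sadm.
  exists 1; apply: negligibleT_near negligibleT0; apply: near_left1 => q /andP[q0 q1].
  by rewrite bracket_nil pseval1 ?mulr1 ?expr0 ?subrr // ltW.
have a1 : (1 < a)%N by case/andP: sadm.
have [z hz] := kbr_adm_limit a1 (proj2 (andP s1)); exists z.
have lt1 : ((sumn (a :: s)).-1 < sumn (a :: s))%N by rewrite prednK //= addn_gt0 ltnW.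
apply: negligibleT_near (negligibleT_lin 1 (FilMD_negligibleT lt1 (bracket_kbr s1)) hz).
apply: near_left1 => q /andP[q0 q1].
by rewrite (pseval_bracket_kbr s1) ?mulrDr ?mul1r ?addrA // ltW.
Unshelve. all: by end_near. Qed.

End Asymptotics.

(** * Vanishing of Z^alg *)

Section ZalgZero.
Variable R : realType.
Implicit Types (q : R) (s : seq nat) (f g : qseries).

Lemma cvg_sum_left1 (I : Type) (r : seq I) (F : I -> R -> R) (l : I -> R) :
  (forall i, F i @ (1 : R)^'- --> l i) ->
  (fun q => \sum_(i <- r) F i q) @ (1 : R)^'- --> \sum_(i <- r) l i.
Proof.
move=> Fl; elim: r => [|i r IH].
  by under eq_fun do rewrite big_nil; rewrite big_nil; apply: cvg_cst.
under eq_fun do rewrite big_cons.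
by rewrite big_cons; apply: cvgD => //; apply: Fl.
Qed.

(** Since T tends to infinity, dividing P(T) by T^n isolates the top coefficient as a limit; it is
    therefore 0 and the size bound drops by one. *)
Lemma poly_Tval_eq0 (P : {poly R}) :
  (fun q => P.[Tval q]) @ (1 : R)^'- --> (0 : R) -> P = 0.
Proof.
move=> P0; have [n] := ubnP (size P); elim: n => // n IH; rewrite ltnS => sP.
case: n IH sP => [|n] IH sP; first by apply/eqP; rewrite -size_poly_leq0.
suff Pn : P`_n = 0.
  apply: IH; rewrite ltnS; apply/leq_sizeP => j; rewrite leq_eqVlt => /orP[/eqP<-//|nj].
  by rewrite nth_default // (leq_trans sP).
have V0 : (fun q : R => (Tval q)^-1) @ (1 : R)^'- --> (0 : R).
  apply/gtr0_cvgV0; last exact: Tval_cvgy.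
  by near=> q; apply: lt_le_trans ltr01 _; near: q; apply: near_Tval_ge1.
have VX m : (fun q : R => (Tval q)^-1 ^+ m) @ (1 : R)^'- --> (0 ^+ m : R).
  elim: m => [|m IHm]; first by under eq_fun do rewrite expr0; apply: cvg_cst.
  by under eq_fun do rewrite exprS; rewrite exprS; apply: cvgM.
have lim1 : (fun q => P.[Tval q] * (Tval q)^-1 ^+ n) @ (1 : R)^'- --> (0 : R).
  by rewrite -[X in _ --> X](mul0r (0 ^+ n : R)); apply: cvgM.
have lim2 : (fun q => \sum_(i < n.+1) P`_i * (Tval q)^-1 ^+ (n - i)) @ (1 : R)^'-
    --> \sum_(i < n.+1) P`_i * 0 ^+ (n - i).
  by apply: cvg_sum_left1 => i; apply: cvgM; [apply: cvg_cst|apply: VX].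
have -> : P`_n = \sum_(i < n.+1) P`_i * 0 ^+ (n - i).
  rewrite big_ord_recr /= subnn expr0 mulr1 big1 ?add0r // => i _.
  by rewrite expr0n subn_eq0 leqNgt ltn_ord mulr0.
apply: (norm_cvg_unique lim2); apply: cvg_trans lim1; apply: near_eq_cvg.
near=> q; have T1 : 1 <= Tval q by near: q; apply: near_Tval_ge1.
have Tn0 : Tval q != 0 by rewrite gt_eqF // (lt_le_trans ltr01).
rewrite (horner_coef_wide _ sP) mulr_suml; apply: eq_bigr => i _.
have iN : (i <= n)%N by rewrite -ltnS.
have -> : (Tval q)^-1 ^+ n = (Tval q)^-1 ^+ i * (Tval q)^-1 ^+ (n - i).
  by rewrite -exprD subnKC.
by rewrite -mulrA; congr (_ * _); rewrite mulrA -exprMn mulfV // expr1n mul1r.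
Unshelve. all: by end_near. Qed.

Definition vanishes k f := (fun q : R => (1 - q) ^+ k * pseval f q) @ (1 : R)^'- --> (0 : R).

Lemma negligibleT_vanishes k f :
  negligibleT (fun q : R => (1 - q) ^+ k * pseval f q) -> vanishes k f.
Proof. by move=> /(_ 0%N); under eq_fun do rewrite expr0 mulr1. Qed.

Lemma negligibleT_is_Z j g z :
  negligibleT (fun q : R => (1 - q) ^+ j * pseval g q - z) -> is_Z j g z.
Proof.
move=> /(_ 0%N); under eq_fun do rewrite expr0 mulr1; move=> h.
have h2 : (fun q : R => (1 - q) ^+ j * pseval g q - z + z) @ (1 : R)^'- --> (0 + z : R).
  by apply: cvgD => //; apply: cvg_cst.
by move: h2; rewrite add0r; under eq_fun do rewrite subrK.
Qed.

(** For an arbitrary decomposition, (1 - q)^k f(q) - P(T) is the sum of the errors of the g_j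
    multiplied by T^(k-j), each tending to 0; hence P(T) tends to 0. *)
Lemma Zalg_graph_eq0 k f (P : {poly R}) : vanishes k f -> Zalg_graph k f P -> P = 0.
Proof.
move=> fv [_ [g [z [/expandable_expansion[gadm fE] gz ->]]]].
have gT (j : 'I_k.+1) : negligibleT (fun q : R => (1 - q) ^+ j * pseval (g j) q - z j).
  (* The graph only provides a limit [z j] without rate; it is identified with the limit from
     [FilMDadm_limit], which carries one. *)
  have jk : (j <= k)%N by rewrite -ltnS.
  have [w hw] := @FilMDadm_limit R _ _ (gadm j jk).
  by have -> : z j = w by apply: (norm_cvg_unique (gz j jk) (negligibleT_is_Z hw)).
apply: poly_Tval_eq0.
have S0 : (fun q => \sum_(j < k.+1)
    ((1 - q) ^+ j * pseval (g j) q - z j) * Tval q ^+ (k - j)) @ (1 : R)^'- -->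
    (\sum_(j < k.+1) 0 : R).
  by apply: cvg_sum_left1 => j; apply: gT.
rewrite big1 // in S0.
rewrite -[X in _ --> X](subrr 0).
apply: cvg_trans (cvgB fv S0); apply: near_eq_cvg.
apply: near_left1 => q /andP[q0 q1]; have q01 : 0 <= q < 1 by rewrite ltW.
have tg (j : 'I_k.+1) : tempered R (g j).
  by apply: (@tempered_span R _ _ (gadm j _)); rewrite -ltnS.
have t1 : tempered R (bracket [:: 1%N]) by exact: tempered_bracket.
transitivity ((1 - q) ^+ k * pseval f q - \sum_(j < k.+1)
    ((1 - q) ^+ j * pseval (g j) q - z j) * Tval q ^+ (k - j)); first by [].
rewrite fE pseval_sum // => [|j]; last by apply: temperedM => //; apply: temperedX.
rewrite mulr_sumr -sumrB horner_sum; apply: eq_bigr => j _.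
rewrite hornerZ hornerXn psevalM ?psevalX //; last exact: temperedX.
have jk : (j <= k)%N by rewrite -ltnS.
have -> : (1 - q) ^+ k = (1 - q) ^+ j * (1 - q) ^+ (k - j) by rewrite -exprD subnKC.
by rewrite /Tval exprMn; ring.
Qed.

(** [FilMD_expandable] and [FilMDadm_limit] make the graph nonempty over f, and [Zalg_graph_eq0]
    forces every polynomial there to be 0, including the one just built. *)
Lemma Zalg_eq0 k f : FilMD k f -> vanishes k f -> Zalg_eq k f (0 : {poly R}).
Proof.
move=> fk fv Q; split=> [/(Zalg_graph_eq0 fv)//|->].
have [g gE] := FilMD_expandable fk; have /expandable_expansion gE' := gE.
have : forall j, exists z : R, (j <= k)%N -> is_Z j (g j) z.
  move=> j; have [jk|kj] := leqP j k; last by exists 0.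
  have [z hz] := @FilMDadm_limit R _ _ (gE.1 j jk).
  by exists z => _; apply: negligibleT_is_Z.
move=> /choice[z hz].
have gr : Zalg_graph k f (\sum_(j < k.+1) z j *: 'X^(k - j)).
  by split=> //; exists g, z; split.
by rewrite -{1}(Zalg_graph_eq0 fv gr).
Qed.

(** * Derivatives *)

Lemma near_left1_half (P : R -> Prop) : (\forall p \near (1 : R)^'-, P p) ->
  \forall q \near (1 : R)^'-, P ((1 + q) / 2).
Proof.
move=> [e /= e0 he]; exists e => //= q /= qe q1; apply: he => /=; last by lra.
have -> : 1 - (1 + q) / 2 = (1 - q) / 2 by field.
by move: qe; rewrite normrM [`|2^-1|]ger0_norm // => qe; have := normr_ge0 (1 - q); lra.
Qed.

Lemma bracket_ge0 s n : 0 <= bracket s n.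
Proof. by rewrite /bracket divr_ge0. Qed.

Lemma pseval_ge0 f q : tempered R f -> (forall n, 0 <= f n) -> 0 <= q < 1 -> 0 <= pseval f q.
Proof.
by move=> tf f0 q01; have := psum_le_pseval 0 tf f0 q01; rewrite big_ord0.
Qed.

Lemma pseval_qder_le f q : tempered R f -> (forall n, 0 <= f n) -> 0 <= q < 1 ->
  pseval (qder f) q <= 2 / (1 - q) * pseval f ((1 + q) / 2).
Proof.
move=> tf f0 /[dup] q01 /andP[q0 q1].
have p01 : 0 <= (1 + q) / 2 < 1 by lra.
have c := pseval_cvg (tempered_qder tf) q01.
apply: (cvgr_to_le c); near=> N; rewrite pseries_psum.
have e0 : 0 <= 2 / (1 - q) by rewrite divr_ge0 // subr_ge0 ltW.
apply: le_trans (ler_wpM2l e0 (psum_le_pseval N tf f0 p01)).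
rewrite mulr_sumr; apply: ler_sum => n _.
have -> : ratr (qder f n) = n%:R * ratr (f n) :> R.
  by rewrite /qder (rmorphM (ratr : rat -> R)) /= ratr_nat.
rewrite [leRHS]mulrCA mulrAC [leLHS]mulrC ler_wpM2l ?ler0q //.
exact: natmul_expr_le.
Unshelve. all: by end_near. Qed.

(** With p = (1 + q)/2 one has 1 - p = (1 - q)/2, so [pseval_qder_le] costs one power of 1 - q and
    leaves (1 - p)^(w+1) times the bracket at p, up to the constant 2 2^(w+1). This tends to 0
    because the bracket has weight w < w + 1. *)
Lemma qder_bracket_vanishes k s : is_index s -> ((sumn s).+2 <= k)%N ->
  vanishes k (qder (bracket s)).
Proof.
move=> s1 sk; set w := sumn s.
have bF : FilMD w (bracket s) by apply: bracket_span_bracket; rewrite s1 leqnn.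
have := negligibleT_vanishes (FilMD_negligibleT (ltnSn w) bF).
move=> /cvgr0Pnorm_le hb; apply/cvgr0Pnorm_le => e e0.
have e0' : 0 < e / (2 * 2 ^+ w.+1) by rewrite divr_gt0 // mulr_gt0 // exprn_gt0.
have hh := near_left1_half (hb _ e0'); near=> q.
have hq : `|(1 - (1 + q) / 2) ^+ w.+1 * pseval (bracket s) ((1 + q) / 2)| <=
    e / (2 * 2 ^+ w.+1) by near: q.
have q01 : 0 < q < 1 by near: q; apply: near_left1.
case/andP: (q01) => q0 q1.
have q01' : 0 <= q < 1 by rewrite ltW.
have p01 : 0 <= (1 + q) / 2 < 1 by lra.
have tb : tempered R (bracket s) by exact: tempered_bracket.
have d0' : 0 <= 1 - q by rewrite subr_ge0 ltW.
have d0 : 0 <= pseval (qder (bracket s)) q.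
  apply: pseval_ge0 => //; first exact: tempered_qder.
  by move=> n; rewrite /qder mulr_ge0 // bracket_ge0.
have b0 : 0 <= pseval (bracket s) ((1 + q) / 2).
  by apply: pseval_ge0 => // n; apply: bracket_ge0.
have pE : 1 - (1 + q) / 2 = (1 - q) / 2 by field.
rewrite ger0_norm ?mulr_ge0 ?exprn_ge0 //.
move: hq; rewrite pE ger0_norm ?mulr_ge0 ?exprn_ge0 ?divr_ge0 // => hq.
have h1 : (1 - q) ^+ k <= (1 - q) ^+ w.+2.
  by apply: ler_wiXn2l => //; rewrite gerBl ltW.
apply: le_trans (ler_pM _ _ h1 (pseval_qder_le tb (@bracket_ge0 s) q01')) _ => //.
  exact: exprn_ge0.
have -> : (1 - q) ^+ w.+2 * (2 / (1 - q) * pseval (bracket s) ((1 + q) / 2)) =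
   2 * 2 ^+ w.+1 * (((1 - q) / 2) ^+ w.+1 * pseval (bracket s) ((1 + q) / 2)).
  rewrite expr_div_n [(1 - q) ^+ w.+2]exprS; field.
  by rewrite expf_neq0 ?pnatr_eq0 //= subr_eq0 gt_eqF.
by rewrite mulrC -ler_pdivlMr // mulr_gt0 // exprn_gt0.
Unshelve. all: by end_near. Qed.

Lemma vanishes_lin k c f g : tempered R f -> tempered R g ->
  vanishes k f -> vanishes k g -> vanishes k (c *: f + g).
Proof.
move=> tf tg vf vg; rewrite /vanishes.
have h : (fun q : R => ratr c * ((1 - q) ^+ k * pseval f q) + (1 - q) ^+ k * pseval g q)
    @ (1 : R)^'- --> (ratr c * 0 + 0 : R).
  by apply: cvgD => //; apply: cvgM => //; apply: cvg_cst.
rewrite mulr0 addr0 in h; apply: cvg_trans h; apply: near_eq_cvg.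
apply: near_left1 => q /andP[q0 q1]; have q01 : 0 <= q < 1 by rewrite ltW.
by rewrite psevalD ?psevalZ //; [rewrite mulrDr mulrCA|exact: temperedZ].
Qed.

Lemma vanishes0 k : vanishes k 0.
Proof.
have h : (fun q : R => (0 : R)) @ (1 : R)^'- --> (0 : R) by exact: cvg_cst.
apply: cvg_trans h; apply: near_eq_cvg; apply: near_left1 => q /andP[q0 q1].
by rewrite pseval0 ?mulr0 // ltW.
Qed.

Lemma qder_vanishes k f : FilMD (k - 2) f -> vanishes k (qder f).
Proof.
(* Temperedness is carried through the induction because linearity of [pseval] is established for
   tempered series. *)
move=> fk; suff [] : tempered R f /\ vanishes k (qder f) by [].
move: f fk; apply: (@bracket_span_rect _
  (fun f => tempered R f /\ vanishes k (qder f))) => [|c f g [tf vf] [tg vg]|s /andP[s1 sk]].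
- by split; [exact: tempered0|rewrite qder0; exact: vanishes0].
- split; first by apply: temperedD => //; apply: temperedZ.
  by rewrite qderD qderZ; apply: vanishes_lin => //; apply: tempered_qder.
split; first exact: tempered_bracket.
case: s s1 sk => [|a s] s1 sk; first by rewrite bracket_nil qder1; exact: vanishes0.
apply: qder_bracket_vanishes => //.
by move: s1 sk => /andP[a0 _] /=; lia.
Qed.

(** Without constant term only n >= 1 matters, where y^n <= 2 y (1/2)^n for y <= 1/2; C is twice a
    bound for the absolute series at 1/2. *)
Lemma pseval_le_near0 f : tempered R f -> f 0%N = 0 ->
  exists2 C : R, 0 <= C & forall y, 0 <= y <= 1 / 2 -> `|pseval f y| <= C * y.
Proof.
move=> tf f00; have h01 : 0 <= (1 / 2 : R) < 1 by lra.
have [C hC] := tf _ h01.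
have C0 : 0 <= C by have := hC 0%N; rewrite big_ord0.
exists (C * 2) => [|y /andP[y0 y2]]; first by rewrite mulr_ge0.
have y01 : 0 <= y < 1 by lra.
have c : (fun N => `|pseries (fun n => ratr (f n)) y N|) @ \oo --> `|pseval f y|.
  by apply: cvg_norm; apply: pseval_cvg.
apply: (cvgr_to_le c); near=> N; rewrite pseries_psum.
apply: le_trans (ler_norm_sum _ _ _) _.
apply: (@le_trans _ _ (\sum_(n < N) (`|ratr (f n)| * (1 / 2) ^+ n) * (2 * y))); last first.
  by rewrite -mulr_suml -[leRHS]mulrA ler_wpM2r // mulr_ge0.
apply: ler_sum => -[[|n] nN] _ /=; first by rewrite f00 rmorph0 mul0r normr0 !mul0r.
rewrite normrM -mulrA ler_wpM2l // ger0_norm ?exprn_ge0 //.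
rewrite !exprS.
have -> : 1 / 2 * (1 / 2) ^+ n * (2 * y) = y * (1 / 2) ^+ n by field.
by rewrite ler_wpM2l // lerXn2r // nnegrE.
Unshelve. all: by end_near. Qed.

End ZalgZero.

(** * Cusp forms on the imaginary axis *)

Section CuspForms.
Variable R : realType.
Local Open Scope complex_scope.
Implicit Types (q t x : R) (f : qseries).

Lemma qparam_imag t : qparam (0 +i* t) = (expR (- (2 * pi * t)))%:C.
Proof.
rewrite /qparam /cexp; simpc => /=.
by rewrite cos0 sin0 mulr1 mulr0.
Qed.

Lemma qexpansion_imag (F : R[i] -> R[i]) f t : tempered R f -> has_qexpansion F f -> 0 < t ->
  F (0 +i* t) = (pseval f (expR (- (2 * pi * t))))%:C.
Proof.
move=> tf /(_ (0 +i* t)) Ff t0.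
have x01 : 0 <= expR (- (2 * pi * t)) < 1.
  by rewrite expR_ge0 expR_lt1 oppr_lt0 !mulr_gt0 // pi_gt0.
have c := pseval_cvg tf x01.
have c' : (fun N => (pseries (fun n => ratr (f n)) (expR (- (2 * pi * t))) N)%:C : R[i]^o)
    @ \oo --> ((pseval f (expR (- (2 * pi * t))))%:C : R[i]^o).
  apply/cvgrPdist_lt => -[e1 e2]; rewrite ltcE /= => /andP[/eqP-> e0].
  move/cvgrPdist_lt: c => /(_ _ e0); apply: filterS => N.
  by rewrite -rmorphB normc_def /= expr0n addr0 sqrtr_sqr -complexr0 ltcR.
apply: (norm_cvg_unique (Ff t0)).
have -> : series (fun n => ratr (f n) * qparam (0 +i* t) ^+ n) =
    (fun N => (pseries (fun n => ratr (f n)) (expR (- (2 * pi * t))) N)%:C) :> (nat -> R[i]).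
  apply/funext => N; rewrite /series /= big_mkord pseries_psum rmorph_sum.
  apply: eq_bigr => n _; rewrite qparam_imag [RHS]rmorphM rmorphXn /=.
  by rewrite (fmorph_rat (real_complex R)).
exact: c'.
Qed.

Lemma imag_inversion (F : R[i] -> R[i]) k t : modular_uhp k F -> 0 < t ->
  F (0 +i* t^-1) = (0 +i* t) ^+ k * F (0 +i* t).
Proof.
move=> Fmod t0; have t0' : t != 0 by rewrite gt_eqF.
have := Fmod 0 (-1) 1 0 _ (0 +i* t) t0; rewrite mul0r add0r mulN1r opprK => /(_ erefl).
rewrite mul0r add0r mul1r addr0 => <-; congr F.
have i0 : 0 +i* t != 0 :> R[i] by rewrite eq_complex /= (negPf t0') andbF.
apply: (mulIf i0); rewrite mulfVK //; simpc.
rewrite mulVf // (_ : (-1)%:~R = -1 :> R[i]) //; apply/eqP.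
by rewrite eq_complex /= oppr0 !eqxx.
Qed.

(** The transformation tau |-> -1/tau at tau = i t; absolute values turn the automorphy factor (i
    t)^k into t^k. *)
Lemma cusp_functional_equation k f t : tempered R f -> is_cusp_form R k f -> 0 < t ->
  `|pseval f (expR (- (2 * pi / t)))| = t ^+ k * `|pseval f (expR (- (2 * pi * t)))|.
Proof.
move=> tf [[F [_ Fmod Fq]] _] t0; have ti0 : 0 < t^-1 by rewrite invr_gt0.
have := imag_inversion Fmod t0; rewrite !(qexpansion_imag tf Fq) // => e.
have ntau : `|0 +i* t : R[i]| = t%:C.
  by rewrite normc_def /= expr0n add0r sqrtr_sqr gtr0_norm.
have nreal (x : R) : `|x%:C : R[i]| = `|x|%:C.
  by rewrite normc_def /= expr0n addr0 sqrtr_sqr.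
have := congr1 (fun z => `|z|) e; rewrite /= normrM normrX ntau !nreal.
by rewrite -rmorphXn -rmorphM => /complexI.
Qed.

Lemma left1_linear_cvg0 (D : R) : 0 <= D ->
  (fun q : R => D * (1 - q)) @ (1 : R)^'- --> (0 : R).
Proof.
move=> D0; apply/cvgr0Pnorm_le => e e0.
have De : 0 < D + 1 by rewrite ltr_wpDl.
have eD : 0 < e / (D + 1) by rewrite divr_gt0.
near=> q; have q01 : 0 < q < 1 by near: q; apply: near_left1.
have e1 : 0 <= 1 - q by case/andP: q01 => _ /ltW; rewrite subr_ge0.
rewrite ger0_norm ?mulr_ge0 //.
have h : 1 - q < e / (D + 1) by near: q; apply: nbhs_left_ltBl.
move: h; rewrite ltr_pdivlMr // mulrC => /ltW; apply: le_trans.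
by rewrite ler_wpM2r // lerDl.
Unshelve. all: by end_near. Qed.

(** Writing q = exp(-2 pi t) and y = exp(-2 pi/t), one has 1 - q <= 2 pi t and t^k |f(q)| = |f(y)|
    <= C y <= C t <= 2 C (1 - q), whence (1 - q)^k |f(q)| is O(1 - q). *)
Lemma cusp_vanishes k f : tempered R f -> is_cusp_form R k f -> vanishes R k f.
Proof.
move=> tf fc; have [C C0 hC] := pseval_le_near0 tf fc.2.
have pi2 : 2 <= pi :> R by exact: pi_ge2.
have pi0 : 0 < pi :> R by exact: pi_gt0.
have D0 : 0 <= (2 * pi) ^+ k * (C * 2) by rewrite !mulr_ge0 ?exprn_ge0 // mulr_ge0 // ltW.
apply/norm_cvg0P.
have h0 := left1_linear_cvg0 D0.
apply: (squeeze_cvgr _ (@cvg_cst _ _ _ _ _) h0).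
near=> q; rewrite normr_ge0 /=.
have q01 : 0 < q < 1 by near: q; apply: near_left1.
(* This gives 1/q <= 1 + 2 (1 - q), and 2 (1 - q) <= 1/2, so that y <= t <= 1/2 is in the range of
   the estimate near 0. *)
have q34 : 3 / 4 <= q by near: q; apply: nbhs_left_ge; lra.
case/andP: (q01) => q0 q1.
have [t t0 qE] : exists2 t : R, 0 < t & expR (- (2 * pi * t)) = q.
  have p20 : 0 < 2 * pi :> R by rewrite mulr_gt0.
  have lnq : ln q < 0 by rewrite ln_lt0 // q0.
  exists (- ln q / (2 * pi)); first by rewrite divr_gt0 ?oppr_gt0.
  by rewrite mulrC divfK ?gt_eqF // opprK lnK // posrE.
have fe := cusp_functional_equation tf fc t0; rewrite qE in fe.
have h1 : 1 - q <= 2 * pi * t.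
  by have := expR_ge1Dx (- (2 * pi * t)); rewrite qE; lra.
have h2 : 2 * pi * t <= 2 * (1 - q).
  have : expR (2 * pi * t) = q^-1 by rewrite -qE expRN invrK.
  have := expR_ge1Dx (2 * pi * t) => + e; rewrite e => h.
  have : q^-1 <= 1 + 2 * (1 - q).
    by rewrite -[q^-1]mul1r ler_pdivrMr //; nra.
  lra.
set y := expR (- (2 * pi / t)) in fe.
have y0 : 0 <= y by exact: expR_ge0.
have yt : y <= t.
  (* The crude bound exp(2 pi/t) >= 2 pi/t >= 1/t is enough, although y decays much faster than
     t. *)
  have a0 : 0 < 2 * pi / t by rewrite divr_gt0 // mulr_gt0.
  rewrite /y expRN -[leRHS]invrK lef_pV2 ?posrE ?expR_gt0 ?invr_gt0 //.
  apply: le_trans (expR_ge1Dx _); rewrite -div1r.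
  by apply: (@le_trans _ _ (2 * pi / t)); [rewrite ler_wpM2r ?invr_ge0 ?(ltW t0) //; lra|lra].
have tq : t <= 2 * (1 - q) by nra.
have hy : `|pseval f y| <= C * y by apply: hC; lra.
rewrite normrM ger0_norm ?exprn_ge0 ?subr_ge0 ?(ltW q1) //.
apply: (@le_trans _ _ ((2 * pi * t) ^+ k * `|pseval f q|)).
  rewrite ler_wpM2r // lerXn2r // nnegrE ?subr_ge0 ?(ltW q1) //.
  by rewrite !mulr_ge0 ?(ltW pi0) ?(ltW t0).
have -> : (2 * pi * t) ^+ k * `|pseval f q| = (2 * pi) ^+ k * (t ^+ k * `|pseval f q|).
  by rewrite (exprMn k (2 * pi)) mulrA.
rewrite -fe -[leRHS]mulrA ler_wpM2l ?exprn_ge0 ?mulr_ge0 ?(ltW pi0) // -mulrA.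
apply: le_trans hy _; rewrite ler_wpM2l //.
exact: le_trans yt tq.
Unshelve. all: by end_near. Qed.

End CuspForms.

(* In the second item, k - 2 is truncated: for k < 2 the span of 1 and the
   brackets of weight at most k - 2 is the span of 1, i.e. FilMD 0. *)
Theorem mainTheorem3 (R : realType) (k : nat) :
  [/\ (forall s : seq nat, is_index s -> (sumn s < k)%N ->
         Zalg_eq k (bracket s) (0 : {poly R})),
      (forall f : qseries, FilMD (k - 2)%N f ->
         Zalg_eq k (qder f) (0 : {poly R}))
    & (forall f : qseries, FilMD k f -> is_cusp_form R k f ->
         Zalg_eq k f (0 : {poly R}))].
Proof.
split=> [s s1 sk|f fk|f fk fc].
- have sF : FilMD (sumn s) (bracket s) by apply: bracket_span_bracket; rewrite s1 leqnn.
  apply: Zalg_eq0; first exact: FilMD_le (ltnW sk) sF.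
  exact: negligibleT_vanishes (FilMD_negligibleT sk sF).
- by apply: Zalg_eq0; [exact: qder_FilMD|exact: qder_vanishes].
- apply: Zalg_eq0 => //; apply: cusp_vanishes => //.
  exact: tempered_FilMD fk.
Qed.
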